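(* Let $X \subseteq [0,1]$. The following are equivalent: (1) There is an endpoint-homogeneous, $X$-EPG smooth fan. (2) There is an $X$-EPG smooth fan. (3) One of the following holds: (a) $X = \emptyset$, $X = \{1\}$, or $X = [0,1]$; or (b) $X$ is a closed subset of $[0,1]$ with $0 \in X$ and $1 \notin X$; or (c) $X$ is a closed subset of $[0,1]$ with $0,1 \in X$, and $1$ is an isolated point of $X$.
   Context: A continuum is a nonempty compact connected metric space. A continuum is unicoherent if whenever it is the union of two subcontinua $A,B$, the set $A\cap B$ is connected; it is hereditarily unicoherent if every subcontinuum is unicoherent. A dendroid is an arcwise connected, hereditarily unicoherent continuum. In a dendroid $D$, any two distinct points $x,y$ are the endpoints of exactly one arc, denoted $[x,y]$ (and $[x,x]=\{x\}$). A point of $D$ is an endpoint of $D$ if it is an endpoint of every arc in $D$ that contains it; $E(D)$ denotes the set of endpoints. A ramification point of $D$ is the common point (top) of some simple triod contained in $D$ (a simple triod is three arcs glued together at one endpoint). A fan is a dendroid with exactly one ramification point $t$, called its top. A blade of a fan $F$ is an arc $[t,e]$ with $e\in E(F)$; $\mathcal{B}(F)$ is the set of blades. A fan $F$ with top $t$ is smooth if for every convergent sequence $(x_n)$ in $F$, $\lim_{n\to\infty}[t,x_n]=[t,\lim_{n\to\infty} x_n]$ in the Hausdorff metric. A fan $F$ is endpoint-homogeneous if for any $e,e'\in E(F)$ there is a homeomorphism $h:F\to F$ with $h(e)=e'$. Given $X\subseteq[0,1]$, a fan $F$ with top $t$ is $X$-EPG ($X$-endpoint generated) if for every $B\in\mathcal{B}(F)$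 there is a homeomorphism $\phi:[0,1]\to B$ with $\phi(0)=t$ and $\phi[X]=B\cap\overline{E(F)\setminus B}$. *)

(* Defs.v *)
From HB Require Import structures.
From mathcomp Require Import all_boot all_order all_algebra.
From mathcomp Require Import all_classical all_reals all_analysis.

Set Implicit Arguments.
Unset Strict Implicit.
Unset Printing Implicit Defensive.

Import Order.TTheory GRing.Theory Num.Theory.
Import numFieldNormedType.Exports.

Local Open Scope classical_set_scope.
Local Open Scope ring_scope.

(* Continua are represented as subsets of an arbitrary ambient metric space,
   with the induced metric; taking the subset [set: M] gives back the metric
   space M itself. *)

(* [f] restricts to a homeomorphism from the subspace [A] onto the subspace [B];
   its values outside [A] are irrelevant. *)
Definition homeomorphism {T U : topologicalType}
    (A : set T) (B : set U) (f : T -> U) : Prop :=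
  [/\ set_bij A B f, {within A, continuous f} &
      exists g : U -> T,
        (forall x, A x -> g (f x) = x) /\ {within B, continuous g}].

Section Continua.
Context {R : realType} {M : metricType R}.
Implicit Types (A B C D F K S : set M) (p t x y z : M).

Definition continuum K : Prop := [/\ K !=set0, compact K & connected K].

Definition unicoherent K : Prop := forall A B,
  continuum A -> continuum B -> A `|` B = K -> connected (A `&` B).

Definition hereditarily_unicoherent D : Prop := forall K,
  K `<=` D -> continuum K -> unicoherent K.

(* [A] is an arc with endpoints [x] and [y]; this forces [x != y]. *)
Definition arc_between A x y : Prop := exists phi : R -> M,
  [/\ homeomorphism (`[0, 1] : set R) A phi, phi 0 = x & phi 1 = y].

Definition arcwise_connected D : Prop := forall x y,
  D x -> D y -> x != y -> exists2 A, A `<=` D & arc_between A x y.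

Definition dendroid D : Prop :=
  [/\ continuum D, arcwise_connected D & hereditarily_unicoherent D].

(* The arc [x,y] of a dendroid [D], with [x,x] = {x}. In a dendroid the arc
   chosen by [xget] is the only one; the default value [set0] is never
   returned when [x] and [y] lie in [D]. *)
Definition segment D x y : set M :=
  if x == y then [set x]
  else xget set0 [set A | A `<=` D /\ arc_between A x y].

Definition endpoints D : set M := [set p | D p /\
  forall A x y, A `<=` D -> arc_between A x y -> A p -> p = x \/ p = y].

Definition simple_triod S p : Prop := exists A B C x y z,
  [/\ [/\ arc_between A p x, arc_between B p y & arc_between C p z],
      [/\ A `&` B = [set p], A `&` C = [set p] & B `&` C = [set p]] &
      S = A `|` B `|` C].

Definition ramification_points D : set M :=
  [set p | exists2 S, S `<=` D & simple_triod S p].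

(* [F] is a fan with top [t]. *)
Definition fan F t : Prop := dendroid F /\ ramification_points F = [set t].

Definition blades F t : set (set M) := [set segment F t e | e in endpoints F].

(* The infimum is taken over a nonempty set when [A] and [B] are nonempty and
   bounded, in particular for the compact sets to which it is applied. *)
Definition hausdorff_dist A B : R := inf [set r : R |
  [/\ 0 < r, forall a, A a -> exists2 b, B b & mdist a b < r &
      forall b, B b -> exists2 a, A a & mdist a b < r]].

Definition smooth_fan F t : Prop := fan F t /\
  forall (x : nat -> M) (l : M), (forall n, F (x n)) -> F l ->
    x n @[n --> \oo] --> l ->
    hausdorff_dist (segment F t (x n)) (segment F t l) @[n --> \oo] --> (0 : R).

Definition endpoint_homogeneous F : Prop := forall e e',
  endpoints F e -> endpoints F e' ->
  exists h : M -> M, homeomorphism F F h /\ h e = e'.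

(* The fan [F] with top [t] is X-endpoint generated. The closure is taken in
   the ambient space, where a compact [F] is closed. *)
Definition endpoint_generated (X : set R) F t : Prop := forall B, blades F t B ->
  exists phi : R -> M, [/\ homeomorphism (`[0, 1] : set R) B phi, phi 0 = t &
    phi @` X = B `&` closure (endpoints F `\` B)].

End Continua.

(* Main.v *)
Require Import Defs.
From Stdlib Require Import Relation_Operators.
From HB Require Import structures.
From mathcomp Require Import all_boot all_order all_algebra.
From mathcomp Require Import all_classical all_reals all_analysis.
From mathcomp Require Import ring lra zify.

(* A smooth fan is ordered from its top outwards, and smoothness makes this order
   closed, hence the maximal points exist and are the endpoints. The point set
   above [q] depends upper semicontinuously on [q], so by Baire it varies
   continuously at some point [q] of any nonempty open set; endpoints of blades
   passing near such a [q] can only accumulate, above [q], at the endpoint of the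
   blade of [q]. A point of [[0, 1]] missing from [X] provides an open set on
   which this yields a contradiction unless (3) holds.

   Conversely, every upper semicontinuous [f] from binary sequences to [[0, 1]]
   defines a smooth fan in the plane, with a blade of length [f c] in the
   direction of the point of a Cantor set coded by [c], and the endpoint [tip c]
   when [0 < f c]. For [X] empty, [{1}] and [[0, 1]] take infinite products
   [f c = \prod_i w_i ^ c_i]: adding a fixed sequence modulo 2 only multiplies [f]
   by a continuous factor, whence homogeneity. For [0 \in X] and [1 \notin X]
   take the self-similar [f] given by [f 0 = 1] and
   [f (0^n 1 v) = h_n (f v)], where the values [h_n 1] cluster exactly at [X]
   while [h_n] is nearly [0] on a segment [[0, b]] containing all the values of
   [f] below [1]. Finally, composing this [f] with [c |-> (c_0, c_2, c_4, ...)]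
   adds [1] to [X]. *)

Set Implicit Arguments.
Unset Strict Implicit.
Unset Printing Implicit Defensive.

Import Order.TTheory GRing.Theory Num.Theory.
Import numFieldNormedType.Exports.

Local Open Scope classical_set_scope.
Local Open Scope ring_scope.

(** * Arcs *)

(** The parametrizations of two blades are unrelated: a point near [phi u] on another blade may have
    any parameter below [1] there. Only being a limit of endpoints passes from blade to blade. So an
    interior point omitted from [X] can be used only against an [X] with points in every interval
    from [v < 1] to [1], and shows that such an [X] is impossible. When [0] is omitted, smoothness
    keeps whole initial segments away from the endpoints, and a single point of [X] below [1] is
    already contradictory.

    In the constructions the difficulty is to make all blades alike. In the self-similar fan a code
    of positive height has finitely many ones, so each blade arises from the main one by finitely
    many grafts, each realized by a homeomorphism swapping two cylinders. Blades grafted more than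
    once could spoil the limits along the main blade; the nearly flat part of [h_n] sends them to
    the top, which [0 \in X] permits. Reading only the bits [c_0, c_2, ...] leaves bits free that
    change the blade but not its height, so every endpoint becomes a limit of endpoints. *)

Lemma continuous_within_comp {S T U : topologicalType} (A : set S) (B : set T)
    (f : S -> T) (g : T -> U) :
  {within A, continuous f} -> {within B, continuous g} ->
  (forall x, A x -> B (f x)) -> {within A, continuous (g \o f)}.
Proof.
move=> /subspace_continuousP fc /subspace_continuousP gc AB.
apply/subspace_continuousP => x Ax.
move=> W gW; have := gc _ (AB _ Ax) _ gW; rewrite !nbhs_simpl /=.
rewrite /within /= => gW'; have := fc _ Ax _ gW'; rewrite !nbhs_simpl /= => H.
have : within A (nbhs x) A by exact: withinT.
by apply: filterS2 H => y /= Hy Ay; apply: Hy; exact: AB.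
Qed.

Lemma homeomorphism_compact {T : ptopologicalType} {U : topologicalType}
    (A : set T) (f : T -> U) : hausdorff_space U -> compact A ->
  {within A, continuous f} -> set_inj A f -> homeomorphism A (f @` A) f.
Proof.
move=> hU cA fc fi.
pose g y := xget point [set x | A x /\ f x = y].
have gf x : A x -> g (f x) = x.
  move=> Ax; rewrite /g; have := @xgetPex _ point [set y | A y /\ f y = f x].
  move=> /(_ (ex_intro _ x (conj Ax erefl))) [Ay fE].
  by apply: fi; rewrite ?inE.
split => //; first by split => // x Ax; exists x.
exists g; split => //; apply/continuous_closedP => W cW.
apply/closed_subspaceP; exists (f @` (A `&` W)).
  apply: compact_closed => //; apply: continuous_compact.
    by apply: continuous_subspaceW fc; exact: subIsetl.
  exact: compact_closedI.
apply/seteqP; split => [y [[x [Ax Wx] <-]] fAy|y [Wy [x Ax xy]]].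
  by split => //; rewrite /from_subspace /preimage /= gf.
split; exists x => //; split => //; move: Wy.
by rewrite /from_subspace /preimage /= -xy gf.
Qed.

Section Arcs.
Context {R : realType} {M : metricType R}.
Implicit Types (A B C D F K S : set M) (p t x y z : M).

Local Notation I01 := (`[0, 1]%classic : set R).

(** No continuous inverse is asked for: compactness of [[0, 1]] provides it, which is how
    [arc_betweenP] recovers [arc_between]. *)
Definition arc_param (phi : R -> M) A x y :=
  [/\ {within I01, continuous phi}, set_inj I01 phi, A = phi @` I01,
      phi 0 = x & phi 1 = y].

Lemma homeomorphism_arc_param phi A :
  homeomorphism I01 A phi -> arc_param phi A (phi 0) (phi 1).
Proof.
move=> [[im inj sur] fc _]; split => //; apply/seteqP.
by split => [z /sur //|z [u u01 <-]]; exact: im.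
Qed.

Lemma arc_betweenP A x y :
  arc_between A x y <-> exists phi, arc_param phi A x y.
Proof.
split=> [[phi [hphi <- <-]]|[phi [fc inj -> p0 p1]]].
  by exists phi; exact: homeomorphism_arc_param.
exists phi; split => //; apply: homeomorphism_compact => //.
  exact: metric_hausdorff.
exact: segment_compact.
Qed.

Lemma itv01P (u : R) : I01 u <-> 0 <= u <= 1.
Proof. by rewrite /= in_itv. Qed.

Lemma arc_continuum A x y : arc_between A x y -> continuum A.
Proof.
move=> /arc_betweenP [phi [fc _ -> p0 _]]; split.
- by exists (phi 0), 0 => //; apply/itv01P; rewrite lexx ler01.
- by apply: continuous_compact => //; exact: segment_compact.
- by apply: connected_continuous_connected => //; exact: segment_connected.
Qed.

Lemma arc_ends A x y : arc_between A x y -> [/\ A x, A y & x != y].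
Proof.
move=> /arc_betweenP [phi [_ inj -> <- <-]].
have I0 : I01 0 by apply/itv01P; rewrite lexx ler01.
have I1 : I01 1 by apply/itv01P; rewrite lexx ler01.
split; [by exists 0|by exists 1|].
apply/eqP => /inj; rewrite !inE => /(_ I0 I1) /eqP.
by rewrite eq_sym oner_eq0.
Qed.

Lemma arc_param_sub phi A x y (u v : R) : arc_param phi A x y ->
  0 <= u -> v <= 1 -> u < v -> arc_between (phi @` `[u, v]) (phi u) (phi v).
Proof.
move=> [fc inj _ _ _] u0 v1 uv; apply/arc_betweenP.
pose h (s : R) := u + (v - u) * s.
have hI s : I01 s -> I01 (h s).
  by rewrite !itv01P /h => /andP[s0 s1]; apply/andP; split; nra.
have hc : continuous h.
  by move=> s; apply: cvgD; [exact: cvg_cst|apply: cvgMl_tmp; exact: cvg_id].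
exists (phi \o h); split.
- apply: continuous_within_comp fc hI; exact: continuous_subspaceT.
- move=> s s' /set_mem Is /set_mem Is' /= /inj; rewrite !inE.
  move=> /(_ (hI _ Is) (hI _ Is')) /addrI /mulfI; apply.
  by rewrite subr_eq0 gt_eqF.
- apply/seteqP; split => [_ [w /= + <-]|_ [s /= + <-]]; rewrite in_itv /= => /andP[h1 h2].
    exists ((w - u) / (v - u)).
      apply/itv01P/andP; split; first by rewrite divr_ge0 ?subr_ge0 // ltW.
      by rewrite ler_pdivrMr ?subr_gt0// mul1r lerD2r.
    rewrite /= /h mulrC divfK ?subr_eq0 ?gt_eqF// addrC subrK //.
  by exists (h s) => //; rewrite /= in_itv /= /h; apply/andP; split; nra.
- by rewrite /h /= mulr0 addr0.
- by rewrite /h /= mulr1 addrC subrK.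
Qed.

Lemma arc_param_split phi A x y (u : R) : arc_param phi A x y ->
  0 <= u <= 1 -> phi @` `[0, u] `&` phi @` `[u, 1] = [set phi u].
Proof.
move=> [_ inj _ _ _] /andP[u0 u1]; apply/seteqP; split => [_ [[v /= + <-]]|_ ->].
  rewrite in_itv/= => /andP[v0 vu] [w /= +].
  rewrite in_itv/= => /andP[uw w1] /inj; rewrite !inE => wv.
  have wvE : w = v.
    by apply: wv; apply/itv01P; apply/andP; split; lra.
  by congr phi; lra.
by split; exists u => //=; rewrite in_itv/= lexx ?u0 ?u1.
Qed.

Lemma arc_sym A x y : arc_between A x y -> arc_between A y x.
Proof.
move=> /arc_betweenP[phi [fc inj -> <- <-]]; apply/arc_betweenP.
have hI (s : R) : I01 s -> I01 (1 - s).
  by rewrite !itv01P => /andP[s0 s1]; apply/andP; split; lra.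
exists (phi \o (fun s => 1 - s)); split.
- apply: continuous_within_comp fc hI; apply: continuous_subspaceT => s.
  by apply: cvgB; [exact: cvg_cst|exact: cvg_id].
- move=> s s' /set_mem Is /set_mem Is' /= /inj; rewrite !inE.
  by move=> /(_ (hI _ Is) (hI _ Is')) /addrI /oppr_inj.
- apply/seteqP; split => _ [w Iw <-]; exists (1 - w) => //=; try exact: hI.
  by rewrite opprB addrC subrK.
- by rewrite /= subr0.
- by rewrite /= subrr.
Qed.

Lemma connected_sub_arc A x y K : arc_between A x y -> K `<=` A ->
  connected K -> K x -> K y -> K = A.
Proof.
move=> [phi [[[im inj sur] fc [g [gphi gc]]] p0 p1]] KA cK Kx Ky.
apply/seteqP; split => // z /sur [u u01 <-].
have gK : connected (g @` K).
  by apply: connected_continuous_connected => //; apply: continuous_subspaceW gc.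
have I0 : I01 0 by apply/itv01P; rewrite lexx ler01.
have I1 : I01 1 by apply/itv01P; rewrite lexx ler01.
have g0 : (g @` K) 0 by exists x => //; rewrite -p0 gphi.
have g1 : (g @` K) 1 by exists y => //; rewrite -p1 gphi.
have := (connected_intervalP (g @` K)).1 gK _ _ g0 g1 u.
move=> /(_ ((itv01P _).1 u01)) [w Kw gwu].
have [w' w'01 ww'] := sur _ (KA _ Kw).
by rewrite -gwu -ww' gphi // ww'.
Qed.

(** [A] and [K] meet, so their union is a continuum and unicoherence makes their intersection
    connected. It contains both ends of the arc, hence all of it. This is the form in which
    hereditary unicoherence is used; when [K] is an arc it gives uniqueness. *)
Lemma arc_sub_continuum D A K x y : hereditarily_unicoherent D ->
  A `<=` D -> K `<=` D -> continuum K -> arc_between A x y -> K x -> K y ->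
  A `<=` K.
Proof.
move=> hD AD KD cK aA Kx Ky; have [Ax Ay _] := arc_ends aA.
have [A0 Ac Acon] := arc_continuum aA; have [K0 Kc Kcon] := cK.
have cAK : continuum (A `|` K).
  split; first by exists x; left.
    exact: compactU.
  by apply: connectedU => //; exists x.
have := hD (A `|` K) _ cAK A K (arc_continuum aA) cK erefl.
rewrite subUset => /(_ (conj AD KD)) conAK z Az.
have := connected_sub_arc aA (@subIsetl _ A K) conAK (conj Ax Kx) (conj Ay Ky).
by move=> E; move: Az; rewrite -E => -[].
Qed.

Lemma arc_unique D A A' x y : hereditarily_unicoherent D ->
  A `<=` D -> A' `<=` D -> arc_between A x y -> arc_between A' x y -> A = A'.
Proof.
move=> hD AD A'D aA aA'; have [Ax Ay _] := arc_ends aA.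
have [A'x A'y _] := arc_ends aA'.
by apply/seteqP; split; apply: (@arc_sub_continuum D _ _ x y) => //;
  apply: arc_continuum; eassumption.
Qed.

End Arcs.

(** * The order of a smooth fan *)

Section MetricTopology.
Context {R : realType} {M : metricType R}.
Implicit Types (A B C D F K S Z : set M) (p t x y z : M).

Lemma nbhs_mdistP p A :
  nbhs p A <-> exists2 e : R, 0 < e & forall y, mdist p y < e -> A y.
Proof.
rewrite -nbhs_ballE; split=> [[e /= e0 pA]|[e e0 pA]]; exists e => //.
  by move=> y py; apply: pA; rewrite ballEmdist.
by move=> y; rewrite ballEmdist; exact: pA.
Qed.

Lemma closure_mdistP A p :
  closure A p <-> forall e : R, 0 < e -> exists2 y, A y & mdist p y < e.
Proof.
split=> [cA e e0|H B /nbhs_mdistP[e e0 pB]].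
  have [|y [Ay By]] := cA [set y | mdist p y < e]; last by exists y.
  by apply/nbhs_mdistP; exists e.
by have [y Ay py] := H _ e0; exists y; split => //; exact: pB.
Qed.

Lemma compact_mdist_closed K : compact K -> closed K.
Proof. by apply: compact_closed; exact: metric_hausdorff. Qed.

Lemma notin_closed_mdist A p : closed A -> ~ A p ->
  exists2 e : R, 0 < e & forall y, A y -> e <= mdist p y.
Proof.
move=> cA nAp; have : ~ closure A p by move=> /cA.
move/closure_mdistP/existsNP => [e /not_implyP[e0 H]]; exists e => // y Ay.
by rewrite leNgt; apply/negP => py; apply: H; exists y.
Qed.

(** The margin [e] tending to [0] is the filter variable of the near-covering form of compactness,
    which turns pointwise margins into a uniform one. [compact_diameter] and [compact_net] do the
    same with large radii and with large finite lists. *)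
Lemma compact_closed_mdist K Z : compact K -> closed Z ->
  (forall x, K x -> ~ Z x) ->
  exists2 e : R, 0 < e & forall x z, K x -> Z z -> e <= mdist x z.
Proof.
move=> /compact_near_coveringP cK cZ KZ.
have := cK _ (0^'+ : set_system R) (fun e x => forall z, Z z -> e <= mdist x z) _ _.
case=> [x Kx|e /= e0 H].
  have [e e0 xZ] := notin_closed_mdist cZ (KZ _ Kx).
  exists ([set y | mdist x y < e / 2], [set r | r < e / 2]); first split => /=.
  - by apply/nbhs_mdistP; exists (e / 2) => //; rewrite divr_gt0.
  - by apply: nbhs_right_lt; rewrite divr_gt0.
  move=> [y r] /= [xy re] z Zz; have := metric_triangle x y z.
  by have := xZ _ Zz; lra.
exists (e / 2); first by rewrite divr_gt0.
move=> x z Kx Zz; apply: H => //=; rewrite ?divr_gt0//.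
by rewrite sub0r normrN gtr0_norm ?divr_gt0// gtr_pMr// invf_lt1// ltr1n.
Qed.

Lemma compact_diameter K p : compact K ->
  exists2 r : R, 0 < r & forall x, K x -> mdist p x < r.
Proof.
move=> /compact_near_coveringP cK.
have := cK _ (+oo : set_system R) (fun r x => mdist p x < r) _ _.
case=> [x Kx|r [_ H]].
  exists ([set y | mdist x y < 1], [set r | mdist p x + 1 < r]); first split => /=.
  - by apply/nbhs_mdistP; exists 1.
  - by apply: nbhs_pinfty_gt; rewrite num_real.
  move=> [y r] /= [xy re]; have := metric_triangle p x y.
  by lra.
exists (`|r| + 1); first by rewrite ltr_wpDl.
by move=> x; apply: H; rewrite (le_lt_trans (ler_norm _))// ltrDl.
Qed.

End MetricTopology.

Section Hausdorff.
Context {R : realType} {M : metricType R}.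
Implicit Types (A B C D F K S Z : set M) (p t x y z : M).

(** The compact set bounds all distances, so the infimum is over a nonempty set and some admissible
    radius lies below [e]. *)
Lemma hausdorff_dist_lt K A B (e : R) : compact K -> A `<=` K -> B `<=` K ->
  A !=set0 -> B !=set0 -> hausdorff_dist A B < e ->
  (forall a, A a -> exists2 b, B b & mdist a b < e) /\
  (forall b, B b -> exists2 a, A a & mdist a b < e).
Proof.
move=> cK AK BK [a0 Aa0] [b0 Bb0] /inf_lt[|r [r0 AB BA] re].
  have [r r0 Hr] := compact_diameter a0 cK.
  have [r' r'0 Hr'] := compact_diameter b0 cK.
  exists (r + r'); split; first exact: addr_gt0.
    move=> a Aa; exists b0 => //; rewrite metric_sym.
    by have := Hr' _ (AK _ Aa); lra.
  by move=> b Bb; exists a0 => //; have := Hr _ (BK _ Bb); lra.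
split=> [a /AB[b Bb ab]|b /BA[a Aa ab]]; [exists b|exists a] => //;
  exact: lt_trans re.
Qed.

End Hausdorff.

Section Segments.
Context {R : realType} {M : metricType R} (F : set M) (t : M).
Implicit Types (A B C D K S Z : set M) (p q r x y z : M).

Local Notation I01 := (`[0, 1]%classic : set R).
Local Notation seg := (segment F t).

Hypotheses (hF : hereditarily_unicoherent F) (aF : arcwise_connected F) (Ft : F t).

Lemma segment_top : seg t = [set t].
Proof. by rewrite /segment eqxx. Qed.

Lemma segment_arc q : F q -> q != t -> seg q `<=` F /\ arc_between (seg q) t q.
Proof.
move=> Fq qt; rewrite /segment eq_sym (negbTE qt).
apply: (@xgetPex _ set0 [set A | A `<=` F /\ arc_between A t q]).
by have [|A AF aA] := aF Ft Fq; [rewrite eq_sym|exists A].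
Qed.

Lemma segment_sub q : F q -> seg q `<=` F.
Proof.
move=> Fq; have [->|qt] := eqVneq q t; first by rewrite segment_top => _ ->.
by have [] := segment_arc Fq qt.
Qed.

Lemma segment_left q : F q -> seg q t.
Proof.
move=> Fq; have [->|qt] := eqVneq q t; first by rewrite segment_top.
by have [_ /arc_ends[]] := segment_arc Fq qt.
Qed.

Lemma segment_right q : F q -> seg q q.
Proof.
move=> Fq; have [->|qt] := eqVneq q t; first by rewrite segment_top.
by have [_ /arc_ends[]] := segment_arc Fq qt.
Qed.

Lemma segment_continuum q : F q -> continuum (seg q).
Proof.
move=> Fq; have [->|qt] := eqVneq q t; last first.
  by have [_ /arc_continuum] := segment_arc Fq qt.
rewrite segment_top; split; [by exists t|exact: compact_set1|exact: connected1].
Qed.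

Lemma segment_closed q : F q -> closed (seg q).
Proof. by move=> /segment_continuum[_ /compact_mdist_closed]. Qed.

Lemma segment_eq A q : A `<=` F -> arc_between A t q -> seg q = A.
Proof.
move=> AF aA; have [_ Aq qt] := arc_ends aA.
rewrite eq_sym in qt; have [sF aS] := segment_arc (AF _ Aq) qt.
exact: arc_unique hF sF AF aS aA.
Qed.

(** An initial piece of the arc is itself an arc from the top, and uniqueness of arcs identifies it.
    The order below [q] thus becomes the order of [[0, 1]]. *)
Lemma segment_param_eq phi q (u : R) : F q -> arc_param phi (seg q) t q ->
  0 <= u <= 1 -> seg (phi u) = phi @` `[0, u].
Proof.
move=> Fq ap /andP[]; have [_ _ sE p0 _] := ap.
rewrite le_eqVlt => /predU1P[<- _|u0 u1].
  rewrite p0 set_itv1 image_set1 p0; exact: segment_top.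
apply: segment_eq; last first.
  by rewrite -[in X in arc_between _ X]p0; exact: arc_param_sub ap _ _ _.
move=> _ [v /= + <-]; rewrite in_itv/= => /andP[v0 vu]; apply: (segment_sub Fq).
by rewrite sE; exists v => //; rewrite /= in_itv/= v0 (le_trans vu).
Qed.

Lemma segment_param q : F q -> q != t -> exists phi, arc_param phi (seg q) t q.
Proof. by move=> Fq /(segment_arc Fq)[_ /arc_betweenP]. Qed.

(** Reading [seg q p] as [p] being below [q], this is transitivity, and [segment_anti] is
    antisymmetry. *)
Lemma segmentS p q : F q -> seg q p -> seg p `<=` seg q.
Proof.
move=> Fq sqp; have [qt|qt] := eqVneq q t.
  by move: sqp; rewrite qt segment_top => ->; rewrite segment_top.
have [phi ap] := segment_param Fq qt; move: (sqp).
have [_ _ sE _ _] := ap; rewrite sE => -[u /itv01P u01 <-].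
rewrite (segment_param_eq Fq ap) // => _ [v /= + <-].
rewrite in_itv /= => /andP[v0 vu]; exists v => //; apply/itv01P.
by case/andP: u01 => _ /(le_trans vu) ->; rewrite v0.
Qed.

Lemma segment_anti p q : F q -> seg q p -> seg p q -> p = q.
Proof.
move=> Fq sqp spq; have [qt|qt] := eqVneq q t.
  by move: sqp; rewrite qt segment_top.
have [phi ap] := segment_param Fq qt; move: spq sqp.
have [_ inj sE _ p1] := ap; rewrite sE => + [u /itv01P u01 up].
rewrite -up (segment_param_eq Fq ap) // => -[v /= + vq].
rewrite in_itv /= => /andP[v0 vu].
have v1 : v <= 1 by case/andP: u01 => _; exact: le_trans.
have : v = 1.
  apply: inj; rewrite ?inE ?vq ?p1 //; apply/itv01P.
    by rewrite v0.
  by rewrite lexx ler01.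
by move=> v1E; suff -> : u = 1; [|case/andP: u01; lra].
Qed.

Definition maximal_in_order m := F m /\ forall r, F r -> seg r m -> r = m.

(* [seg x] and [seg y] both avoid [m], so by unicoherence their union contains
   the arc from [x] to [y]. *)
Lemma maximal_endpoint m : maximal_in_order m -> endpoints F m.
Proof.
move=> [Fm mm]; split => // A x y AF aA Am.
apply: contrapT => /not_orP[mx my].
have [Ax Ay _] := arc_ends aA.
have Fx := AF _ Ax; have Fy := AF _ Ay.
have [sx0 sxc sxn] := segment_continuum Fx.
have [sy0 syc syn] := segment_continuum Fy.
have := @arc_sub_continuum _ _ F A (seg x `|` seg y) x y hF AF _ _ aA.
have UF : seg x `|` seg y `<=` F by rewrite subUset; split; exact: segment_sub.
have cU : continuum (seg x `|` seg y).
  split; [by exists t; left; exact: segment_left|exact: compactU|].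
  by apply: connectedU => //; exists t; split; exact: segment_left.
move=> /(_ UF cU (or_introl (segment_right Fx)) (or_intror (segment_right Fy))).
by move=> /(_ _ Am)[/(mm _ Fx)|/(mm _ Fy)] /esym.
Qed.

Lemma endpoint_maximal e : endpoints F e -> e != t -> maximal_in_order e.
Proof.
move=> [Fe ee] et; split => // r Fr sre.
have [rt|rt] := eqVneq r t.
  by move: sre et; rewrite rt segment_top => ->; rewrite eqxx.
have [sF aS] := segment_arc Fr rt.
by have [/eqP|] := ee _ _ _ sF aS sre; rewrite ?(negbTE et).
Qed.

(** Otherwise the two segments have a last common point [m], maximizing the parameter [g] of
    [seg e], and [m] differs from [t], [e] and [e']. The segment to [m] and the two pieces beyond it
    form a simple triod at [m], a ramification point off the top. *)
Lemma max_disjoint : ramification_points F `<=` [set t] -> forall e e' p,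
  maximal_in_order e -> maximal_in_order e' -> seg e p -> seg e' p -> p != t ->
  e = e'.
Proof.
move=> rF e e' p me me' ep e'p pt; apply: contrapT => nee'.
have [[Fe em] [Fe' e'm]] := (me, me').
have neqt r : seg r p -> r != t.
  by move=> rp; apply: contra_neq pt => rt; move: rp; rewrite rt segment_top.
have [et e't] := (neqt _ ep, neqt _ e'p).
have [sF [phi [hphi ph0 ph1]]] := segment_arc Fe et.
have ap := homeomorphism_arc_param hphi; rewrite ph0 ph1 in ap.
have [fc inj sE _ _] := ap.
have [_ _ [g [gphi gc]]] := hphi.
have [phi' ap'] := segment_param Fe' e't; have [_ _ s'E p'0 p'1] := ap'.
have cK : compact (seg e `&` seg e').
  apply: compact_closedI; last exact: segment_closed.
  by have [] := segment_continuum Fe.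
have gcK : {within seg e `&` seg e', continuous g}.
  by apply: continuous_subspaceW gc; exact: subIsetl.
have [m /set_mem[em_ e'm_] gmax] := compact_EVT_max (ex_intro _ p (conj ep e'p)) cK gcK.
have [s /itv01P s01 sm] : exists2 s, I01 s & phi s = m by rewrite sE in em_.
have [s' /itv01P s'01 s'm] : exists2 s, I01 s & phi' s = m.
  by rewrite s'E in e'm_.
have smax z : seg e z -> seg e' z -> seg m z.
  move=> ez e'z; move: (ez); rewrite sE => -[w /itv01P w01 wz].
  have := gmax z; rewrite inE => /(_ (conj ez e'z)).
  rewrite -wz -sm !gphi; try exact/itv01P.
  move=> ws; rewrite (segment_param_eq Fe ap)//; exists w => //.
  by rewrite /= in_itv/= ws andbT; case/andP: w01.
have mt : m != t.
  apply: contra_neq pt => mt; have := smax _ ep e'p.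
  by rewrite mt segment_top.
have me1 : m != e.
  by apply: contra_not_neq nee' => mE; apply/esym/em => //; rewrite -mE.
have me1' : m != e'.
  by apply: contra_not_neq nee' => mE; apply/e'm => //; rewrite -mE.
have Fm : F m by exact: (segment_sub Fe).
have s0 : 0 < s.
  rewrite lt_neqAle; apply/andP; split; last by case/andP: s01.
  by apply: contra_neq mt => sE0; rewrite -sm -sE0 ph0.
have s1 : s < 1.
  rewrite lt_neqAle; apply/andP; split; last by case/andP: s01.
  by apply: contra_neq me1 => sE0; rewrite -sm sE0 ph1.
have s'1 : s' < 1.
  rewrite lt_neqAle; apply/andP; split; last by case/andP: s'01.
  by apply: contra_neq me1' => sE0; rewrite -s'm sE0 p'1.
have smE : seg m = phi @` `[0, s] by rewrite -sm (segment_param_eq Fe ap).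
have smE' : seg m = phi' @` `[0, s'] by rewrite -s'm (segment_param_eq Fe' ap').
have s1F : phi @` `[s, 1] `<=` seg e.
  rewrite sE => _ [w + <-]; rewrite /= in_itv/= => /andP[sw w1].
  by exists w => //; apply/itv01P; rewrite w1 andbT (le_trans _ sw)// ltW.
have s'1F : phi' @` `[s', 1] `<=` seg e'.
  rewrite s'E => _ [w + <-]; rewrite /= in_itv/= => /andP[sw w1].
  exists w => //; apply/itv01P; rewrite w1 andbT (le_trans _ sw)//.
  by case/andP: s'01.
have am1 : seg m `&` phi @` `[s, 1] = [set m].
  by rewrite smE (arc_param_split ap) // sm.
have am2 : seg m `&` phi' @` `[s', 1] = [set m].
  by rewrite smE' (arc_param_split ap') // s'm.
have : ramification_points F m.
  exists (seg m `|` phi @` `[s, 1] `|` phi' @` `[s', 1]).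
    rewrite !subUset; split; [split|]; first exact: segment_sub.
      by move=> z /s1F; exact: segment_sub.
    by move=> z /s'1F; exact: segment_sub.
  exists (seg m), (phi @` `[s, 1]), (phi' @` `[s', 1]), t, e, e'; split=> //.
    split.
    - by apply: arc_sym; have [] := segment_arc Fm mt.
    - by have := arc_param_sub ap (ltW s0) (lexx 1) s1; rewrite sm ph1.
    - have := arc_param_sub ap' _ (lexx 1) s'1; rewrite s'm p'1; apply.
      by case/andP: s'01.
  split => //; apply/seteqP; split => [z [/[dup] zs /s1F ez /s'1F e'z]|_ ->].
    by rewrite -am1; split => //; exact: smax.
  have [_ m1] : (seg m `&` phi @` `[s, 1]) m by rewrite am1.
  by have [_ m2] : (seg m `&` phi' @` `[s', 1]) m by rewrite am2.
by move=> /rF /= mE; rewrite mE eqxx in mt.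
Qed.

End Segments.

Section SmoothOrder.
Context {R : realType} {M : metricType R} (F : set M) (t : M).
Implicit Types (A B C D K S Z : set M) (p q r x y z : M).
Local Notation seg := (segment F t).

Hypotheses (hF : hereditarily_unicoherent F) (aF : arcwise_connected F)
  (cF : compact F) (Ft : F t).
Hypothesis smF : forall (x : nat -> M) (l : M), (forall n, F (x n)) -> F l ->
    x n @[n --> \oo] --> l ->
    hausdorff_dist (seg (x n)) (seg l) @[n --> \oo] --> (0 : R).

Lemma segment_near q (e : R) : F q -> 0 < e ->
  exists2 d : R, 0 < d & forall q', F q' -> mdist q q' < d ->
    (forall p', seg q' p' -> exists2 p, seg q p & mdist p' p < e) /\
    (forall p, seg q p -> exists2 p', seg q' p' & mdist p' p < e).
Proof.
move=> Fq e0; apply: contrapT => /forall2NP H.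
have {}H (n : nat) : exists q', [/\ F q', mdist q q' < n.+1%:R^-1 &
    ~ hausdorff_dist (seg q') (seg q) < e].
  have [|/existsNP[q' /not_implyP[Fq' /not_implyP[qq' nH]]]] := H n.+1%:R^-1.
    by rewrite invr_gt0 ltr0n.
  exists q'; split => // /(hausdorff_dist_lt cF _ _ _ _) hd; apply: nH; apply: hd.
  - exact: segment_sub.
  - exact: segment_sub.
  - by exists t; exact: segment_left.
  - by exists t; exact: segment_left.
have [x xP] := choice H.
have xq : x n @[n --> \oo] --> q.
  apply/(@cvg_ballP R M) => d d0; near=> n; rewrite ballEmdist /=.
  have [_ + _] := xP n; move=> /lt_trans; apply.
  near: n; exact: near_infty_natSinv_lt (PosNum d0).
have /(@cvgrPdist_lt _ R) /(_ _ e0) [N _ /(_ N (leqnn _))] :=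
  smF (fun n => let: And3 a _ _ := xP n in a) Fq xq.
rewrite /= sub0r normrN => /ltr_normlW.
by have [] := xP N.
Unshelve. all: by end_near. Qed.

Definition upper_closure Z : set M := [set q | F q /\ exists2 z, Z z & seg q z].
Definition lower_closure Z : set M := [set p | exists z, [/\ F z, Z z & seg z p]].

(** If [seg q] misses [Z], it does so by some [e]; segments of points near [q] stay within [e] of
    [seg q] and miss [Z] as well. *)
Lemma upper_closure_closed Z : closed Z -> closed (upper_closure Z).
Proof.
move=> cZ q /closure_mdistP cq.
have Fq : F q.
  apply: (compact_mdist_closed cF); apply/closure_mdistP => e /cq[y [Fy _] qy].
  by exists y.
split => //; apply: contrapT => nZ.
have [_ csq _] := segment_continuum aF Ft Fq.
have [x sx Zx|e e0 He] := compact_closed_mdist csq cZ; first by apply: nZ; exists x.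
have [d d0 qd] := segment_near Fq e0.
have [y [Fy [z Zz yz]] qy] := cq _ d0.
have [/(_ _ yz)[p qp zp] _] := qd _ Fy qy.
by have := He _ _ qp Zz; rewrite metric_sym leNgt zp.
Qed.

(** For a single [z] with [p] off [seg z], smoothness keeps points near [p] off the segments of
    points near [z]. Compactness of [F] intersected with [Z] makes the neighbourhood of [p]
    independent of [z]. *)
Lemma lower_closure_closed Z : closed Z -> closed (lower_closure Z).
Proof.
move=> cZ p cp; apply: contrapT => nZ.
have cFZ : compact (F `&` Z) by exact: compact_closedI.
have /compact_near_coveringP nc := cFZ.
have {}nc := nc _ (nbhs p) (fun p' z => F z -> ~ seg z p') _.
suff /nc /cp [y [[z [Fz Zz yz]] By]] : forall z, (F `&` Z) z ->
    \near z & p, F z -> ~ seg z p.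
  by apply: By (conj Fz Zz) Fz yz.
move=> z [Fz Zz].
have [//|e e0 pe] := notin_closed_mdist (segment_closed aF Ft Fz) (_ : ~ seg z p).
  by move=> szp; apply: nZ; exists z.
have e20 : 0 < e / 2 by rewrite divr_gt0.
have [d d0 zd] := segment_near Fz e20.
exists ([set y | mdist z y < d], [set y | mdist p y < e / 2]); first split => /=.
- by apply/nbhs_mdistP; exists d.
- by apply/nbhs_mdistP; exists (e / 2).
move=> [z' p'] /= [zz' pp'] Fz' z'p'.
have [/(_ _ z'p')[y zy yp']] := zd _ Fz' zz'.
have := pe _ zy; have := metric_triangle p p' y; lra.
Qed.

Lemma maximal_above q : F q -> exists2 m, maximal_in_order F t m & seg m q.
Proof.
move=> Fq; pose T := {r : M | F r /\ seg r q}.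
pose rel (r s : T) := `[< seg (sval s) (sval r) >].
have FT (r : T) : F (sval r) by case: r => r [].
pose q0 : T := exist _ q (conj Fq (segment_right aF Ft Fq)).
have refl : forall r : T, rel r r.
  by move=> r; apply/asboolP; exact: segment_right.
have trans : forall r s u : T, rel r s -> rel s u -> rel r u.
  move=> r s u /asboolP rs /asboolP su; apply/asboolP.
  exact: (segmentS hF aF Ft (FT u) su rs).
have anti : forall r s : T, rel r s -> rel s r -> r = s.
  move=> [r Hr] [s Hs] /asboolP rs /asboolP sr; apply: eq_exist => /=.
  exact: (segment_anti hF aF Ft (FT (exist _ s Hs)) rs sr).
have chain : forall A : set T, total_on A rel -> exists u, forall s, A s -> rel s u.
  move=> A totA; have [->|/set0P[a0 Aa0]] := eqVneq A set0; first by exists q0.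
  (* The sets of points above members of the chain form a filter base. They are closed, so a cluster
     point belongs to all of them and bounds the chain. *)
  pose G := filter_from A (fun a => upper_closure [set sval a]).
  have GF : ProperFilter G.
    apply: filter_from_proper.
      apply: filter_from_filter; first by exists a0.
      move=> a b Aa Ab; have [/asboolP ab|/asboolP ba] := totA a b Aa Ab.
        exists b => // z [Fz [_ -> bz]]; split; split => //.
          by exists (sval a) => //; exact: (segmentS hF aF Ft Fz bz ab).
        by exists (sval b).
      exists a => // z [Fz [_ -> az]]; split; split => //; first by exists (sval a).
      by exists (sval b) => //; exact: (segmentS hF aF Ft Fz az ba).
    move=> a Aa; exists (sval a); split => //; exists (sval a) => //.
    exact: segment_right.
  have [|u [Fu Gu]] := cF GF; first by exists a0 => // z [].
  have uA a : A a -> seg u (sval a).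
    move=> Aa; have : closure (upper_closure [set sval a]) u.
      by move=> B Bu; apply: Gu => //; exists a.
    have c1 : closed [set sval a] by apply: compact_mdist_closed; exact: compact_set1.
    by move=> /(upper_closure_closed c1) [_ [_ ->]].
  have uq : seg u q.
    by apply: (segmentS hF aF Ft Fu (uA _ Aa0)); case: (a0) => ? [].
  by exists (exist _ u (conj Fu uq)) => s As; apply/asboolP; exact: uA.
have [[m [Fm mq]] mm] := Zorn refl trans anti chain.
exists m => //; split => // r Fr rm.
have rq : seg r q by exact: (segmentS hF aF Ft Fr rm).
have := mm (exist _ r (conj Fr rq)); rewrite /rel /= => /(_ (asboolT rm)).
by move=> [].
Qed.

End SmoothOrder.

(** * The sets generated by smooth fans *)

Section CompactBaire.
Context {R : realType} {M : metricType R} (F : set M).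
Hypothesis cF : compact F.
Implicit Types (p q x y z : M).

Lemma compact_net (e : R) : 0 < e ->
  exists l : seq M, forall x, F x -> exists2 y, y \in l & mdist x y < e.
Proof.
move=> e0; have /compact_near_coveringP nc := cF.
pose G := filter_from [set: seq M] (fun l0 => [set l : seq M | {subset l0 <= l}]).
have GF : Filter G.
  apply: filter_from_filter; first by exists [::].
  move=> l1 l2 _ _; exists (l1 ++ l2) => // l /= l12.
  by split => z zl; apply: l12; rewrite mem_cat zl ?orbT.
have [x Fx|l0 _ H] := nc _ G (fun (l : seq M) x => exists2 y, y \in l & mdist x y < e) GF.
  exists ([set y | mdist x y < e], [set l : seq M | {subset [:: x] <= l}]).
    split; last by exists [:: x].
    by apply/nbhs_mdistP; exists e.
  move=> [y l] /= [xy xl]; exists x; last by rewrite metric_sym.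
  by apply: xl; rewrite inE.
by exists l0; apply: (H l0) => /= z.
Qed.

(** A countable substitute for neighbourhoods, as Baire requires: closed balls of radius
    [n.+1%:R^-1] around finite nets. *)
Lemma compact_separating_family : exists beta : nat -> set M,
  (forall k, closed (beta k)) /\
  forall p Z, F p -> closed Z -> ~ Z p ->
    exists2 k, beta k p & forall z, beta k z -> ~ Z z.
Proof.
have net (n : nat) : exists l : seq M, forall x, F x ->
    exists2 y, y \in l & mdist x y < n.+1%:R^-1.
  by apply: compact_net; rewrite invr_gt0 ltr0n.
have [l lP] := choice net.
pose B n y := [set x | mdist y x <= (n.+1%:R^-1 : R)].
have Bc n y : closed (B n y).
  move=> x /closure_mdistP cx; rewrite /B /=; apply/ler_addgt0Pr => e e0.
  have [z yz xz] := cx _ e0; rewrite /B /= in yz.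
  apply: le_trans (metric_triangle y z x) _; apply: lerD => //.
  by rewrite metric_sym ltW.
(* Numbers coding no pair, or an index outside the net, get the default [set0], which is closed. *)
pose beta k := if unpickle k is Some (n, i) then
  (if onth (l n) i is Some y then B n y else set0) else set0.
exists beta; split=> [k|p Z Fp cZ Zp].
  rewrite /beta; case: unpickle => [[n i]|]; last exact: closed0.
  by case: onth => [y|]; [exact: Bc|exact: closed0].
have [e e0 He] := notin_closed_mdist cZ Zp.
have [n ne] : exists n : nat, n.+1%:R^-1 < e / 2.
  have e20 : 0 < e / 2 by rewrite divr_gt0.
  have [N _ H] := near_infty_natSinv_lt (PosNum e20).
  by exists N; exact: (H N (leqnn N)).
have [y yl py] := lP n _ Fp.
have bE : beta (pickle (n, index y (l n))) = B n y.
  by rewrite /beta pickleK (onthE _ _) (nth_map y) ?index_mem// nth_index.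
exists (pickle (n, index y (l n))); rewrite bE.
  by rewrite /B /= metric_sym ltW.
move=> z; rewrite /B /=; move: ne py; set r := _^-1 => ne py yz Zz.
have := He _ Zz; have := metric_triangle p y z; lra.
Qed.

(** The boundary of a closed set has empty interior, so some point near [p] avoids all these
    boundaries: it is relatively interior to every [V k] that contains it. *)
Lemma compact_baire (V : nat -> set M) (p : M) (e : R) :
  (forall k, closed (V k)) -> F p -> 0 < e ->
  exists q, [/\ F q, mdist p q < e & forall k, V k q ->
    exists2 d : R, 0 < d & forall y, F y -> mdist q y < d -> V k y].
Proof.
move=> cV Fp e0; pose S := {x : M * R | F x.1 /\ 0 < x.2}.
(* One step of a construction of nested balls: the next closed ball lies in the current open one,
   and either the current ball is already inside [V k] or the next one misses [V k]. *)
pose P (ks : nat * S) (s' : S) :=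
  let: (q, r) := sval ks.2 in let: (q', r') := sval s' in
  (forall y, mdist q' y <= r' -> mdist q y < r) /\
  ((forall y, F y -> mdist q y < r -> V ks.1 y) \/
   (forall y, mdist q' y <= r' -> ~ V ks.1 y)).
have step ks : exists s', P ks s'.
  case: ks => k [[q r] /= [Fq r0]].
  have [qV|/existsNP[y /not_implyP[Fy /not_implyP[qy nVy]]]] :=
    pselect (forall y, F y -> mdist q y < r -> V k y).
    have r20 : 0 < r / 2 by rewrite divr_gt0.
    exists (exist _ (q, r / 2) (conj Fq r20)); split => /=; last by left.
    by move=> y qy; apply: le_lt_trans qy _; rewrite ltr_pdivrMr ?ltr_pMr ?ltr1n.
  have [d d0 dV] := notin_closed_mdist (cV k) nVy.
  pose r' := Num.min (d / 2) ((r - mdist q y) / 2).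
  have r'0 : 0 < r' by rewrite lt_min !divr_gt0 ?subr_gt0.
  have r'1 : r' <= d / 2 by rewrite ge_min lexx.
  have r'2 : r' <= (r - mdist q y) / 2 by rewrite ge_min lexx orbT.
  exists (exist _ (y, r') (conj Fy r'0)); split => /=.
    by move=> z yz; have := metric_triangle q y z; lra.
  by right=> z yz Vz; have := dV _ Vz; lra.
have [f fP] := choice step.
pose s0 : S := exist _ (p, e) (conj Fp e0).
pose s := fix s n : S := if n is n'.+1 then f (n', s n') else s0.
pose q n := (sval (s n)).1; pose r n := (sval (s n)).2.
have sP n : (forall y, mdist (q n.+1) y <= r n.+1 -> mdist (q n) y < r n) /\
  ((forall y, F y -> mdist (q n) y < r n -> V n y) \/
   (forall y, mdist (q n.+1) y <= r n.+1 -> ~ V n y)).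
  have := fP (n, s n); rewrite /P /q /r /=.
  by case: (sval (s n)) => a b; case: (sval (f _)) => a' b'.
have Fq n : F (q n) by rewrite /q; case: (s n) => x [].
have r0 n : 0 < r n by rewrite /r; case: (s n) => x [].
have nest m n y : mdist (q (n + m)%N) y <= r (n + m)%N -> mdist (q n) y <= r n.
  elim: m => [|m IH]; first by rewrite addn0.
  by rewrite addnS => /(proj1 (sP _))/ltW; exact: IH.
have [|z [Fz zc]] := cF (F := q n @[n --> \oo]) _.
  by exists 0%N => // n _; exact: Fq.
have zq n : mdist (q n) z <= r n.
  apply/ler_addgt0Pr => d d0.
  have [||y [[m /= nm <-] zy]] := zc (q @` [set m | (n <= m)%N]) [set y | mdist z y < d].
  - by exists n => // m /= nm; exists m.
  - by apply/nbhs_mdistP; exists d.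
  have := nest (m - n)%N n (q m); rewrite subnKC // mdistxx => /(_ (ltW (r0 m))).
  have := metric_triangle (q n) (q m) z.
  by rewrite (metric_sym (q m) z); lra.
have zq' n : mdist (q n) z < r n by apply: (proj1 (sP n)).
exists z; split => //; first exact: (zq' 0%N).
move=> k Vz; have [_ [H|H]] := sP k; last by case: (H _ (zq k.+1)).
exists (r k - mdist (q k) z); first by rewrite subr_gt0.
by move=> y Fy zy; apply: H => //; have := metric_triangle (q k) z y; lra.
Qed.

End CompactBaire.

(** * Restrictions on [X] imposed by a smooth fan *)

Section Necessity.
Context {R : realType} {M : metricType R} (F : set M) (t : M) (X : set R).
Implicit Types (p q r : M).
Local Notation seg := (segment F t).
Local Notation I01 := (`[0, 1]%classic : set R).
Local Notation E := (endpoints F).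

Hypotheses (smooth : smooth_fan F t) (gen : endpoint_generated X F t).

Let dF : dendroid F. Proof. by case: smooth => -[]. Qed.
Let cF : compact F. Proof. by case: dF => -[]. Qed.
Let aF : arcwise_connected F. Proof. by case: dF. Qed.
Let hF : hereditarily_unicoherent F. Proof. by case: dF. Qed.

Let top_arc : exists2 q, F q & F t /\ q != t.
Proof.
have : ramification_points F t by case: smooth => -[_ ->].
move=> [S SF [A [B [C [x [y [z [[aA _ _] _ SE]]]]]]]].
have [At Ax tx] := arc_ends aA.
exists x; first by apply: SF; rewrite SE; left; left.
by split; [apply: SF; rewrite SE; left; left|rewrite eq_sym].
Qed.
Let Ft : F t. Proof. by case: top_arc => q _ []. Qed.
Let smF := proj2 smooth.

Let I0 : I01 0. Proof. by apply/itv01P; rewrite lexx ler01. Qed.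
Let I1 : I01 1. Proof. by apply/itv01P; rewrite lexx ler01. Qed.

(** The blade of an endpoint [t] would be the single point [t], which is not homeomorphic to
    [[0, 1]]. *)
Let endpoint_top e : E e -> e != t.
Proof.
move=> Ee; apply/eqP => et; rewrite et in Ee.
have [|phi [hphi p0 _]] := gen (_ : blades F t (seg t)); first by exists t.
have := homeomorphism_arc_param hphi; rewrite p0 segment_top => -[_ inj sE _ _].
have : phi 1 = t by have : [set t] (phi 1) by rewrite sE; exists 1.
rewrite -p0 => /inj; rewrite !inE => /(_ I1 I0) /eqP.
by rewrite oner_eq0.
Qed.

Let endpoint_max e : E e -> maximal_in_order F t e.
Proof. by move=> Ee; apply: endpoint_maximal => //; exact: endpoint_top. Qed.

Let blade_param e : E e -> exists phi, [/\ homeomorphism I01 (seg e) phi,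
  arc_param phi (seg e) t e & phi @` X = seg e `&` closure (E `\` seg e)].
Proof.
move=> Ee; have [|phi [hphi p0 pX]] := gen (_ : blades F t (seg e)); first by exists e.
have ap := homeomorphism_arc_param hphi; exists phi; split => //.
(* The definition of generation fixes [phi 0] only. An endpoint is an end of every arc containing
   it, and [e] is not the top, so [e] is the other end. *)
suff p1 : phi 1 = e by rewrite p0 p1 in ap.
have [Fe ee] := Ee.
have [sF _] := segment_arc aF Ft Fe (endpoint_top Ee).
have aS : arc_between (seg e) (phi 0) (phi 1) by exists phi.
have [eE|//] := ee _ _ _ sF aS (segment_right aF Ft Fe).
by have := endpoint_top Ee; rewrite eE p0 eqxx.
Qed.

Let endpoint_above q : F q -> exists2 e, E e & seg e q.
Proof.
move=> Fq; have [m mm mq] := maximal_above hF aF cF Ft smF Fq.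
by exists m => //; exact: (maximal_endpoint hF aF Ft mm).
Qed.

Let endpoint_in_blade e e' : E e -> E e' -> seg e e' -> e' = e.
Proof.
move=> Ee Ee' ee'; have [_ H] := endpoint_max Ee'.
by apply/esym/H => //; case: Ee.
Qed.

(* Near some point [q] of the open ball the set of points above [q] varies
   continuously, so the endpoints close to [q] in the space of blades can only
   accumulate, above [q], at the endpoint of the blade of [q]. *)
Lemma no_open_set_of_approximable_blades p (e0 : R) : F p -> 0 < e0 ->
  (forall q, F q -> mdist p q < e0 -> q <> t) ->
  (forall q e, F q -> mdist p q < e0 -> E e -> seg e q ->
    exists r, [/\ seg e r, seg r q, r <> e & closure E r]) -> False.
Proof.
move=> Fp e00 nt H; have [beta [bc bsep]] := compact_separating_family cF.
have Vc k : closed (lower_closure F t (beta k)) by exact: lower_closure_closed.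
have [q [Fq pq Vq]] := compact_baire cF Vc Fp e00.
have [e Ee eq_] := endpoint_above Fq; have [Fe _] := Ee.
have [r [er rq re clr]] := H q e Fq pq Ee eq_.
have Fr : F r := segment_sub aF Ft Fe er.
have nre : ~ seg r e by move=> re'; apply: re; exact: (segment_anti hF aF Ft Fe er re').
(* [beta k] contains the tip [e] and misses [seg r]: it witnesses, within a countable family, that
   [r] is strictly below [e]. *)
have [k bke bkr] := bsep _ _ Fe (segment_closed aF Ft Fr) nre.
(* By the choice of [q], all points of [F] near [q] lie below points of [beta k]. *)
have [|d d0 Hd] := Vq k; first by exists e.
pose d' := Num.min d (e0 - mdist p q).
have d'0 : 0 < d' by rewrite lt_min d0 subr_gt0.
have [d1 d10 Hd1] := segment_near aF cF Ft smF Fr d'0.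
(* An endpoint [c] near [r] has on its segment a point [q'] near [q], which lies below some [b] in
   [beta k]. Blades being disjoint off the top, [c] is the tip above [b]. So [r] is a limit of
   points above [beta k], hence itself above [beta k]. *)
have : upper_closure F t (beta k) r.
  apply: (upper_closure_closed aF cF Ft smF (bc k)); apply/closure_mdistP => eps eps0.
  have [|c Ec rc] := (closure_mdistP E r).1 clr (Num.min eps d1).
    by rewrite lt_min eps0.
  have [rceps rcd1] : mdist r c < eps /\ mdist r c < d1.
    by move: rc; rewrite lt_min => /andP.
  have [Fc _] := Ec; exists c => //; split => //.
  have [_ /(_ _ rq)[q' cq' q'q]] := Hd1 _ Fc rcd1.
  have [q'd q'e] : mdist q q' < d /\ mdist q q' < e0 - mdist p q.
    by move: q'q; rewrite metric_sym lt_min => /andP.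
  have Fq' : F q' := segment_sub aF Ft Fc cq'.
  have [b [Fb bb bq']] := Hd _ Fq' q'd.
  have [eb Eeb ebb] := endpoint_above Fb; have [Feb _] := Eeb.
  have ebq' : seg eb q' := segmentS hF aF Ft Feb ebb bq'.
  have q't : q' != t.
    by apply/eqP/nt => //; have := metric_triangle p q q'; lra.
  have -> : c = eb.
    apply: (max_disjoint hF aF Ft _ (endpoint_max Ec) (endpoint_max Eeb) cq' ebq' q't).
    by have [_ ->] := proj1 smooth.
  by exists b.
by move=> [_ [z /bkr]].
Qed.

Hypothesis hX : X `<=` I01.

Let endpoint_exists : exists e, E e.
Proof.
have [q Fq _] := top_arc.
by have [e Ee _] := endpoint_above Fq; exists e.
Qed.

(** An endpoint closer to [p] than [e] is not [e], and [e] is the only endpoint on its own blade. *)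
Let blade_closure e p : E e -> closure E p -> p != e -> closure (E `\` seg e) p.
Proof.
move=> Ee /closure_mdistP cp pe; apply/closure_mdistP => d d0.
have [|y Ey] := cp (Num.min d (mdist p e)).
  by rewrite lt_min d0 mdist_gt0.
rewrite lt_min => /andP[pyd pye]; exists y => //; split => // ey.
by move: pye; rewrite (endpoint_in_blade Ee Ey ey) ltxx.
Qed.

(** Below the tip, [X] records membership in the closure of all endpoints, a set that does not
    depend on the blade. At the tip this breaks down, since [e] itself always belongs to that
    closure. *)
Let blade_generator e phi (u : R) : E e -> arc_param phi (seg e) t e ->
  phi @` X = seg e `&` closure (E `\` seg e) -> I01 u -> u != 1 ->
  closure E (phi u) <-> X u.
Proof.
move=> Ee ap pX Iu u1; have [_ inj sE _ p1] := ap; split=> [cu|Xu].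
  have pe : phi u != e.
    by apply: contra_neq u1; rewrite -p1 => /inj; rewrite !inE; apply.
  have : (phi @` X) (phi u).
    by rewrite pX; split; [rewrite sE; exists u|exact: blade_closure].
  by move=> [x Xx /inj]; rewrite !inE => <- //; exact: hX.
have : (phi @` X) (phi u) by exists u.
by rewrite pX => -[_]; apply: closureS; exact: subDsetl.
Qed.

Lemma generator_closed : closed X.
Proof.
have [e Ee] := endpoint_exists; have [Fe _] := Ee.
have [phi [[_ _ [g [gphi gc]]] _ pX]] := blade_param Ee.
have -> : X = g @` (phi @` X).
  rewrite image_comp; apply/seteqP; split => [x Xx|_ [x Xx <-]] /=.
    by exists x => //=; rewrite gphi //; exact: hX.
  by rewrite gphi //; exact: hX.
apply: compact_closed; first exact: order_hausdorff.
have [_ cs _] := segment_continuum aF Ft Fe.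
rewrite pX; apply: continuous_compact.
  by apply: continuous_subspaceW gc; exact: subIsetl.
by apply: compact_closedI => //; exact: closed_closure.
Qed.

(** The point [phi u] has a neighbourhood free of endpoints. If [X] accumulated at [1] from below,
    any [q] in it, whatever its parameter [v < 1] on its own blade, would have a limit of endpoints
    strictly between it and the tip. *)
Lemma generator_gap (u : R) : 0 < u < 1 -> ~ X u ->
  exists2 d : R, 0 < d & forall x, X x -> x < 1 -> x <= 1 - d.
Proof.
move=> /andP[u0 u1] nXu; apply: contrapT => /forall2NP H.
have {}H (v : R) : v < 1 -> exists x, [/\ X x, v < x & x < 1].
  move=> v1; have [|/existsNP[x /not_implyP[Xx /not_implyP[x1 vx]]]] := H (1 - v).
    by rewrite subr_gt0.
  by exists x; split => //; move/negP: vx; rewrite -ltNge subKr.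
have [e Ee] := endpoint_exists; have [Fe _] := Ee.
have [phi [_ ap pX]] := blade_param Ee; have [_ inj sE p0 p1] := ap.
have Iu : I01 u by apply/itv01P; rewrite !ltW.
have nclu : ~ closure E (phi u).
  by move=> /(blade_generator Ee ap pX Iu) Xu; apply/nXu/Xu; rewrite lt_eqF.
have Fp : F (phi u) by apply: (segment_sub aF Ft Fe); rewrite sE; exists u.
have [d d0 Hd] := notin_closed_mdist (@closed_closure _ E) nclu.
have pt : phi u != t.
  apply: contraTneq u0; rewrite -p0 => /inj; rewrite !inE => /(_ Iu I0) ->.
  by rewrite ltxx.
apply: (@no_open_set_of_approximable_blades (phi u) (Num.min d (mdist (phi u) t))) => //.
- by rewrite lt_min d0 mdist_gt0.
- by move=> q _; rewrite lt_min => /andP[_ +] qt; rewrite qt ltxx.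
move=> q e' Fq; rewrite lt_min => /andP[pq _] Ee' e'q.
have [phi' [_ ap' pX']] := blade_param Ee'; have [_ inj' sE' p'0 p'1] := ap'.
have [Fe' _] := Ee'.
move: (e'q); rewrite sE' => -[v Iv vq].
have v1 : v < 1.
  rewrite lt_neqAle; apply/andP; split; last by case/andP: ((itv01P v).1 Iv).
  apply/eqP => v1; move: pq; rewrite -vq v1 p'1 ltNge => /negP; apply.
  by apply: Hd; exact: subset_closure.
have [x [Xx vx x1]] := H _ v1; have Ix := hX Xx.
exists (phi' x); split.
- by rewrite -sE'; rewrite sE'; exists x.
- rewrite (segment_param_eq hF aF Ft Fe' ap') -?itv01P //; exists v => //.
  by rewrite /= in_itv/= (ltW vx) andbT; case/andP: ((itv01P v).1 Iv).
- by rewrite -p'1 => /inj'; rewrite !inE => /(_ Ix I1) xE; rewrite xE ltxx in x1.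
- by apply/(blade_generator Ee' ap' pX' Ix); rewrite // lt_eqF.
Qed.

(** Some initial segment, up to [phi u], is at positive distance from the limits of endpoints, and
    by smoothness so are the segments to points near [phi u]. On every blade through such a point,
    the limit of endpoints with parameter [x < 1] therefore lies beyond it. *)
Lemma generator_zero : ~ X 0 -> X `<=` [set 1].
Proof.
move=> nX0 x Xx; apply: contrapT => /= /eqP x1; have Ix := hX Xx.
have [u [u0 u1 uX]] : exists u : R, [/\ 0 < u, u < 1 & forall v, 0 <= v <= u -> ~ X v].
  have : nbhs (0 : R) (~` X)
    by apply: open_nbhs_nbhs; split => //; exact/closed_openC/generator_closed.
  move=> /nbhs_ballP[d /= d0 dX]; exists (Num.min (d / 2) (1 / 2)); split.
  - by rewrite lt_min !divr_gt0.
  - by rewrite gt_min [X in _ || X](_ : _ = true) ?orbT//; lra.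
  - move=> v /andP[v0]; rewrite le_min => /andP[vd _]; apply: dX.
    by rewrite /ball /= sub0r normrN ger0_norm //; lra.
have [e Ee] := endpoint_exists; have [Fe _] := Ee.
have [phi [_ ap pX]] := blade_param Ee; have [_ inj sE p0 p1] := ap.
have Iu : I01 u by apply/itv01P; rewrite !ltW.
have Fp : F (phi u) by apply: (segment_sub aF Ft Fe); rewrite sE; exists u.
have [_ csp _] := segment_continuum aF Ft Fp.
have pt : phi u != t.
  apply: contraTneq u0; rewrite -p0 => /inj; rewrite !inE => /(_ Iu I0) ->.
  by rewrite ltxx.
have [a|d d0 Hd] := compact_closed_mdist csp (@closed_closure _ E).
  rewrite (segment_param_eq hF aF Ft Fe ap) -?itv01P// => -[v /= + <-].
  rewrite in_itv/= => uv; have v1 : v < 1 by case/andP: uv => _ /le_lt_trans; apply.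
  move=> /(blade_generator Ee ap pX) Xv; apply: (uX v uv); apply: Xv.
    by apply/itv01P; case/andP: uv => -> _; exact: ltW.
  by rewrite lt_eqF.
have [d1 d10 Hd1] := segment_near aF cF Ft smF Fp d0.
apply: (@no_open_set_of_approximable_blades (phi u) (Num.min d1 (mdist (phi u) t))) => //.
- by rewrite lt_min d10 mdist_gt0.
- by move=> q _; rewrite lt_min => /andP[_ +] qt; rewrite qt ltxx.
move=> q e' Fq; rewrite lt_min => /andP[pq _] Ee' e'q.
have [phi' [_ ap' pX']] := blade_param Ee'; have [_ inj' sE' p'0 p'1] := ap'.
have [Fe' _] := Ee'.
have clr : closure E (phi' x) by apply/(blade_generator Ee' ap' pX' Ix).
move: (e'q); rewrite sE' => -[v Iv vq].
have sq : seg q = phi' @` `[0, v].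
  by rewrite -vq (segment_param_eq hF aF Ft Fe' ap') -?itv01P.
have vx : v < x.
  rewrite ltNge; apply/negP => xv; have [qp _] := Hd1 _ Fq pq.
  have [|a pa ra] := qp (phi' x).
    rewrite sq; exists x => //; rewrite /= in_itv/= xv andbT.
    by case/andP: ((itv01P x).1 Ix).
  by have := Hd _ _ pa clr; rewrite metric_sym leNgt ra.
exists (phi' x); split => //.
- rewrite (segment_param_eq hF aF Ft Fe' ap') -?itv01P //; exists v => //.
  by rewrite /= in_itv/= (ltW vx) andbT; case/andP: ((itv01P v).1 Iv).
- by rewrite -p'1 => /inj'; rewrite !inE => /(_ Ix I1) xE; rewrite xE eqxx in x1.
Qed.

Lemma generator_classification :
  [\/ (X = set0 \/ X = [set 1] \/ X = `[0, 1]%classic),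
       [/\ closed X, X 0 & ~ X 1] |
       [/\ closed X, X 0, X 1 & isolated X 1]].
Proof.
have cX := generator_closed.
have [X0|nX0] := pselect (X 0); last first.
  apply: Or31; have X1 := generator_zero nX0.
  have [->|/set0P[x Xx]] := eqVneq X set0; first by left.
  right; left; apply/seteqP; split => // _ ->.
  by have xE : x = 1 := X1 _ Xx; rewrite xE in Xx.
have [X1|nX1] := pselect (X 1); last by apply: Or32.
have [XI|/existsNP[u /not_implyP[Iu nXu]]] := pselect (I01 `<=` X).
  by apply: Or31; right; right; apply/seteqP; split.
apply: Or33; split => //; split; first exact/mem_set.
have [|d d0 Hd] := @generator_gap u _ nXu.
  move/itv01P: Iu; rewrite !le_eqVlt => /andP[/predU1P[u0|->] /predU1P[u1|->]] //.
  - by rewrite u0 in X0.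
  - by rewrite u0 in X0.
  - by rewrite u1 in nXu.
exists (ball (1 : R) d); first exact: nbhsx_ballx.
apply/seteqP; split => [x [xd Xx]|_ ->]; last by split => //; exact: ballxx.
have /itv01P/andP[_] := hX Xx; rewrite le_eqVlt => /predU1P[//|x1].
have := Hd _ Xx x1; move: xd; rewrite /ball /= ltr_norml => /andP[_]; lra.
Qed.

End Necessity.

(** * Planar fans over the Cantor set *)

(** The functions underlying [cantor_space], whose topology is called upon for compactness;
    elsewhere [agree n] plays the role of basic neighbourhoods. *)
Definition bits := nat -> bool.

Definition bit_shift (c : bits) : bits := fun i => c i.+1.

Definition agree n (c c' : bits) := forall i, (i < n)%N -> c i = c' i.

Lemma agree_sym n c c' : agree n c c' -> agree n c' c.
Proof. by move=> cc' i /cc'. Qed.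

Lemma agree_trans n c c' c'' : agree n c c' -> agree n c' c'' -> agree n c c''.
Proof. by move=> cc' c'c'' i ni; rewrite cc' // c'c''. Qed.

Lemma agree_leq m n c c' : (m <= n)%N -> agree n c c' -> agree m c c'.
Proof. by move=> mn cc' i im; apply: cc'; exact: leq_trans mn. Qed.

Lemma agreeS n c c' :
  agree n.+1 c c' <-> c 0%N = c' 0%N /\ agree n (bit_shift c) (bit_shift c').
Proof.
split=> [cc'|[c0 cc'] [|i] //]; last by rewrite ltnS => /cc'.
by split => [|i ni]; apply: cc'.
Qed.

Lemma agree_eq c c' : (forall n, agree n c c') -> c = c'.
Proof. by move=> cc'; apply/funext => i; exact: (cc' i.+1). Qed.

Lemma agree_near n (c : cantor_space) : nbhs c (agree n c).
Proof.
elim: n => [|n IH]; first by apply: filterS filterT => y _ i.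
have cn : nbhs c [set y : cantor_space | y n = c n].
  apply: (@proj_continuous nat (fun=> bool) n c [set b | b = c n]).
  exact/principal_filterP.
apply: filterS2 IH cn => y cy yn i; rewrite ltnS leq_eqVlt.
by move=> /predU1P[->|/cy].
Qed.

Section Kappa.
Context {R : realType}.
Implicit Types c : bits.

(* Base 4 expansion with digits 0 and 3: two sequences that differ below [n] are
   twice as far apart as two sequences that agree below [n] can be. *)
Fixpoint kappa_part n c : R :=
  if n is n'.+1 then (3 * (c 0%N)%:R + kappa_part n' (bit_shift c)) / 4 else 0.

Definition kappa c : R := limn (kappa_part^~ c).

Lemma kappa_part_bounds n c : 0 <= kappa_part n c <= 1.
Proof.
elim: n c => [|n IH] c /=; first by rewrite lexx ler01.
by have /andP[] := IH (bit_shift c); case: (c 0%N) => /=; lra.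
Qed.

Lemma kappa_part_incr n c : kappa_part n c <= kappa_part n.+1 c.
Proof.
elim: n c => [|n IH] c; first by have /andP[] := kappa_part_bounds 1 c.
have E m : kappa_part m.+1 c = (3 * (c 0%N)%:R + kappa_part m (bit_shift c)) / 4 by [].
by rewrite (E n) (E n.+1) ler_pM2r ?invr_gt0// lerD2l; exact: IH.
Qed.

Lemma kappa_part_cvg c : kappa_part n c @[n --> \oo] --> kappa c.
Proof.
apply: nondecreasing_is_cvgn.
  by apply/nondecreasing_seqP => n; exact: kappa_part_incr.
by exists 1 => _ [n _ <-]; case/andP: (kappa_part_bounds n c).
Qed.

Lemma kappa_bounds c : 0 <= kappa c <= 1.
Proof.
apply/andP; split.
  apply: limr_ge; first by apply: cvgP; exact: kappa_part_cvg.
  by apply: nearW => n; case/andP: (kappa_part_bounds n c).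
apply: limr_le; first by apply: cvgP; exact: kappa_part_cvg.
by apply: nearW => n; case/andP: (kappa_part_bounds n c).
Qed.

Lemma kappaE c : kappa c = (3 * (c 0%N)%:R + kappa (bit_shift c)) / 4.
Proof.
have h1 : kappa_part n.+1 c @[n --> \oo] --> kappa c.
  by have := @kappa_part_cvg c; rewrite -cvg_shiftS.
have h2 : kappa_part n.+1 c @[n --> \oo] --> (3 * (c 0%N)%:R + kappa (bit_shift c)) / 4.
  apply: cvgMr_tmp; apply: cvgD; [exact: cvg_cst|exact: kappa_part_cvg].
exact: cvg_unique h1 h2.
Qed.

Let quarter_gt0 : 0 < 4^-1 :> R. Proof. by rewrite invr_gt0. Qed.

Lemma kappa_agree n c c' : agree n c c' -> `|kappa c - kappa c'| <= 4 ^- n.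
Proof.
elim: n c c' => [|n IH] c c'.
  move=> _; rewrite expr0 invr1 ler_norml.
  by have /andP[] := kappa_bounds c; have /andP[] := kappa_bounds c'; lra.
move=> /agreeS[c0 /IH]; rewrite (kappaE c) (kappaE c') c0 exprS invfM.
set a := kappa _; set b := kappa _ => ab.
rewrite [X in `|X|](_ : _ = (a - b) / 4); last by field.
by rewrite normrM (gtr0_norm quarter_gt0) mulrC ler_wpM2l// ltW// quarter_gt0.
Qed.

Lemma kappa_disagree n c c' : ~ agree n c c' -> 2 * 4 ^- n <= `|kappa c - kappa c'|.
Proof.
elim: n c c' => [|n IH] c c' ncc'; first by case: ncc'.
have [c0|/eqP c0] := eqVneq (c 0%N) (c' 0%N).
  have /IH : ~ agree n (bit_shift c) (bit_shift c').
    by move=> cc'; apply: ncc'; apply/agreeS.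
  rewrite (kappaE c) (kappaE c') c0 exprS invfM.
  set a := kappa _; set b := kappa _ => ab.
  rewrite [X in `|X|](_ : _ = (a - b) / 4); last by field.
  rewrite normrM (gtr0_norm quarter_gt0) mulrCA [leRHS]mulrC.
  by rewrite ler_wpM2l// ltW// quarter_gt0.
(* The first digits differ and contribute [3 / 4], of which the tails cancel at most [1 / 4]. *)
have p1 : 4 ^- n.+1 <= (1 / 4 : R).
  rewrite exprS invfM mul1r -[leRHS]mulr1 ler_wpM2l ?invr_ge0//.
  by rewrite invf_le1 ?exprn_gt0// exprn_ege1// ler1n.
apply: (@le_trans _ _ (1 / 2)); first by lra.
rewrite (kappaE c) (kappaE c'); have /andP[] := kappa_bounds (bit_shift c).
have /andP[] := kappa_bounds (bit_shift c').
case: (c 0%N) (c' 0%N) c0 => -[] //= _ *; rewrite ler_normr; apply/orP; [left|right]; lra.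
Qed.

Lemma kappa_inj : injective kappa.
Proof.
move=> c c' kE; apply: agree_eq => n; apply: contrapT => /kappa_disagree.
by rewrite kE subrr normr0 leNgt mulr_gt0// invr_gt0 exprn_gt0.
Qed.

Lemma expr4_small (e : R) : 0 < e -> exists n, 4 ^- n < e.
Proof.
move=> e0; have : (fun n => (4^-1 : R) ^+ n) @ \oo --> (0 : R).
  by apply: cvg_expr; rewrite gtr0_norm ?invr_gt0// invf_lt1// ltr1n.
move=> /cvgrPdist_lt /(_ _ e0)[N _ /(_ N (leqnn N))] /=.
rewrite sub0r normrN exprVn ger0_norm ?invr_ge0 ?exprn_ge0//; by exists N.
Qed.

End Kappa.

(** A separate name for the product, so that it can carry the max distance as its metric
    structure. *)
Definition plane (R : realType) : Type := (R * R)%type.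

Section PlaneMetric.
Variable R : realType.

HB.instance Definition _ := PseudoMetric.copy (plane R) (R * R)%type.

Let dist (p q : plane R) : R := Num.max `|p.1 - q.1| `|p.2 - q.2|.

Let dist_ge0 p q : 0 <= dist p q.
Proof. by rewrite le_max normr_ge0. Qed.

Let dist_positivity p q : dist p q = 0 -> p = q.
Proof.
move=> d0; have : dist p q <= 0 by rewrite d0.
rewrite ge_max !normr_le0 !subr_eq0 => /andP[/eqP + /eqP].
by case: p q {d0} => [? ?] [? ?] /= -> ->.
Qed.

Let ballEdist p d : ball p d = [set q | dist p q < d].
Proof.
by apply/seteqP; split => q /=; rewrite gt_max => /andP.
Qed.

HB.instance Definition _ := PseudoMetric_isMetric.Build R (plane R)
  dist_ge0 dist_positivity ballEdist.

Lemma plane_mdistE (p q : plane R) : mdist p q = Num.max `|p.1 - q.1| `|p.2 - q.2|.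
Proof. by []. Qed.

End PlaneMetric.

Section WithinContinuity.
Context {R : realType} {M N : metricType R}.

Lemma within_continuous_mdistP (A : set M) (f : M -> N) :
  (forall x, A x -> forall e : R, 0 < e -> exists2 d : R, 0 < d &
    forall y, A y -> mdist x y < d -> mdist (f x) (f y) < e) ->
  {within A, continuous f}.
Proof.
move=> H; apply/subspace_continuousP => x Ax W /nbhs_mdistP[e e0 eW].
rewrite nbhs_simpl /= /within /=; have [d d0 Hd] := H _ Ax _ e0.
by apply/nbhs_mdistP; exists d => // y xy Ay; apply: eW; exact: Hd.
Qed.

End WithinContinuity.

Section Points.
Context {R : realType}.
Implicit Types (c : bits) (s x : R).

(** Slopes [kappa c] lie in [[0, 1]], so the max distance along a line is the difference of
    abscissas, and the abscissa of a tip is the length of its blade. *)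
Definition pt c s : plane R := (s, s * kappa c).

Definition origin : plane R := (0, 0).

Lemma pt0 c : pt c 0 = origin. Proof. by rewrite /pt mul0r. Qed.

Lemma pt_inj c c' s s' : 0 < s -> pt c s = pt c' s' -> c = c' /\ s = s'.
Proof.
move=> s0 [<-] /mulfI k; split => //; apply: (@kappa_inj R).
by apply: k; rewrite gt_eqF.
Qed.

Lemma pt_injr c s s' : pt c s = pt c s' -> s = s'.
Proof. by case. Qed.

Lemma pt_eq_origin c s : pt c s = origin -> s = 0.
Proof. by case. Qed.

Lemma pt_dist c s s' : mdist (pt c s) (pt c s') = `|s - s'|.
Proof.
rewrite plane_mdistE /= -mulrBl normrM; apply/max_idPl.
have /andP[k0 k1] := @kappa_bounds R c.
by rewrite (ger0_norm k0) ler_piMr.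
Qed.

Lemma pt_dist_agree n c c' s s' : agree n c c' -> 0 <= s <= 1 ->
  mdist (pt c s) (pt c' s') <= `|s - s'| + 4 ^- n.
Proof.
move=> cc' /andP[s0 s1]; apply: (le_trans (metric_triangle _ (pt c' s) _)).
rewrite pt_dist addrC lerD2l plane_mdistE /= subrr normr0 ge_max.
rewrite invr_ge0 exprn_ge0//= -mulrBr normrM (ger0_norm s0).
by rewrite (le_trans (ler_piMl (normr_ge0 _) s1)) ?kappa_agree.
Qed.

(** If the codes disagreed below [n], [pt c s] and [pt c' s] would be at least [2 * s * 4 ^- n]
    apart, while moving from [pt c' s'] to [pt c' s] costs at most the given distance: the factor
    [2] of [kappa_disagree] pays for this move. *)
Lemma pt_dist_near n c c' s s' : 0 < s ->
  mdist (pt c s) (pt c' s') < s * 4 ^- n -> agree n c c'.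
Proof.
move=> s0 d; apply: contrapT => /(@kappa_disagree R) k.
have := metric_triangle (pt c s) (pt c' s') (pt c' s).
rewrite (pt_dist c') leNgt => /negP; apply.
have ds : `|s' - s| <= mdist (pt c s) (pt c' s').
  by rewrite distrC plane_mdistE le_max /= lexx.
have : s * (2 * 4 ^- n) <= mdist (pt c s) (pt c' s).
  rewrite plane_mdistE le_max /= -mulrBr normrM (gtr0_norm s0).
  by rewrite ler_wpM2l ?orbT// ltW.
by apply: lt_le_trans; rewrite mulrCA; lra.
Qed.

Lemma pt_continuous c (h : R -> R) :
  continuous h -> continuous (pt c \o h : R -> plane R).
Proof.
move=> hc u W /nbhs_mdistP[e e0 eW].
have H : nbhs u (h @^-1` ball (h u) e) by apply: hc; exact: nbhsx_ballx.
rewrite nbhs_simpl; apply: filterS H => y /= hy.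
by apply: eW; rewrite pt_dist.
Qed.

End Points.

Section Fan.
Context {R : realType} (f : bits -> R).
Implicit Types (c : bits) (s x : R).

Definition upper_semicontinuous := forall c (e : R), 0 < e ->
  exists n, forall c', agree n c c' -> f c' < f c + e.

(** Where [f c = 0] the blade of [c] shrinks to [origin]; this is how codes are discarded. *)
Definition Fan : set (plane R) := [set p | exists c s, 0 <= s <= f c /\ p = pt c s].

Hypotheses (f01 : forall c, 0 <= f c <= 1) (usc : upper_semicontinuous).

Lemma pt_Fan c s : 0 <= s <= f c -> Fan (pt c s).
Proof. by exists c, s. Qed.

Lemma Fan_origin : Fan origin.
Proof.
exists (fun=> false), 0; rewrite pt0 lexx.
by case/andP: (f01 (fun=> false)) => ->.
Qed.

(** The fan is the image of the region below the graph of [f] in the product of the Cantor set with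
    [[0, 1]], and upper semicontinuity makes that region closed. *)
Lemma Fan_compact : compact Fan.
Proof.
pose A := [set cs : cantor_space * R | 0 <= cs.2 <= f cs.1].
have cA : compact A.
  apply: (@subclosed_compact _ _ ([set: cantor_space] `*` (`[0, 1]%classic : set R))).
  - move=> [c s] cAs.
    have near n (e : R) : 0 < e ->
        exists c' s', [/\ 0 <= s' <= f c', agree n c c' & `|s - s'| < e].
      move=> e0; have [|[c' s'] /= [sf [cc' ss']]] := cAs (agree n c `*` ball s e).
        exists (agree n c, ball s e) => //=.
        by split; [exact: agree_near|exact: nbhsx_ballx].
      by exists c', s'.
    rewrite /A /=; apply/andP; split.
      apply/ler_addgt0Pr => e e0; have [c' [s' [/andP[s0 _] _]]] := near 0%N e e0.
      by rewrite ltr_norml => /andP[]; lra.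
    apply/ler_addgt0Pr => e e0; have e20 : 0 < e / 2 by rewrite divr_gt0.
    have [n fn] := usc c e20.
    have [c' [s' [/andP[_ sf] /fn fc]]] := near n _ e20.
    by rewrite ltr_norml => /andP[]; lra.
  - by apply: compact_setX; [exact: cantor_space_compact|exact: segment_compact].
  - move=> [c s] /andP[/= s0 sf]; split => //=; rewrite in_itv/= s0.
    by apply: le_trans sf _; case/andP: (f01 c).
have -> : Fan = (fun cs : cantor_space * R => pt cs.1 cs.2) @` A.
  apply/seteqP; split => [p [c [s [sf ->]]]|_ [[c s] sf <-]]; first by exists (c, s).
  by exists c, s.
apply: continuous_compact => //; apply/subspace_continuousP => -[c s] /= Acs.
move=> W /nbhs_mdistP[e e0 eW]; rewrite nbhs_simpl /= /within /=.
have e20 : 0 < e / 2 by rewrite divr_gt0.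
have [n ne] := expr4_small e20.
exists (agree n c, ball s (e / 2)).
  by split; [exact: agree_near|exact: nbhsx_ballx].
move=> [c' s'] /= [cc' ss'] Acs'; apply: eW.
apply: le_lt_trans (pt_dist_agree _ cc' _) _.
  by case/andP: Acs => /= -> /le_trans; apply; case/andP: (f01 c).
by move: ss'; rewrite /ball /=; lra.
Qed.

End Fan.

Section Rays.
Context {R : realType}.
Implicit Types (c : bits) (s x : R).

Local Notation I01 := (`[0, 1]%classic : set R).

Definition ray c s : set (plane R) := pt c @` `[0, s].

Lemma ray_homeomorphism c (h : R -> R) : continuous h -> {homo h : u v / u < v} ->
  h 0 = 0 -> homeomorphism I01 (ray c (h 1)) (pt c \o h).
Proof.
move=> hc hi h0.
have -> : ray c (h 1) = (pt c \o h) @` I01.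
  apply/seteqP; split => [_ [x /= + <-]|_ [u Iu <-]].
    rewrite in_itv/= => /andP[x0 x1].
    have h01 : h 0 <= h 1 by apply/ltW/hi.
    have [|u Iu <-] := @IVT _ h 0 1 x ler01 (continuous_subspaceT hc).
      by rewrite h0 in h01 *; rewrite (min_idPl h01) (max_idPr h01) x0.
    by exists u.
  have /andP[u0 u1] := (itv01P u).1 Iu.
  exists (h u) => //=; rewrite in_itv/=; apply/andP; split.
    by move: u0; rewrite (le_eqVlt 0 u) => /predU1P[<-|/hi]; rewrite h0 // => /ltW.
  by move: u1; rewrite (le_eqVlt u) => /predU1P[->|/hi/ltW].
apply: homeomorphism_compact.
- exact: metric_hausdorff.
- exact: segment_compact.
- by apply: continuous_subspaceT; exact: pt_continuous.
- move=> u v _ _ /pt_injr huv.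
  by have [/hi|/hi|//] := ltgtP u v; rewrite huv ltxx.
Qed.

Lemma ray_arc c s : 0 < s -> arc_between (ray c s) origin (pt c s).
Proof.
move=> s0; exists (pt c \o (fun u => s * u)); split.
- have := @ray_homeomorphism c (fun u => s * u); rewrite mulr1 mulr0; apply => //.
    by move=> u; apply: cvgMl_tmp; exact: cvg_id.
  by move=> u v uv; rewrite ltr_pM2l.
- by rewrite /= mulr0 pt0.
- by rewrite /= mulr1.
Qed.

Lemma ray_sub_arc c s s' : 0 <= s -> s < s' ->
  arc_between (pt c @` `[s, s']) (pt c s) (pt c s').
Proof.
move=> s0 ss'; have s'0 := le_lt_trans s0 ss'.
pose h u := s' * u.
have hh : homeomorphism I01 (ray c (h 1)) (pt c \o h).
  apply: ray_homeomorphism; rewrite /h ?mulr0//.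
    by move=> u; apply: cvgMl_tmp; exact: cvg_id.
  by move=> u v uv; rewrite ltr_pM2l.
have := arc_param_sub (homeomorphism_arc_param hh) (divr_ge0 s0 (ltW s'0)) (lexx 1) _.
rewrite ltr_pdivrMr// mul1r => /(_ ss').
have hs : h (s / s') = s by rewrite /h mulrC divfK// gt_eqF.
rewrite /= hs {2}/h mulr1.
suff -> : (pt c \o h) @` `[s / s', 1] = pt c @` `[s, s'] by [].
apply/seteqP; split => [_ [u /= + <-]|_ [x /= + <-]]; rewrite in_itv/= => /andP[u0 u1].
  exists (h u) => //=; rewrite in_itv/= -hs /h ler_pM2l// u0/=.
  by rewrite ler_piMr// ltW.
exists (x / s'); last by rewrite /= /h mulrC divfK// gt_eqF.
by rewrite /= in_itv/= ler_pM2r ?invr_gt0// u0 ler_pdivrMr// mul1r.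
Qed.

Lemma ray_connected c s : connected (ray c s).
Proof.
apply: connected_continuous_connected; first exact: segment_connected.
by apply: continuous_subspaceT; apply: (@pt_continuous _ c id) => u; exact: cvg_id.
Qed.

Lemma rayP c s x : ray c s (pt c x) <-> 0 <= x <= s.
Proof.
split=> [[u /= + /pt_injr <-]|]; first by rewrite in_itv.
by exists x => //=; rewrite in_itv.
Qed.

(* The coefficients [a] and [b] vanish on complementary halves of [[0, 1]]: the
   path runs down the first ray, then up the second one. *)
Lemma ray_ray_arc c c' s s' : c != c' -> 0 < s -> 0 < s' ->
  arc_between (ray c s `|` ray c' s') (pt c s) (pt c' s').
Proof.
move=> cc' s0 s'0; apply/arc_betweenP.
pose pos (y : R) := (y + `|y|) / 2.
have pos_id y : 0 <= y -> pos y = y by move=> y0; rewrite /pos ger0_norm//; lra.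
have pos_0 y : y <= 0 -> pos y = 0 by move=> y0; rewrite /pos ler0_norm//; lra.
have posc (g : R -> R) : continuous g -> continuous (pos \o g).
  move=> gc u; apply: cvgMr_tmp; apply: cvgD; first exact: gc.
  by apply: cvg_norm; exact: gc.
pose a u : R := s * pos (1 - 2 * u).
pose b u : R := s' * pos (2 * u - 1).
have ac : continuous a.
  move=> u; apply: cvgMl_tmp; apply: (posc (fun u => 1 - 2 * u)) => v.
  by apply: cvgB; [exact: cvg_cst|apply: cvgMl_tmp; exact: cvg_id].
have bc : continuous b.
  move=> u; apply: cvgMl_tmp; apply: (posc (fun u => 2 * u - 1)) => v.
  by apply: cvgB; [apply: cvgMl_tmp; exact: cvg_id|exact: cvg_cst].
pose phi u : plane R := (a u + b u, a u * kappa c + b u * kappa c').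
have phi1 u : u <= 1 / 2 -> phi u = pt c (s * (1 - 2 * u)).
  move=> u2; have h1 : 2 * u - 1 <= 0 by lra.
  have h2 : 0 <= 1 - 2 * u by lra.
  have bu : b u = 0 by rewrite /b (pos_0 _ h1) mulr0.
  have au : a u = s * (1 - 2 * u) by rewrite /a (pos_id _ h2).
  by rewrite /phi bu au mul0r !addr0.
have phi2 u : 1 / 2 <= u -> phi u = pt c' (s' * (2 * u - 1)).
  move=> u2; have h1 : 1 - 2 * u <= 0 by lra.
  have h2 : 0 <= 2 * u - 1 by lra.
  have au : a u = 0 by rewrite /a (pos_0 _ h1) mulr0.
  have bu : b u = s' * (2 * u - 1) by rewrite /b (pos_id _ h2).
  by rewrite /phi bu au mul0r !add0r.
exists phi; split.
- apply: continuous_subspaceT => u W /nbhs_mdistP[e e0 eW].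
  have c1 : continuous (fun u => a u + b u).
    by move=> v; apply: cvgD; [exact: ac|exact: bc].
  have c2 : continuous (fun u => a u * kappa c + b u * kappa c').
    by move=> v; apply: cvgD; [apply: cvgMr_tmp; exact: ac|apply: cvgMr_tmp; exact: bc].
  rewrite nbhs_simpl.
  have H1 : nbhs u ((fun u => a u + b u) @^-1` ball (a u + b u) e).
    by apply: c1; exact: nbhsx_ballx.
  have H2 : nbhs u ((fun u => a u * kappa c + b u * kappa c') @^-1`
      ball (a u * kappa c + b u * kappa c') e).
    by apply: c2; exact: nbhsx_ballx.
  apply: filterS2 H1 H2 => v /= h1 h2; apply: eW.
  by rewrite plane_mdistE gt_max; apply/andP.
- move=> u v _ _; have [u2|u2] := leP u (1 / 2); have [v2|v2] := leP v (1 / 2).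
  + rewrite !phi1// => /pt_injr /mulfI; rewrite gt_eqF// => /(_ isT); lra.
  + rewrite phi1// (phi2 v) ?(ltW v2)// => /esym /pt_inj [|cE _].
      by rewrite mulr_gt0//; lra.
    by rewrite cE eqxx in cc'.
  + rewrite phi2 ?(ltW u2)// (phi1 v)// => /pt_inj [|cE _].
      by rewrite mulr_gt0//; lra.
    by rewrite cE eqxx in cc'.
  + rewrite !phi2 ?ltW// => /pt_injr /mulfI; rewrite gt_eqF// => /(_ isT); lra.
- apply/seteqP; split => [p []|_ [u Iu <-]].
  + move=> [x + <-]; rewrite /= in_itv/= => /andP[x0 xs].
    have d0 : 0 <= x / s by rewrite divr_ge0// ltW.
    have d1 : x / s <= 1 by rewrite ler_pdivrMr// mul1r.
    exists ((1 - x / s) / 2); first by apply/itv01P; apply/andP; split; lra.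
    rewrite phi1; last by lra.
    by congr pt; rewrite mulrC; field; rewrite gt_eqF.
  + move=> [x + <-]; rewrite /= in_itv/= => /andP[x0 xs].
    have d0 : 0 <= x / s' by rewrite divr_ge0// ltW.
    have d1 : x / s' <= 1 by rewrite ler_pdivrMr// mul1r.
    exists ((1 + x / s') / 2); first by apply/itv01P; apply/andP; split; lra.
    rewrite phi2; last by lra.
    by congr pt; rewrite mulrC; field; rewrite gt_eqF.
  + have /andP[u0 u1] := (itv01P u).1 Iu; have [u2|u2] := leP u (1 / 2).
      by left; rewrite phi1//; apply/rayP/andP; split; nra.
    by right; rewrite phi2 ?(ltW u2)//; apply/rayP/andP; split; nra.
- by rewrite phi1; [congr pt|]; lra.
- by rewrite phi2; [congr pt|]; lra.
Qed.

End Rays.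

(** * Subcontinua of a planar fan *)

Section FanContinua.
Context {R : realType} (f : bits -> R).
Implicit Types (c : bits) (s x : R) (S A B : set (plane R)).

Hypotheses (f01 : forall c, 0 <= f c <= 1) (usc : upper_semicontinuous f).
Local Notation F := (Fan f).

(* If [S] misses [pt c x], it misses a whole level-[x] cylinder around it, which
   makes the part of [S] above that cylinder relatively clopen. *)
Lemma Fan_connected_above S c s x : S `<=` F -> closed S -> connected S ->
  S (pt c s) -> 0 < x < s -> ~ S (pt c x) ->
  forall q, S q -> exists2 s', x < s' & q = pt c s'.
Proof.
move=> SF cS coS Ss /andP[x0 xs] nSx.
have [e e0 He] := notin_closed_mdist cS nSx.
have s1 : s <= 1.
  have [c' [s' [/andP[_ sf] /esym]]] := SF _ Ss.
  have s0 := lt_trans x0 xs.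
  have [s'0|s'0] := leP s' 0; first by move=> [s'E _]; lra.
  by move=> /(pt_inj s'0)[_ <-]; apply: le_trans sf _; case/andP: (f01 c').
have cut n : 4 ^- n < e -> forall q, S q ->
    exists c' s', [/\ x < s', agree n c c' & q = pt c' s'].
  (* The factor [3 / 2] separates slopes at most [4 ^- n] apart, for codes agreeing below [n], from
     slopes at least [2 * 4 ^- n] apart. Moreover no point of [S] at level [x] has a code agreeing
     with [c] below [n], as it would be within [e] of [pt c x]. So the open [O1] and the closed [O2]
     cut the same part out of [S]. *)
  move=> ne; pose a : R := 3 / 2 * 4 ^- n.
  have n0 : 0 < 4 ^- n :> R by rewrite invr_gt0 exprn_gt0.
  pose O1 := [set p : plane R | x < p.1] `&`
    [set p : plane R | `|p.2 - p.1 * kappa c| < p.1 * a].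
  pose O2 := [set p : plane R | x <= p.1] `&`
    [set p : plane R | `|p.2 - p.1 * kappa c| <= p.1 * a].
  have kc : continuous (fun p : plane R => `|p.2 - p.1 * kappa c|).
    move=> p; apply: (@cvg_norm _ R^o); apply: cvgB; first exact: cvg_snd.
    by apply: cvgMr_tmp; exact: cvg_fst.
  have ac : continuous (fun p : plane R => p.1 * a).
    by move=> p; apply: cvgMr_tmp; exact: cvg_fst.
  have oO1 : open O1.
    apply: openI; first by apply: open_comp (@open_gt _ x) => p _; exact: cvg_fst.
    rewrite (_ : [set _ | _] = (fun p : plane R =>
        p.1 * a - `|p.2 - p.1 * kappa c|) @^-1` [set y | 0 < y]); last first.
      by apply/seteqP; split => p /=; rewrite subr_gt0.
    by apply: open_comp (@open_gt _ 0) => p _; apply: cvgB; [exact: ac|exact: kc].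
  have cO2 : closed O2.
    apply: closedI; first by apply: closed_comp (@closed_ge _ x) => p _; exact: cvg_fst.
    rewrite (_ : [set _ | _] = (fun p : plane R =>
        p.1 * a - `|p.2 - p.1 * kappa c|) @^-1` [set y | 0 <= y]); last first.
      by apply/seteqP; split => p /=; rewrite subr_ge0.
    by apply: closed_comp (@closed_ge _ 0) => p _; apply: cvgB; [exact: ac|exact: kc].
  have near c' s' : 0 < s' -> `|s' * kappa c' - s' * kappa c| <= s' * a -> agree n c c'.
    move=> s'0; rewrite -mulrBr normrM gtr0_norm// ler_pM2l// => k.
    apply: contrapT => /(@kappa_disagree R); rewrite distrC; rewrite /a in k; lra.
  have O12 : S `&` O1 = S `&` O2.
    apply/seteqP; split => p [Sp [p1 p2]]; split => //; first by split; exact: ltW.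
    have [c' [s' [sf pE]]] := SF _ Sp; subst p; move: p1 p2 => /= p1 p2.
    have s'0 : 0 < s' := lt_le_trans x0 p1.
    have cc' := near _ _ s'0 p2.
    split => /=.
      rewrite lt_neqAle p1 andbT; apply/eqP => xE; subst s'.
      have := He _ Sp; apply/negP; rewrite -ltNge; apply: le_lt_trans ne.
      have := pt_dist_agree x cc' (_ : 0 <= x <= 1); rewrite subrr normr0 add0r; apply.
      by rewrite (ltW x0) (le_trans (ltW xs)).
    rewrite -mulrBr normrM gtr0_norm// ltr_pM2l//.
    rewrite distrC; apply: le_lt_trans (kappa_agree cc') _; rewrite /a; lra.
  have SE : S `&` O1 = S.
    apply: coS; last by exists O2.
      exists (pt c s); split => //; split => //=.
      by rewrite subrr normr0 !mulr_gt0// (lt_trans x0).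
    by exists O1.
  move=> q Sq; have [_ [q1 q2]] : (S `&` O1) q by rewrite SE.
  have [c' [s' [sf qE]]] := SF _ Sq; subst q; exists c', s'; split => //.
  by apply: near; [exact: lt_trans q1|exact: ltW].
(* All of [S] lies in arbitrarily small cylinders around [c], so [c] is the only code left; [N]
   ensures the smallness that [cut] asks for. *)
have [N Ne] := expr4_small e0.
move=> q Sq; have [c' [s' [xs' _ qE]]] := cut N Ne q Sq; exists s' => //.
rewrite qE; congr pt; apply/esym/agree_eq => n.
pose m := maxn n N; have me : 4 ^- m < e.
  apply: le_lt_trans Ne; rewrite lef_pV2 ?posrE ?exprn_gt0//.
  by apply: ler_weXn2l; [rewrite ler1n|rewrite leq_maxr].
have [c'' [s'' [xs'' cc'' qE']]] := cut m me q Sq.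
have s'0 : 0 < s' := lt_trans x0 xs'.
have [c''E _] : c' = c'' /\ s' = s'' by apply: (pt_inj s'0); rewrite -qE.
by rewrite c''E; apply: agree_leq cc''; rewrite leq_maxl.
Qed.

Lemma Fan_continuum_star S c s x : S `<=` F -> continuum S -> S origin ->
  S (pt c s) -> 0 <= x <= s -> S (pt c x).
Proof.
move=> SF [_ kS coS] S0 Ss /andP[]; rewrite le_eqVlt => /predU1P[<- _|x0].
  by rewrite pt0.
rewrite le_eqVlt => /predU1P[->//|xs]; apply: contrapT => nSx.
have cS := compact_mdist_closed kS.
have [|s' xs' /esym/pt_eq_origin] := Fan_connected_above SF cS coS Ss _ nSx S0.
  by rewrite x0.
lra.
Qed.

Lemma Fan_continuum_between S c s s' x : S `<=` F -> continuum S -> 0 <= s ->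
  S (pt c s) -> S (pt c s') -> s <= x <= s' -> S (pt c x).
Proof.
move=> SF [_ kS coS] s0 Ss Ss' /andP[]; rewrite le_eqVlt => /predU1P[<-//|sx].
rewrite le_eqVlt => /predU1P[->//|xs']; apply: contrapT => nSx.
have cS := compact_mdist_closed kS.
have [|s'' xs'' /pt_injr] := Fan_connected_above SF cS coS Ss' _ nSx Ss.
  by rewrite xs' (le_lt_trans s0).
lra.
Qed.

(** All [pt c x] with [x] small belong to [S], since otherwise [Fan_connected_above] would confine
    [S] to the blade of [c]. As [S] is closed, it contains their limit. *)
Lemma Fan_continuum_origin S c c' s s' : S `<=` F -> continuum S -> 0 < s ->
  0 < s' -> S (pt c s) -> S (pt c' s') -> c <> c' -> S origin.
Proof.
move=> SF [_ kS coS] s0 s'0 Ss Ss' cc'.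
have cS := compact_mdist_closed kS.
apply: (cS origin); apply/closure_mdistP => e e0.
pose x := Num.min (s / 2) (e / 2).
have x0 : 0 < x by rewrite lt_min !divr_gt0.
have xe : x <= e / 2 by rewrite ge_min lexx orbT.
have xs : x <= s / 2 by rewrite ge_min lexx.
exists (pt c x); last by rewrite -(pt0 c) pt_dist sub0r normrN gtr0_norm//; lra.
apply: contrapT => nSx.
have [|s'' xs'' /(pt_inj s'0)[cE _]] := Fan_connected_above SF cS coS Ss _ nSx Ss'.
  by rewrite x0; lra.
by case: cc'.
Qed.

(** If [A] and [B] both contain the origin, their intersection is a union of rays. Otherwise it lies
    on a single blade, since a continuum with points on two blades contains the origin, and there it
    is the image of an interval. *)
Lemma Fan_hereditarily_unicoherent : hereditarily_unicoherent F.
Proof.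
move=> K KF cK A B cA cB AB.
have AF : A `<=` F by move=> p Ap; apply: KF; rewrite -AB; left.
have BF : B `<=` F by move=> p Bp; apply: KF; rewrite -AB; right.
have [[A0 B0]|nAB] := pselect ((A `&` B) origin).
  have -> : A `&` B = \bigcup_(cs in [set cs : bits * R |
      0 <= cs.2 /\ (A `&` B) (pt cs.1 cs.2)]) ray cs.1 cs.2.
    apply/seteqP; split => [p [Ap Bp]|p [[c s] /= [s0 [As Bs]] [x + <-]]].
      have [c [s [/andP[s0 _] pE]]] := AF _ Ap; rewrite pE in Ap Bp *.
      by exists (c, s) => //; apply/rayP; rewrite s0 lexx.
    rewrite /= in_itv/= => xs.
    by split; apply: (@Fan_continuum_star _ c s).
  apply: bigcup_connected; last by move=> [c s] _; exact: ray_connected.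
  exists origin => -[c s] /= [s0 _]; rewrite -(pt0 c); apply/rayP.
  by rewrite lexx s0.
have [->|/set0P[p [Ap Bp]]] := eqVneq (A `&` B) set0; first exact: connected0.
have [c [s [/andP[s0 _] pE]]] := AF _ Ap; subst p.
have {s0} s0 : 0 < s.
  rewrite lt_neqAle s0 andbT; apply/eqP => sE.
  by apply: nAB; rewrite -(pt0 c) sE.
have one q : (A `&` B) q -> exists2 s', 0 < s' & q = pt c s'.
  move=> [Aq Bq]; have [c' [s' [/andP[s'0 _] qE]]] := AF _ Aq; subst q.
  have {s'0} s'0 : 0 < s'.
    rewrite lt_neqAle s'0 andbT; apply/eqP => sE.
    by apply: nAB; rewrite -(pt0 c') sE.
  exists s' => //; have [->//|/eqP cc'] := eqVneq c c'; case: nAB; split.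
    exact: (Fan_continuum_origin AF cA s0 s'0 Ap Aq cc').
  exact: (Fan_continuum_origin BF cB s0 s'0 Bp Bq cc').
have -> : A `&` B = pt c @` [set x | 0 < x /\ (A `&` B) (pt c x)].
  apply/seteqP; split => [q ABq|_ [x [_ ABx] <-]] //.
  by have [s' s'0 qE] := one _ ABq; exists s' => //; split => //; rewrite -qE.
apply: connected_continuous_connected; last first.
  by apply: continuous_subspaceT; apply: (@pt_continuous _ c id) => u; exact: cvg_id.
apply/connected_intervalP => u v [u0 [Au Bu]] [v0 [Av Bv]] w uwv.
have w0 : 0 < w by case/andP: uwv => + _; exact: lt_le_trans.
split => //; split.
  exact: (Fan_continuum_between AF cA (ltW u0) Au Av).
exact: (Fan_continuum_between BF cB (ltW u0) Bu Bv).
Qed.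

Lemma ray_Fan c s : s <= f c -> ray c s `<=` F.
Proof.
move=> sf _ [x /= + <-]; rewrite in_itv/= => /andP[x0 xs].
by apply: pt_Fan; rewrite x0 (le_trans xs).
Qed.

Lemma Fan_arcwise_connected : arcwise_connected F.
Proof.
have arc0 c s : 0 < s -> s <= f c -> exists2 A, A `<=` F & arc_between A origin (pt c s).
  by move=> s0 sf; exists (ray c s); [exact: ray_Fan|exact: ray_arc].
move=> _ _ [c [s [/andP[+ sf] ->]]] [c' [s' [/andP[+ sf'] ->]]].
rewrite le_eqVlt => /predU1P[<-|s0]; rewrite le_eqVlt => /predU1P[<-|s0'].
- by rewrite !pt0 eqxx.
- by move=> _; rewrite pt0; exact: arc0.
- move=> _; rewrite pt0; have [A AF aA] := arc0 c s s0 sf.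
  by exists A => //; exact: arc_sym.
- have [cE|cc'] := eqVneq c c' => ss'.
    subst c'; have [sE|ls|ls] := ltgtP s s'; last by rewrite ls eqxx in ss'.
      exists (pt c @` `[s, s']); last by apply: ray_sub_arc => //; exact: ltW.
      move=> _ [x /= + <-]; rewrite in_itv/= => /andP[xs xs'].
      by apply: pt_Fan; apply/andP; split; lra.
    exists (pt c @` `[s', s]); last by apply/arc_sym/ray_sub_arc => //; exact: ltW.
    move=> _ [x /= + <-]; rewrite in_itv/= => /andP[xs xs'].
    by apply: pt_Fan; apply/andP; split; lra.
  exists (ray c s `|` ray c' s'); last exact: ray_ray_arc.
  by rewrite subUset; split; exact: ray_Fan.
Qed.

Lemma Fan_dendroid : dendroid F.
Proof.
split; [split|exact: Fan_arcwise_connected|exact: Fan_hereditarily_unicoherent].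
- by exists origin; exact: Fan_origin.
- exact: Fan_compact.
- have -> : F = \bigcup_(c in [set: bits]) ray c (f c).
    apply/seteqP; split => [_ [c [s [sf ->]]]|p [c _]]; last exact: ray_Fan.
    by exists c => //; apply/rayP.
  apply: bigcup_connected; last by move=> c _; exact: ray_connected.
  exists origin => c _; rewrite -(pt0 c); apply/rayP.
  by rewrite lexx; case/andP: (f01 c).
Qed.

End FanContinua.

(** * Endpoints, ramification and smoothness of a planar fan *)

Section FanStructure.
Context {R : realType} (f : bits -> R).
Implicit Types (c : bits) (s x : R) (S A B : set (plane R)).

Hypotheses (f01 : forall c, 0 <= f c <= 1) (usc : upper_semicontinuous f).
Hypothesis three : exists c1 c2 c3,
  [/\ 0 < f c1, 0 < f c2 & 0 < f c3] /\ [/\ c1 != c2, c1 != c3 & c2 != c3].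
Local Notation F := (Fan f).
Local Notation seg := (segment F origin).

Let hF := Fan_hereditarily_unicoherent f01.
Let aF := @Fan_arcwise_connected R f.
Let oF := Fan_origin f01.

Lemma Fan_segment c s : 0 <= s <= f c -> seg (pt c s) = ray c s.
Proof.
move=> /andP[]; rewrite le_eqVlt => /predU1P[<- _|s0 sf].
  by rewrite pt0 segment_top /ray set_itv1 image_set1 pt0.
by apply: (segment_eq hF aF oF); [exact: ray_Fan|exact: ray_arc].
Qed.

Lemma Fan_tip_maximal c : 0 < f c -> maximal_in_order F origin (pt c (f c)).
Proof.
move=> f0; have fc : 0 <= f c <= f c by rewrite ltW/=.
split; first exact: pt_Fan.
move=> _ [c' [s' [sf' ->]]]; rewrite Fan_segment //.
move=> -[x /= + /esym /(pt_inj f0)[cE xE]].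
subst c' x; rewrite in_itv/= => /andP[_ fs].
by congr pt; apply/eqP; rewrite eq_le fs andbT; case/andP: sf'.
Qed.

Lemma Fan_endpoints : endpoints F = [set p | exists c, 0 < f c /\ p = pt c (f c)].
Proof.
apply/seteqP; split => [p [[c [s [/andP[s0 sf] ->]]] ep]|_ [c [f0 ->]]]; last first.
  exact: (maximal_endpoint hF aF oF (Fan_tip_maximal f0)).
move: s0 sf ep; rewrite le_eqVlt => /predU1P[<- _ ep|s0].
  (* The origin is interior to the arc made of two blades, so it is no endpoint. *)
  have [c1 [c2 [c3 [[f1 f2 _] [c12 _ _]]]]] := three.
  have UF : ray c1 (f c1) `|` ray c2 (f c2) `<=` F.
    by rewrite subUset; split; exact: ray_Fan.
  have := ep _ _ _ UF (ray_ray_arc c12 f1 f2); rewrite pt0 => -[].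
  - by left; rewrite -(pt0 c1); apply/rayP; rewrite lexx ltW.
  - by move=> /esym/pt_eq_origin f10; rewrite f10 ltxx in f1.
  - by move=> /esym/pt_eq_origin f10; rewrite f10 ltxx in f2.
rewrite le_eqVlt => /predU1P[sE _|sf ep]; first by exists c; rewrite -sE.
have := ep _ _ _ (ray_Fan (lexx (f c))) (ray_arc c (lt_trans s0 sf)).
move=> [|/pt_eq_origin|/pt_injr].
- by apply/rayP; rewrite !ltW.
- lra.
- lra.
Qed.

(** [down] and [up] say that [A] contains a one-sided neighbourhood of [pt c s] in its blade,
    towards or away from the origin. *)
Let down A c s := exists2 d : R, d < s & forall x, d < x < s -> A (pt c x).
Let up A c s := exists2 d : R, s < d & forall x, s < x < d -> A (pt c x).

Let arc_direction A c s q : A `<=` F -> 0 < s -> arc_between A (pt c s) q ->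
  down A c s \/ up A c s.
Proof.
move=> AF s0 aA; have [Ap Aq pq] := arc_ends aA; have cA := arc_continuum aA.
have [c' [s' [/andP[+ _] qE]]] := AF _ Aq; subst q.
have dn : A origin -> down A c s.
  move=> A0; exists 0 => // x /andP[x0 xs].
  by apply: (Fan_continuum_star f01 AF cA A0 Ap); rewrite !ltW.
rewrite le_eqVlt => /predU1P[s'E|s'0].
  by left; apply: dn; rewrite -(pt0 c') s'E.
have [cE|/eqP cc'] := eqVneq c c'; last first.
  by left; apply: dn; exact: (Fan_continuum_origin f01 AF cA s0 s'0 Ap Aq).
subst c'; have [ss'|ss'|ss'] := ltgtP s s'; last by rewrite ss' eqxx in pq.
  right; exists s' => // x /andP[xs xs'].
  by apply: (Fan_continuum_between f01 AF cA (ltW s0) Ap Aq); rewrite !ltW.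
left; exists s' => // x /andP[xs xs'].
by apply: (Fan_continuum_between f01 AF cA (ltW s'0) Aq Ap); rewrite !ltW.
Qed.

Let down_meet A B c s : down A c s -> down B c s -> A `&` B <> [set pt c s].
Proof.
move=> [d ds Ad] [d' d's Bd]; pose x := (Num.max d d' + s) / 2.
have dd : d <= Num.max d d' by rewrite le_max lexx.
have dd' : d' <= Num.max d d' by rewrite le_max lexx orbT.
have ms : Num.max d d' < s by rewrite gt_max ds.
move=> E; have : (A `&` B) (pt c x).
  by split; [apply: Ad|apply: Bd]; rewrite /x; apply/andP; split; lra.
by rewrite E => /pt_injr; rewrite /x; lra.
Qed.

Let up_meet A B c s : up A c s -> up B c s -> A `&` B <> [set pt c s].
Proof.
move=> [d ds Ad] [d' d's Bd]; pose x := (Num.min d d' + s) / 2.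
have dd : Num.min d d' <= d by rewrite ge_min lexx.
have dd' : Num.min d d' <= d' by rewrite ge_min lexx orbT.
have ms : s < Num.min d d' by rewrite lt_min ds.
move=> E; have : (A `&` B) (pt c x).
  by split; [apply: Ad|apply: Bd]; rewrite /x; apply/andP; split; lra.
by rewrite E => /pt_injr; rewrite /x; lra.
Qed.

Let ray_meet c c' : c != c' -> 0 < f c -> 0 < f c' ->
  ray c (f c) `&` ray c' (f c') = [set origin].
Proof.
move=> cc' f0 f0'; apply/seteqP; split => [_ [[x /= + <-]]|_ ->]; last first.
  by split; [rewrite -(pt0 c)|rewrite -(pt0 c')]; apply/rayP; rewrite lexx ltW.
rewrite in_itv/= => /andP[+ _]; rewrite le_eqVlt => /predU1P[<- _|x0].
  by rewrite pt0.
by move=> [x' _ /esym/(pt_inj x0)[cE _]]; rewrite cE eqxx in cc'.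
Qed.

(* Through a point off the top there are only two directions, so two of the
   three legs of a triod would overlap. *)
Lemma Fan_ramification : ramification_points F = [set origin].
Proof.
apply/seteqP; split => [p [S SF [A [B [C [x [y [z [[aA aB aC] [AB AC BC] SE]]]]]]]]|_ ->].
  have [Ap _ _] := arc_ends aA.
  have [AF BF CF] : [/\ A `<=` F, B `<=` F & C `<=` F].
    by split => q ?; apply: SF; rewrite SE; [left; left|left; right|right].
  have [c [s [/andP[+ _] pE]]] := AF _ Ap; subst p.
  rewrite le_eqVlt => /predU1P[<-|s0]; first by rewrite pt0.
  have [a|a] := arc_direction AF s0 aA; have [b|b] := arc_direction BF s0 aB;
    have [d|d] := arc_direction CF s0 aC;
    first [by case: (down_meet a b)|by case: (down_meet a d)|by case: (down_meet b d)
          |by case: (up_meet a b)|by case: (up_meet a d)|by case: (up_meet b d)].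
have [c1 [c2 [c3 [[f1 f2 f3] [c12 c13 c23]]]]] := three.
exists (ray c1 (f c1) `|` ray c2 (f c2) `|` ray c3 (f c3)).
  by rewrite !subUset; split; [split|]; exact: ray_Fan.
exists (ray c1 (f c1)), (ray c2 (f c2)), (ray c3 (f c3)),
  (pt c1 (f c1)), (pt c2 (f c2)), (pt c3 (f c3)); split => //.
  by split; exact: ray_arc.
by split; exact: ray_meet.
Qed.

Lemma Fan_fan : fan F origin.
Proof. by split; [exact: Fan_dendroid|exact: Fan_ramification]. Qed.

(** Segments are swept by the homotheties of ratio [u] in [[0, 1]], which increase no distance; this
    is why the segments of two close points are close. *)
Let seg_scale c s : 0 <= s <= f c ->
  seg (pt c s) = [set ((u * (pt c s).1, u * (pt c s).2) : plane R) | u in `[0, 1]].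
Proof.
move=> sf; rewrite Fan_segment //; apply/seteqP; split => [_ [x /= + <-]|_ [u /= + <-]].
  rewrite in_itv/= => /andP[]; rewrite le_eqVlt => /predU1P[<- _|x0 xs].
    by exists 0; rewrite ?pt0 ?mul0r //= in_itv/= lexx ler01.
  have s0 := lt_le_trans x0 xs; exists (x / s).
    rewrite /= in_itv/=; apply/andP; split; first by rewrite divr_ge0 ?ltW.
    by rewrite ler_pdivrMr// mul1r.
  by rewrite /pt /= mulrA divfK ?gt_eqF.
rewrite in_itv/= => /andP[u0 u1]; case/andP: sf => s0 _.
exists (u * s); last by rewrite /pt /= mulrA.
by rewrite /= in_itv/= mulr_ge0//= ler_piMl.
Qed.

Let hausdorff_segment p q (e : R) : F p -> F q -> mdist p q < e ->
  0 <= hausdorff_dist (seg p) (seg q) <= e.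
Proof.
move=> [c [s [sf ->]]] [c' [s' [sf' ->]]] pq.
have near (p' q' : plane R) u : 0 <= u <= 1 -> mdist p' q' < e ->
    mdist ((u * p'.1, u * p'.2) : plane R) ((u * q'.1, u * q'.2) : plane R) < e.
  move=> /andP[u0 u1]; apply: le_lt_trans; rewrite !plane_mdistE /= -!mulrBr !normrM.
  rewrite (ger0_norm u0) ge_max !le_max; apply/andP; split; apply/orP; [left|right];
    by rewrite ler_piMl.
suff H : [set r : R | [/\ 0 < r,
    forall a, seg (pt c s) a -> exists2 b, seg (pt c' s') b & mdist a b < r &
    forall b, seg (pt c' s') b -> exists2 a, seg (pt c s) a & mdist a b < r]] e.
  apply/andP; split; first by apply: lb_le_inf; [exists e|move=> r [/ltW]].
  by apply: ge_inf => //; exists 0 => r [/ltW].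
rewrite !seg_scale //; split.
- by apply: le_lt_trans pq; exact: mdist_ge0.
- move=> _ [u u01 <-]; exists (u * (pt c' s').1, u * (pt c' s').2); first by exists u.
  by apply: near => //; move: u01; rewrite /= in_itv.
- move=> _ [u u01 <-]; exists (u * (pt c s).1, u * (pt c s).2); first by exists u.
  by apply: near => //; move: u01; rewrite /= in_itv.
Qed.

Lemma Fan_smooth : smooth_fan F origin.
Proof.
split; first exact: Fan_fan.
move=> x l Fx Fl xl; apply/cvgrPdist_lt => e e0.
have e20 : 0 < e / 2 by rewrite divr_gt0.
near=> n.
have : ball l (e / 2) (x n) by near: n; apply: xl; exact: nbhsx_ballx.
rewrite ballEmdist /= metric_sym.
move=> /(hausdorff_segment (Fx n) Fl)/andP[h0 he].
rewrite sub0r normrN ger0_norm //; apply: le_lt_trans he _.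
by rewrite ltr_pdivrMr// ltr_pMr// ltr1n.
Unshelve. all: by end_near. Qed.

End FanStructure.

Lemma homeomorphism_comp {S T U : topologicalType} (A : set S) (B : set T)
    (C : set U) (f : S -> T) (g : T -> U) :
  homeomorphism A B f -> homeomorphism B C g -> homeomorphism A C (g \o f).
Proof.
move=> [[fAB finj fsurj] fc [f' [f'f f'c]]] [[gBC ginj gsurj] gc [g' [g'g g'c]]].
split; first split.
- by move=> x /fAB /gBC.
- move=> x y /set_mem Ax /set_mem Ay /= /ginj; rewrite !inE.
  by move=> /(_ (fAB _ Ax) (fAB _ Ay)) /finj; rewrite !inE; apply.
- move=> z /gsurj[y By <-]; have [x Ax <-] := fsurj _ By.
  by exists x.
- exact: (continuous_within_comp fc gc fAB).
- exists (f' \o g'); split=> [x Ax|]; first by rewrite /= g'g ?f'f //; exact: fAB.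
  apply: (continuous_within_comp g'c f'c) => z /gsurj[y By <-].
  by rewrite g'g.
Qed.

(** * Generation and homogeneity in terms of heights *)

Section Criteria.
Context {R : realType} (f : bits -> R).
Implicit Types (c : bits) (s x : R).

Hypotheses (f01 : forall c, 0 <= f c <= 1) (usc : upper_semicontinuous f).
Hypothesis three : exists c1 c2 c3,
  [/\ 0 < f c1, 0 < f c2 & 0 < f c3] /\ [/\ c1 != c2, c1 != c3 & c2 != c3].
Local Notation F := (Fan f).
Local Notation tip c := (pt c (f c)).

(** Off the top, these are the abscissas at which other tips accumulate on the blade of [c]:
    [c' <> c] reflects the removal of the blade in [endpoint_generated], and [0 < f c'] says that
    [c'] carries an endpoint. *)
Definition heights_near c : set R := [set y | forall n (e : R), 0 < e ->
  exists c', [/\ agree n c c', c' <> c, 0 < f c' & `|f c' - y| < e]].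

(* Every tip close to the top would put [0] in [X], whatever its blade, hence
   the last hypothesis. *)
Lemma Fan_endpoint_generated (X : set R) : X `<=` `[0, 1] ->
  (forall c, 0 < f c -> exists h : R -> R,
    [/\ continuous h, {homo h : u v / u < v}, h 0 = 0, h 1 = f c &
        h @` X = heights_near c]) ->
  (X 0 \/ exists2 d : R, 0 < d & forall c, 0 < f c -> d <= f c) ->
  endpoint_generated X F origin.
Proof.
move=> hX hh X0 _ [e + <-]; rewrite Fan_endpoints // => -[c [f0 ->]].
have fc : 0 <= f c <= f c by rewrite ltW/=.
have [h [hc hi h0 h1 hXE]] := hh c f0.
rewrite Fan_segment//; exists (pt c \o h); split.
- by rewrite -h1; exact: ray_homeomorphism.
- by rewrite /= h0 pt0.
have tip_ray c' : 0 < f c' -> ray c (f c) (tip c') -> c' = c.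
  by move=> f'0 [x _ /esym/(pt_inj f'0)[]].
rewrite -image_comp hXE; apply/seteqP; split.
  move=> _ [y cy <-]; have yf : 0 <= y <= f c.
    move: cy; rewrite -hXE => -[x /hX /itv01P/andP[x0 x1] <-]; apply/andP; split.
      by move: x0; rewrite (le_eqVlt 0 x) => /predU1P[<-|/hi]; rewrite h0// => /ltW.
    by rewrite -h1; move: x1; rewrite (le_eqVlt x) => /predU1P[->//|/hi/ltW].
  split; first exact/rayP.
  apply/closure_mdistP => e0 e00; have e20 : 0 < e0 / 2 by rewrite divr_gt0.
  have [n ne] := expr4_small e20; have [c' [cc' c'c f'0 fy]] := cy n _ e20.
  exists (tip c'); first by split; [exists c'|move=> /(tip_ray _ f'0)].
  apply: le_lt_trans (pt_dist_agree _ cc' _) _; last by rewrite distrC; lra.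
  by case/andP: yf => -> /le_trans; apply; case/andP: (f01 c).
move=> _ [[y /= + <-] /closure_mdistP cl]; rewrite in_itv/= => /andP[y0 yf].
exists y => //; move: y0; rewrite le_eqVlt => /predU1P[yE|y0].
  have [X0'|[d d0 fd]] := X0; first by rewrite -hXE; exists 0; rewrite ?h0.
  have [_ [[c' [f'0 ->]] _]] := cl d d0; rewrite -yE pt0 -(pt0 c') pt_dist.
  by rewrite sub0r normrN gtr0_norm// ltNge fd.
move=> n e0 e00; have [|_ [[c' [f'0 ->]] nr]] := cl (Num.min e0 (y * 4 ^- n)).
  by rewrite lt_min e00 mulr_gt0// invr_gt0 exprn_gt0.
rewrite lt_min => /andP[d1 d2]; exists c'; split => //.
- exact: pt_dist_near d2.
- by move=> cE; apply: nr; rewrite cE; apply/rayP.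
- by apply: le_lt_trans d1; rewrite plane_mdistE le_max /= distrC lexx.
Qed.

(* [tau] permutes the blades and [H c] maps the blade of [c] onto that of
   [tau c], fixing the top. *)
Definition fan_move c1 c2 := exists (tau : bits -> bits) (H : bits -> R -> R),
  [/\ involutive tau, tau c1 = c2 &
      forall c n, exists m, forall c', agree m c c' -> agree n (tau c) (tau c')] /\
  [/\ forall c s, 0 <= s <= f c -> 0 <= H c s <= f (tau c) /\ H (tau c) (H c s) = s,
      forall c, H c (f c) = f (tau c),
      forall e : R, 0 < e -> exists2 d : R, 0 < d &
        forall c s, 0 <= s <= f c -> s < d -> H c s < e &
      forall c s (e : R), 0 < s <= f c -> 0 < e -> exists m, exists2 d : R, 0 < d &
        forall c' s', 0 < s' <= f c' -> agree m c c' -> `|s - s'| < d ->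
          `|H c s - H c' s'| < e].

(** Off the origin, closeness in the plane forces long agreement of codes, so the local condition on
    [H] applies. At the origin, where all blades meet, the uniform smallness of [H] takes over. The
    map is its own inverse. *)
Lemma fan_move_homeomorphism c1 c2 : fan_move c1 c2 ->
  exists h, homeomorphism F F h /\ h (tip c1) = tip c2.
Proof.
move=> [tau [H [[tauK tau12 tauc] [HH Htip H0 Hc]]]].
have Hz c : H c 0 = 0.
  have fz : (0 : R) <= 0 <= f c by rewrite lexx; case/andP: (f01 c).
  have [/andP[Hge _] _] := HH _ _ fz; apply/eqP; rewrite eq_le Hge andbT.
  apply/ler_addgt0Pr => e e0; have [d d0 /(_ c 0 fz d0)/ltW] := H0 e e0.
  by rewrite add0r.
(* The pair [(c, s)] of a point is unique off the origin only; at the origin every pair gives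
   [origin], because [H c 0 = 0]. *)
have /choice[Phi PhiE] : forall p, exists q : plane R, forall c s, 0 <= s <= f c ->
    p = pt c s -> q = pt (tau c) (H c s).
  move=> p.
  have [[c [s [sf pE]]]|nFp] := pselect (F p); last first.
    by exists p => c s sf pE; case: nFp; exists c, s.
  exists (pt (tau c) (H c s)) => c' s' sf' pE'.
  case/andP: (sf); rewrite le_eqVlt => /predU1P[sE _|s0 _].
    have s'E : s' = 0 by apply: (@pt_eq_origin _ c'); rewrite -pE' pE -sE pt0.
    by rewrite -sE s'E !Hz !pt0.
  by have [-> ->] : c = c' /\ s = s' by apply: (pt_inj s0); rewrite -pE.
have {}PhiE c s : 0 <= s <= f c -> Phi (pt c s) = pt (tau c) (H c s).
  by move=> sf; exact: PhiE.
have PhiF p : F p -> F (Phi p).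
  move=> [c [s [sf ->]]]; rewrite PhiE//; apply: pt_Fan.
  by have [] := HH c s sf.
have PhiK p : F p -> Phi (Phi p) = p.
  move=> [c [s [sf ->]]]; have [Hf HK] := HH c s sf.
  by rewrite PhiE// PhiE// tauK HK.
have Phic : {within F, continuous Phi}.
  apply: within_continuous_mdistP => _ [c [s [sf ->]]] e e0; rewrite PhiE//.
  have [Hf _] := HH c s sf.
  have H1 : 0 <= H c s <= 1.
    by case/andP: Hf => -> /le_trans; apply; case/andP: (f01 (tau c)).
  case/andP: (sf); rewrite le_eqVlt => /predU1P[sE _|s0 sfc].
    have [d d0 Hd] := H0 e e0; exists d => // _ [c' [s' [sf' ->]]].
    rewrite PhiE// -sE Hz !pt0 -[X in mdist X _](pt0 c') pt_dist.
    rewrite -[X in mdist X _](pt0 (tau c')) pt_dist !sub0r !normrN.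
    have [/andP[H'0 _] _] := HH _ _ sf'; case/andP: (sf') => s'0 _.
    by rewrite !ger0_norm//; exact: Hd.
  have e20 : 0 < e / 2 by rewrite divr_gt0.
  have [|m [d d0 Hd]] := Hc c s (e / 2) _ e20; first by rewrite s0.
  have [n ne] := expr4_small e20; have [m' Hm'] := tauc c n.
  pose N := maxn m m'.
  exists (Num.min d (s * 4 ^- N)).
    by rewrite lt_min d0 mulr_gt0// invr_gt0 exprn_gt0.
  move=> _ [c' [s' [sf' ->]]]; rewrite lt_min => /andP[d1 d2].
  have cc' := pt_dist_near s0 d2.
  have ss' : `|s - s'| <= mdist (pt c s) (pt c' s').
    by rewrite plane_mdistE le_max lexx.
  have s'0 : 0 < s'.
    have : `|s - s'| < s.
      apply: le_lt_trans ss' (lt_le_trans d2 _).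
      by rewrite ger_pMr// invf_le1 ?exprn_gt0// exprn_ege1// ler1n.
    by rewrite ltr_norml => /andP[_]; lra.
  have {}Hd : `|H c s - H c' s'| < e / 2.
    apply: Hd; first by rewrite s'0; case/andP: sf'.
      by apply: agree_leq cc'; rewrite leq_maxl.
    exact: le_lt_trans ss' d1.
  rewrite PhiE//; apply: le_lt_trans (pt_dist_agree _ (Hm' c' _) H1) _; last by lra.
  by apply: agree_leq cc'; rewrite leq_maxr.
exists Phi; split; last by rewrite PhiE ?lexx ?andbT ?Htip ?tau12//; case/andP: (f01 c1).
split => //; first split.
- exact: PhiF.
- by move=> p q /set_mem Fp /set_mem Fq pq; rewrite -(PhiK p)// pq PhiK.
- by move=> p Fp; exists (Phi p); [exact: PhiF|exact: PhiK].
by exists Phi.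
Qed.

Lemma Fan_endpoint_homogeneous :
  (forall c1 c2, 0 < f c1 -> 0 < f c2 -> clos_refl_trans bits fan_move c1 c2) ->
  endpoint_homogeneous F.
Proof.
move=> hom e e'; rewrite Fan_endpoints// => -[c1 [f1 ->]] [c2 [f2 ->]].
elim: (hom _ _ f1 f2) => [c c' /fan_move_homeomorphism //|c|].
  exists id; split => //; split; first by split => // p Fp; exists p.
    by apply: continuous_subspaceT => p; exact: cvg_id.
  by exists id; split => //; apply: continuous_subspaceT => p; exact: cvg_id.
move=> c c' c'' _ [h [hh h1]] _ [h' [hh' h'1]]; exists (h' \o h); split.
  exact: homeomorphism_comp hh hh'.
by rewrite /= h1.
Qed.

End Criteria.

(** * Infinite products *)

Section Weights.
Context {R : realType}.
Implicit Types (c g : bits) (w : nat -> R).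

Definition wfactor w c i : R := if c i then w i else 1.

Definition wprod w n c : R := \prod_(i < n) wfactor w c i.

Definition weight w c : R := limn (wprod w ^~ c).

Definition xor_bits c g : bits := fun i => c i (+) g i.

Definition tail_from n {T} (u : nat -> T) : nat -> T := fun i => u (n + i)%N.

Definition weights w := forall i, 0 <= w i <= 1.

Lemma xor_bitsK g : involutive (xor_bits^~ g).
Proof. by move=> c; apply/funext => i; rewrite /xor_bits addbK. Qed.

Section Theory.
Variable w : nat -> R.
Hypothesis w01 : weights w.

Lemma wfactor01 c i : 0 <= wfactor w c i <= 1.
Proof. by rewrite /wfactor; case: (c i) => //; rewrite ler01 lexx. Qed.

Lemma wprodS n c : wprod w n.+1 c = wprod w n c * wfactor w c n.
Proof. by rewrite /wprod big_ord_recr. Qed.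

Lemma wprod_ge0 n c : 0 <= wprod w n c.
Proof. by apply: prodr_ge0 => i _; case/andP: (wfactor01 c i). Qed.

Lemma wprod_le m n c : (m <= n)%N -> wprod w n c <= wprod w m c.
Proof.
move=> /subnK <-; elim: (n - m)%N => [//|k IH]; rewrite addSn wprodS.
apply: le_trans IH; rewrite ler_piMr ?wprod_ge0//.
by case/andP: (wfactor01 c (k + m)).
Qed.

Lemma wprod_agree n c c' : agree n c c' -> wprod w n c = wprod w n c'.
Proof. by move=> cc'; apply: eq_bigr => i _; rewrite /wfactor cc'. Qed.

Lemma weight_cvg c : wprod w n c @[n --> \oo] --> weight w c.
Proof.
apply: nonincreasing_is_cvgn; first by move=> m n; exact: wprod_le.
by exists 0 => _ [n _ <-]; exact: wprod_ge0.
Qed.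

Lemma weight_le n c : weight w c <= wprod w n c.
Proof.
apply: nonincreasing_cvgn_ge; first by move=> a b; exact: wprod_le.
by apply: cvgP; exact: weight_cvg.
Qed.

Lemma weight_bounds c : 0 <= weight w c <= 1.
Proof.
apply/andP; split; last by have := weight_le 0 c; rewrite /wprod big_ord0.
apply: limr_ge; first by apply: cvgP; exact: weight_cvg.
by apply: nearW => n; exact: wprod_ge0.
Qed.

Lemma weight_usc : upper_semicontinuous (weight w).
Proof.
move=> c e e0; have := @weight_cvg c; move/cvgrPdist_lt => /(_ _ e0)[N _ HN].
exists N => c' cc'; apply: le_lt_trans (weight_le N c') _.
have := HN N (leqnn N); rewrite /= -(wprod_agree cc') ltr_norml => /andP[]; lra.
Qed.

Lemma weight_eventually n c : (forall m, (n <= m)%N -> c m = false) ->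
  weight w c = wprod w n c.
Proof.
move=> c0; have h : (fun=> wprod w n c) @ \oo --> weight w c.
  have := @weight_cvg c; rewrite -(cvg_shiftn n) => h.
  apply: cvg_trans h; apply: near_eq_cvg; apply: nearW => m /=.
  elim: m => [//|m IH]; rewrite addSn wprodS -IH /wfactor c0 ?mulr1//.
  exact: leq_addl.
by apply: (cvg_unique _ h); [exact: order_hausdorff|exact: cvg_cst].
Qed.

(** Factor by factor: the exponent of [w i] on the left is at least that on the right, and
    [w i <= 1]. As [xor_bits^~ g] is an involution, this bounds the ratio of the weights of
    [xor_bits c g] and [c] on both sides, in terms of [g] alone. *)
Lemma wprod_xor n c g : wprod w n (xor_bits c g) * wprod w n g <= wprod w n c.
Proof.
elim: n => [|n IH]; first by rewrite /wprod !big_ord0 mulr1.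
rewrite !wprodS mulrACA; apply: ler_pM => //.
- by rewrite mulr_ge0 ?wprod_ge0.
- have /andP[h1 _] := wfactor01 (xor_bits c g) n.
  by have /andP[h2 _] := wfactor01 g n; exact: mulr_ge0.
- rewrite /wfactor /xor_bits; have /andP[w0 w1] := w01 n.
  by case: (c n); case: (g n); rewrite /= ?mulr1 ?mul1r//; nra.
Qed.

Lemma weight_xor c g : weight w (xor_bits c g) * weight w g <= weight w c.
Proof.
apply: (@ler_cvg_to nat \oo _ R
  (fun n => wprod w n (xor_bits c g) * wprod w n g) (wprod w ^~ c)).
- by apply: cvgM; exact: weight_cvg.
- exact: weight_cvg.
- by apply: nearW => n; exact: wprod_xor.
Qed.

End Theory.

Lemma weights_tail w n : weights w -> weights (tail_from n w).
Proof. by move=> w01 i; exact: w01. Qed.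

Lemma weight_tail w n c : weights w ->
  weight w c = wprod w n c * weight (tail_from n w) (tail_from n c).
Proof.
move=> w01; have h : wprod w (m + n)%N c @[m --> \oo] --> weight w c.
  by have := @weight_cvg _ w01 c; rewrite -(cvg_shiftn n).
apply: (cvg_unique _ h); first exact: order_hausdorff.
have -> : (fun m => wprod w (m + n)%N c) =
    (fun m => wprod w n c * wprod (tail_from n w) m (tail_from n c)).
  apply/funext => m; elim: m => [|m IH]; first by rewrite /wprod big_ord0 mulr1.
  by rewrite addSn !wprodS IH mulrA {2}/wfactor /tail_from addnC.
by apply: cvgMl_tmp; apply: weight_cvg; exact: weights_tail.
Qed.

(** Each blade is mapped linearly onto its image, so everything rests on the continuity in [c] of
    the ratio [f (tau c) / f c], although [f] itself need not be continuous. *)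
Lemma weight_fan_move w c1 c2 : weights w -> 0 < weight w c1 -> 0 < weight w c2 ->
  fan_move (weight w) c1 c2.
Proof.
move=> w01; set f := weight w => f1 f2.
pose g := xor_bits c1 c2; pose tau := xor_bits^~ g.
have tauK : involutive tau := xor_bitsK g.
have f0 c : 0 <= f c by case/andP: (weight_bounds w01 c).
have fle1 c : f c <= 1 by case/andP: (weight_bounds w01 c).
have g0 : 0 < f g.
  have := weight_xor w01 g c2; rewrite /g xor_bitsK; apply: lt_le_trans.
  exact: mulr_gt0.
have fl c : f (tau c) * f g <= f c := weight_xor w01 c g.
have fr c : f c * f g <= f (tau c) by have := fl (tau c); rewrite tauK.
have pos c : 0 < f c -> 0 < f (tau c).
  by move=> fc; apply: lt_le_trans (fr c); exact: mulr_gt0.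
(* When [f c = 0] the quotient is [0] by the convention on inverses, and [s = 0] is the only
   parameter. *)
pose H c (s : R) := s * (f (tau c) / f c).
exists tau, H; split.
  split => //; first by apply/funext => i; rewrite /tau /g /xor_bits addKb.
  by move=> c n; exists n => c' cc' i ni; rewrite /tau /xor_bits cc'.
have case0 c : f c = 0 \/ 0 < f c by case: (ltgtP 0 (f c)) (f0 c) => //; [right|left].
split.
- move=> c s /andP[s0 sf]; have [fc|fc] := case0 c.
    have s00 : s = 0 by rewrite fc in sf; lra.
    by rewrite /H s00 !mul0r lexx f0.
  split; last by rewrite /H tauK; field; rewrite !gt_eqF ?pos.
  rewrite /H mulr_ge0 ?divr_ge0//= mulrCA ler_piMr// ler_pdivrMr// mul1r//.
- move=> c; rewrite /H; have [fc|fc] := case0 c; last by field; rewrite gt_eqF.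
  rewrite fc mul0r; apply/eqP; rewrite eq_le f0 /=.
  by have := fl c; rewrite fc pmulr_lle0.
- move=> e e0; exists (e * f g); first exact: mulr_gt0.
  move=> c s /andP[s0 sf] sd; have [fc|fc] := case0 c.
    by rewrite /H fc invr0 !mulr0.
  apply: (@le_lt_trans _ _ (s / f g)); last by rewrite ltr_pdivrMr.
  rewrite /H ler_wpM2l// ler_pdivrMr// mulrC ler_pdivlMr//; exact: fl.
move=> c s e /andP[s0 sf] e0; have fc := lt_le_trans s0 sf.
set K := f (tau c) / f c; have K0 : 0 < K by rewrite divr_gt0 ?pos.
(* [wprod w n g / f g] is the inverse [u] of the product of [g] beyond [n], and tends to [1] because
   [0 < f g]. For codes agreeing below [n] the ratios share their first [n] factors, while the tails
   contribute between [u^-1] and [u]; so the ratios differ by a factor at most [u ^+ 2]. *)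
have [n Hn] : exists n, K * ((wprod w n g / f g) ^+ 2 - 1) < e / 2.
  have h : K * ((wprod w n g / f g) ^+ 2 - 1) @[n --> \oo] --> K * ((f g / f g) ^+ 2 - 1).
    apply: cvgMl_tmp; apply: cvgB; last exact: cvg_cst.
    by apply: cvgM; apply: cvgMr_tmp; exact: weight_cvg.
  rewrite divff ?gt_eqF// expr1n subrr mulr0 in h.
  have e20 : 0 < e / 2 by rewrite divr_gt0.
  move/cvgrPdist_lt : h => /(_ _ e20)[N _ /(_ N (leqnn N))] /=.
  by rewrite sub0r normrN => /ltr_normlW; exists N.
exists n, (e / (2 * K)); first by apply: divr_gt0 => //; exact: mulr_gt0.
move=> c' s' /andP[s'0 sf'] cc' ss'; have fc' := lt_le_trans s'0 sf'.
pose T := weight (tail_from n w) \o tail_from n.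
have wt := weights_tail n w01.
have fT a : f a = wprod w n a * T a := weight_tail n a w01.
have TT a : T (tau a) * T g <= T a := weight_xor wt (tail_from n a) (tail_from n g).
have TT' a : T a * T g <= T (tau a) by have := TT (tau a); rewrite tauK.
have PT a : 0 < f a -> 0 < wprod w n a /\ 0 < T a.
  move=> fa; have P0 := wprod_ge0 w01 n a.
  have T0 : 0 <= T a by case/andP: (weight_bounds wt (tail_from n a)).
  by split; rewrite lt_neqAle eq_sym ?P0 ?T0 andbT; apply: contraTneq fa => z;
    rewrite fT z ?mul0r ?mulr0 ltxx.
have [Pg Tg] := PT _ g0; have [Pc Tc] := PT _ fc; have [Pc' Tc'] := PT _ fc'.
have [Pt Tt] := PT _ (pos _ fc); have [Pt' Tt'] := PT _ (pos _ fc').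
have theta : wprod w n g / f g = (T g)^-1.
  by rewrite fT invfM mulrA divff ?gt_eqF// mul1r.
have Peq : wprod w n c' = wprod w n c by apply: wprod_agree; exact: agree_sym.
have Peq' : wprod w n (tau c') = wprod w n (tau c).
  by apply: wprod_agree => i ni; rewrite /tau /xor_bits cc'.
set K' := f (tau c') / f c'; have K'0 : 0 < K' by rewrite divr_gt0 ?pos.
pose Q := wprod w n (tau c) / wprod w n c; have Q0 : 0 < Q by rewrite divr_gt0.
have KE : K = Q * (T (tau c) / T c).
  by rewrite /K /Q !fT; field; rewrite !gt_eqF.
have K'E : K' = Q * (T (tau c') / T c').
  by rewrite /K' /Q !fT Peq Peq'; field; rewrite !gt_eqF.
have Tg1 : T g <= 1 by case/andP: (weight_bounds wt (tail_from n g)).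
have ratio a : 0 < T a -> 0 < T (tau a) -> T g <= T (tau a) / T a <= (T g)^-1.
  move=> Ta Tta; rewrite ler_pdivlMr// mulrC TT'/= ler_pdivrMr// mulrC ler_pdivlMr//.
have /andP[l1 u1] := ratio _ Tc Tt; have /andP[l2 u2] := ratio _ Tc' Tt'.
have dK : `|K - K'| <= K * ((wprod w n g / f g) ^+ 2 - 1).
  rewrite theta; set u := (T g)^-1.
  have u0 : 1 <= u by rewrite /u invf_ge1.
  have uT : u * T g = 1 by rewrite /u mulVf// gt_eqF.
  set a := T (tau c) / T c; set b := T (tau c') / T c'.
  rewrite KE K'E -/a -/b -mulrBr normrM (gtr0_norm Q0) -mulrA ler_pM2l//.
  have a0 : 0 < a by rewrite divr_gt0.
  have au : 1 <= a * u by rewrite -uT mulrC ler_pM2r // (lt_le_trans _ u0).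
  have bu : b <= a * u * u by apply: le_trans u2 _; rewrite -/u; nra.
  have ab : a <= b * u * u.
    apply: le_trans u1 _; rewrite -/u.
    have : 1 <= b * u by rewrite -uT mulrC ler_pM2r // (lt_le_trans _ u0).
    nra.
  pose v := u * u; have v0 : 0 < v by rewrite mulr_gt0 // (lt_le_trans _ u0).
  clearbody a b; rewrite -!mulrA -/v in bu ab.
  (* From [a <= b * v], because [v * (2 - v) <= 1]. *)
  have bv : a * (2 - v) <= b.
    rewrite -(ler_pM2r v0); apply: le_trans _ ab.
    by have := mulr_ge0 (ltW a0) (sqr_ge0 (v - 1)); rewrite expr2; lra.
  by rewrite expr2 -/v ler_norml; apply/andP; split; lra.
rewrite /H -/K -/K'; clearbody K K'.
have -> : s * K - s' * K' = (s - s') * K + s' * (K - K') by ring.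
apply: le_lt_trans (ler_normD _ _) _; rewrite !normrM (gtr0_norm K0) (gtr0_norm s'0).
have h1 : `|s - s'| * K < e / 2.
  have -> : e / 2 = e / (2 * K) * K by field; rewrite gt_eqF.
  by rewrite ltr_pM2r.
have h2 : s' * `|K - K'| < e / 2.
  apply: le_lt_trans Hn; apply: le_trans dK.
  by rewrite ler_piMl//; apply: le_trans sf' _.
by lra.
Qed.

End Weights.

(** * Fans for the empty set, the singleton of 1 and the unit interval *)

Section Realization.
Context {R : realType}.
Implicit Types (X : set R) (f : bits -> R) (w : nat -> R) (c g : bits).

Definition homogeneous_smooth_fan X := exists (M : metricType R) (F : set M) (t : M),
  [/\ smooth_fan F t, endpoint_generated X F t & endpoint_homogeneous F].

Definition three_positive f := exists c1 c2 c3,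
  [/\ 0 < f c1, 0 < f c2 & 0 < f c3] /\ [/\ c1 != c2, c1 != c3 & c2 != c3].

Lemma Fan_realizes X f : X `<=` `[0, 1] -> (forall c, 0 <= f c <= 1) ->
  upper_semicontinuous f -> three_positive f ->
  (forall c, 0 < f c -> exists h : R -> R,
    [/\ continuous h, {homo h : u v / u < v}, h 0 = 0, h 1 = f c &
        h @` X = heights_near f c]) ->
  (X 0 \/ exists2 d : R, 0 < d & forall c, 0 < f c -> d <= f c) ->
  (forall c1 c2, 0 < f c1 -> 0 < f c2 -> clos_refl_trans bits (fan_move f) c1 c2) ->
  homogeneous_smooth_fan X.
Proof.
move=> hX f01 usc three gen X0 hom; exists (plane R), (Fan f), origin; split.
- exact: Fan_smooth.
- exact: Fan_endpoint_generated.
- exact: Fan_endpoint_homogeneous.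
Qed.

Lemma heights_near_bounds f c y : upper_semicontinuous f ->
  heights_near f c y -> 0 <= y <= f c.
Proof.
move=> usc hy; apply/andP; split; apply/ler_addgt0Pr => e e0.
  have [c' [_ _ f0]] := hy 0%N _ e0; rewrite ltr_norml => /andP[]; lra.
have e20 : 0 < e / 2 by rewrite divr_gt0.
have [n fn] := usc c _ e20.
have [c' [/fn fc _ _]] := hy n _ e20; rewrite ltr_norml => /andP[]; lra.
Qed.

Lemma scale_homeomorphism (a : R) : 0 < a ->
  [/\ continuous (fun x : R => x * a),
      {homo (fun x : R => x * a) : u v / u < v}, 0 * a = 0 & 1 * a = a].
Proof.
move=> a0; split; rewrite ?mul0r ?mul1r//.
  by move=> u; apply: cvgMr_tmp; exact: cvg_id.
by move=> u v uv; rewrite ltr_pM2r.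
Qed.

Lemma weight_three w : weights w -> 0 < w 0%N -> 0 < w 1%N -> three_positive (weight w).
Proof.
move=> w01 w0 w1; exists (fun=> false), (pred1 0%N), (pred1 1%N); split; last first.
  by split; apply/eqP => /(congr1 (fun c => (c 0%N, c 1%N))).
rewrite (@weight_eventually _ _ w01 0)// (@weight_eventually _ _ w01 1); last by case.
rewrite (@weight_eventually _ _ w01 2); last by case=> [|[]].
by rewrite !wprodS /wprod !big_ord0 /wfactor /= ?mulr1 ?mul1r.
Qed.

Lemma weight_realizes X w : X `<=` `[0, 1] -> weights w -> 0 < w 0%N -> 0 < w 1%N ->
  (forall c, 0 < weight w c ->
    heights_near (weight w) c = (fun x : R => x * weight w c) @` X) ->
  (X 0 \/ exists2 d : R, 0 < d & forall c, 0 < weight w c -> d <= weight w c) ->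
  homogeneous_smooth_fan X.
Proof.
move=> hX w01 w0 w1 gen X0; apply: (@Fan_realizes X (weight w)) => //.
- exact: weight_bounds.
- exact: weight_usc.
- exact: weight_three.
- move=> c f0; have [sc si s0 s1] := scale_homeomorphism f0.
  by exists (fun x : R => x * weight w c); split => //; rewrite gen.
- by move=> c1 c2 f1 f2; apply: rt_step; exact: weight_fan_move.
Qed.

(** Two weights [1] followed by zeros leave four blades, all of height [1], so endpoints accumulate
    nowhere. *)
Lemma realizes_set0 : homogeneous_smooth_fan (set0 : set R).
Proof.
pose w i : R := if (i < 2)%N then 1 else 0.
have w01 : weights w by move=> i; rewrite /w; case: ifP; rewrite ?ler01 ?lexx.
have pos c : 0 < weight w c -> forall i, (1 < i)%N -> c i = false.
  move=> f0 i i1; apply/negbTE/negP => ci; move: f0; rewrite ltNge => /negP; apply.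
  apply: le_trans (weight_le w01 i.+1 c) _.
  by rewrite wprodS /wfactor ci /w ltnNge i1 /= mulr0.
apply: (@weight_realizes set0 w) => //; rewrite ?/w//.
  move=> c f0; rewrite image_set0; apply/seteqP; split => // y /(_ 2%N 1 ltr01).
  move=> [c' [cc' c'c f'0 _]]; apply: c'c; apply/funext => i.
  by have [i2|i2] := ltnP i 2; [rewrite cc'|rewrite (pos c' f'0) ?(pos c f0)].
right; exists 1 => // c f0; rewrite (weight_eventually w01 (pos c f0)).
rewrite /wprod big1// => i _; rewrite /wfactor /w (ltn_ord i).
by case: (c i).
Qed.

Lemma xor_pred1 c n : agree n c (xor_bits c (pred1 n)) /\ xor_bits c (pred1 n) <> c.
Proof.
split=> [i ni|/(congr1 (@^~ n))]; first by rewrite /xor_bits /= (ltn_eqF ni) addbF.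
by rewrite /xor_bits /= eqxx; case: (c n).
Qed.

(** With all weights [1] every blade has height [1]: this is the cone over the Cantor set. *)
Lemma realizes_set1 : homogeneous_smooth_fan ([set 1] : set R).
Proof.
pose w (_ : nat) : R := 1.
have w01 : weights w by move=> i; rewrite /w ler01 lexx.
have f1 c : weight w c = 1.
  have h : wprod w n c @[n --> \oo] --> (1 : R).
    rewrite (_ : wprod w ^~ c = fun=> 1); first exact: cvg_cst.
    by apply/funext => n; rewrite /wprod big1// => i _; rewrite /wfactor; case: (c i).
  exact: (cvg_lim (@order_hausdorff _ R) h).
apply: (@weight_realizes _ w) => //.
- by move=> _ ->; rewrite /= in_itv/= ler01 lexx.
- move=> c _; rewrite f1 image_set1 mulr1; apply/seteqP; split => [y hy|_ -> n e e0].
    apply/eqP; rewrite eq_sym -subr_eq0 -normr_le0; apply/ler_addgt0Pr => e e0.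
    by have [c' [_ _ _]] := hy 0%N _ e0; rewrite f1 add0r => /ltW.
  have [a b] := xor_pred1 c n.
  by exists (xor_bits c (pred1 n)); rewrite !f1 subrr normr0.
- by right; exists 1 => // c _; rewrite f1.
Qed.

(* The weights [(i + 1) / (i + 2)] telescope, have product [0] and tend to [1]:
   ones on a block starting far away bring the height of a blade close to
   any smaller value. *)
Lemma realizes_interval : homogeneous_smooth_fan (`[0, 1]%classic : set R).
Proof.
pose w i : R := i.+1%:R / i.+2%:R.
have w0 i : 0 < w i by rewrite divr_gt0.
have w01 : weights w.
  by move=> i; rewrite ltW//= ler_pdivrMr// mul1r ler_nat.
apply: (@weight_realizes _ w) => //; last first.
  by left; rewrite /= in_itv/= lexx ler01.
move=> c; set f := weight w => f0; apply/seteqP; split => [y|_ [x /= + <-]].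
  move=> /(heights_near_bounds (weight_usc w01)) /andP[y0 yf]; exists (y / f c).
    by apply/itv01P; rewrite divr_ge0 ?(ltW f0)//= ler_pdivrMr// mul1r.
  by rewrite /= divfK// gt_eqF.
rewrite in_itv/= => /andP[x0 x1]; set y := x * f c.
have y0 : 0 <= y by rewrite mulr_ge0// ltW.
have yf : y <= f c by rewrite ler_piMl// ltW.
move=> n e e0.
have [N0 Ne] : exists N : nat, N.+1%:R^-1 < e / 3.
  have e30 : 0 < e / 3 by rewrite divr_gt0.
  have [N _ H] := near_infty_natSinv_lt (PosNum e30).
  by exists N; exact: (H N (leqnn N)).
pose N1 := maxn n N0.
have [N2 HN2] : exists N2, forall N, (N2 <= N)%N -> wprod w N c < f c + e / 2.
  have e20 : 0 < e / 2 by rewrite divr_gt0.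
  have := @weight_cvg _ _ w01 c; move/cvgrPdist_lt => /(_ _ e20)[N2 _ HN2].
  exists N2 => N N2N; have := HN2 N N2N.
  by rewrite /= ltr_norml => /andP[]; rewrite -/f; lra.
pose N := maxn N1 N2; pose p := wprod w N c.
have pf : f c <= p := weight_le w01 N c.
have p0 : 0 < p := lt_le_trans f0 pf.
have p1 : p <= 1.
  by have := wprod_le w01 c (leq0n N); rewrite {2}/wprod big_ord0.
(* The weights from [N] to [M] excluded telescope to [N.+1 / M.+1], so [a M] is the height of the
   code [c' M], which copies [c] below [N] and has ones exactly up to [M] after that. *)
pose a M : R := p * N.+1%:R / M.+1%:R.
pose c' M : bits := fun i => if (i < N)%N then c i else (i < M)%N.
have fc' M : (N <= M)%N -> f (c' M) = a M.
  move=> NM; rewrite /f (@weight_eventually _ _ w01 M); last first.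
    by move=> m Mm; rewrite /c' !ltnNge Mm (leq_trans NM Mm).
  rewrite -(subnK NM); elim: (M - N)%N => [|k IH].
    rewrite add0n /a mulfK ?pnatr_eq0//; apply: wprod_agree => i iN.
    by rewrite /c' iN.
  rewrite addSn wprodS (@wprod_agree _ w _ _ (c' (k + N)%N)); last first.
    move=> i ik; rewrite /c'; case: ifP => // _.
    by rewrite ik (ltn_trans ik (ltnSn _)).
  rewrite IH /wfactor {1}/c' ltnNge leq_addl /= ltnSn /a /w.
  by rewrite mulrA divfK// pnatr_eq0.
have cc' M : agree n c (c' M).
  by move=> i ni; rewrite /c' ifT// (leq_trans ni)// /N /N1 -maxnA leq_maxl.
have a0 M : 0 < a M by rewrite divr_gt0 ?mulr_gt0.
have adec M : (N <= M)%N -> a M - e / 3 <= a M.+1.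
  move=> NM; have : a M - a M.+1 <= N0.+1%:R^-1; last by move: Ne; set u := _^-1; lra.
  have -> : a M - a M.+1 = (p * (N.+1%:R / M.+1%:R)) * M.+2%:R^-1.
    rewrite /a -(natr1 M.+1); have : 0 < M.+1%:R :> R by rewrite ltr0n.
    move: (M.+1%:R : R) (N.+1%:R : R) => u v u0; field.
    by rewrite !gt_eqF ?addr_gt0.
  apply: (@le_trans _ _ (M.+2%:R^-1)).
    rewrite ler_piMl ?invr_ge0// mulr_ile1 ?divr_ge0 ?(ltW p0)//.
    by rewrite ler_pdivrMr// mul1r ler_nat ltnS.
  rewrite lef_pV2 ?posrE// ler_nat ltnS; apply: leqW; apply: leq_trans NM.
  by rewrite /N /N1 -maxnA maxnCA leq_maxl.
have amono M : a M.+1 <= a M.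
  by rewrite /a ler_pM2l ?mulr_gt0// lef_pV2 ?posrE// ler_nat.
(* The heights start at [p >= y] and drop by at most [e / 3] each time, so the first one below
   [y + e / 2] is above [y - e / 2], and its successor is still within [e] of [y]. *)
have [M [NM aM aM1]] : exists M, [/\ (N <= M)%N, `|a M - y| < e & `|a M.+1 - y| < e].
  have exM : exists M, (N <= M)%N && (a M < y + e / 2).
    have e20 : 0 < e / 2 by rewrite divr_gt0.
    have q0 : 0 < e / 2 / (p * N.+1%:R) by rewrite divr_gt0 ?mulr_gt0.
    have [K _ HK] := near_infty_natSinv_lt (PosNum q0).
    exists (maxn N K); rewrite leq_maxl /=.
    have := HK (maxn N K) (leq_maxr N K); rewrite /= /a.
    by rewrite ltr_pdivlMr ?mulr_gt0// mulrC => h; apply: lt_le_trans h _; lra.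
  case: (ex_minnP exM) => M /andP[NM aM] Mmin; exists M.
  have am := amono M; have ad := adec M NM.
  suff yl : y - e / 2 < a M by split => //; rewrite ltr_norml; apply/andP; split; lra.
  have [MN|NltM] := leqP M N.
    have -> : M = N by apply/eqP; rewrite eqn_leq MN.
    by rewrite /a mulfK ?pnatr_eq0//; lra.
  case: M NltM {NM aM Mmin am ad} (adec M.-1) (Mmin M.-1) => // M NM /(_ NM) /= ad Mm.
  have : ~~ (a M < y + e / 2).
    by apply/negP => h; move: Mm; rewrite (NM : (N <= M)%N) h ltnn => /(_ isT).
  by rewrite -leNgt; lra.
(* [c' M] and [c' M.+1] differ at bit [M], so at least one of them is not [c]. *)
have [cM|cM] := eqVneq (c' M) c; last first.
  by exists (c' M); split; rewrite -/f ?fc'//; exact/eqP.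
exists (c' M.+1); split; rewrite -/f ?fc' ?(leqW NM)// => cM1.
have : c' M M = c' M.+1 M by rewrite cM cM1.
by rewrite /c' ltnNge NM /= ltnn ltnSn.
Qed.

End Realization.

(** * Self-similar heights *)

Section Bend.
Context {R : realType}.
Implicit Types (p q k x y : R).

(** Piecewise linear, of slope [p] below [k] and [p + q] above; the positive part of [x - k] is
    written with an absolute value, so that continuity needs no gluing. *)
Definition bend p q k x := p * x + q * ((x - k + `|x - k|) / 2).

Lemma bend_low p q k x : x <= k -> bend p q k x = p * x.
Proof. by move=> xk; rewrite /bend ler0_norm ?subr_le0// subrr mul0r mulr0 addr0. Qed.

Lemma bend_high p q k x : k <= x -> bend p q k x = p * x + q * (x - k).
Proof. by move=> xk; rewrite /bend ger0_norm ?subr_ge0//; field. Qed.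

Lemma bend_continuous p q k : continuous (bend p q k).
Proof.
move=> x; have cx : (fun x => x - k) y @[y --> x] --> x - k.
  by apply: cvgB; [exact: cvg_id|exact: cvg_cst].
apply: cvgD; first by apply: cvgMl_tmp; exact: cvg_id.
apply: cvgMl_tmp; apply: cvgMr_tmp; apply: cvgD; first exact: cx.
exact: (@cvg_norm _ R^o).
Qed.

Lemma bend_homo p q k : 0 < p -> 0 < q -> {homo bend p q k : x y / x < y}.
Proof.
move=> p0 q0 x y xy; have [xk|kx] := leP x k; have [yk|ky] := leP y k.
- by rewrite !bend_low// ltr_pM2l.
- rewrite bend_low// bend_high ?(ltW ky)//; nra.
- lra.
- rewrite !bend_high ?ltW//; nra.
Qed.

(** The inverse is again a bend, with slopes [p^-1] and [(p + q)^-1] and its break at [p * k]. *)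
Lemma bendK p q k : 0 < p -> 0 < q ->
  cancel (bend p q k) (bend p^-1 ((p + q)^-1 - p^-1) (p * k)).
Proof.
move=> p0 q0 x; have pq := addr_gt0 p0 q0; have [xk|/ltW kx] := leP x k.
  by rewrite (bend_low p q xk) bend_low ?ler_pM2l// mulKf// gt_eqF.
rewrite (bend_high p q kx) bend_high; last by nra.
by field; rewrite !gt_eqF.
Qed.

Lemma bendVK p q k : 0 < p -> 0 < q ->
  cancel (bend p^-1 ((p + q)^-1 - p^-1) (p * k)) (bend p q k).
Proof.
move=> p0 q0 y; have pq := addr_gt0 p0 q0; have [yk|ky] := leP y (p * k).
  rewrite (bend_low _ _ yk) bend_low ?mulVKf ?gt_eqF//.
  by rewrite mulrC ler_pdivrMr// mulrC.
have E : p^-1 * y + ((p + q)^-1 - p^-1) * (y - p * k) = k + (y - p * k) / (p + q).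
  by field; rewrite !gt_eqF.
rewrite (bend_high _ _ (ltW ky)) E bend_high; last first.
  by rewrite lerDl; apply: divr_ge0; rewrite ?subr_ge0 ltW.
by field; rewrite gt_eqF.
Qed.

End Bend.

Section Runs.
Implicit Types (c v : bits).

Definition zeros : bits := fun=> false.

Definition cons_run n v : bits :=
  fun i => if (i < n)%N then false else if i == n then true else v (i - n.+1)%N.

Lemma bit_shift_cons_run0 v : bit_shift (cons_run 0 v) = v.
Proof. by apply/funext => i; rewrite /bit_shift /cons_run /= subSS subn0. Qed.

Lemma bit_shift_cons_runS n v : bit_shift (cons_run n.+1 v) = cons_run n v.
Proof. by apply/funext => i; rewrite /bit_shift /cons_run ltnS eqSS subSS. Qed.

Lemma cons_run_add n v i : cons_run n v (n.+1 + i)%N = v i.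
Proof.
rewrite /cons_run addSn ltnNge leqW ?leq_addr//= gtn_eqF ?ltnS ?leq_addr//.
by rewrite subSS addKn.
Qed.

Lemma cons_run_lt n v i : (i < n.+1)%N -> cons_run n v i = (i == n).
Proof.
rewrite ltnS /cons_run => iln; case: ltnP => [iltn|nli]; first by rewrite ltn_eqF.
by rewrite eqn_leq iln nli.
Qed.

Lemma agree_cons_run n k v c : agree (n.+1 + k) (cons_run n v) c <->
  exists2 v', agree k v v' & c = cons_run n v'.
Proof.
split=> [H|[v' vv' -> i ik]]; last first.
  have [iln|nli] := ltnP i n.+1; first by rewrite !cons_run_lt.
  by rewrite -(subnKC nli) !cons_run_add vv'// -(ltn_add2l n.+1) subnKC.
exists (tail_from n.+1 c).
  by move=> i ik; rewrite /tail_from -H ?ltn_add2l// cons_run_add.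
apply/funext => i; have [iln|nli] := ltnP i n.+1.
  by rewrite -H ?(leq_trans iln) ?leq_addr// !cons_run_lt.
by rewrite -(subnKC nli) cons_run_add.
Qed.

Lemma tail_cons_run n v : tail_from n.+1 (cons_run n v) = v.
Proof. by apply/funext => i; rewrite /tail_from cons_run_add. Qed.

Lemma agree_cons_run_same n k v v' : agree k v v' ->
  agree (n.+1 + k) (cons_run n v) (cons_run n v').
Proof. by move=> vv'; apply/agree_cons_run; exists v'. Qed.

Lemma runs_case c : c = zeros \/ exists n v, c = cons_run n v.
Proof.
have [[i ci]|nc] := pselect (exists i, c i); last first.
  by left; apply/funext => i; apply/negbTE/negP => ci; apply: nc; exists i.
right; have ex : exists i, c i by exists i.
case: (ex_minnP ex) => n cn nmin; exists n, (tail_from n.+1 c).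
apply/funext => j; have [jn|nj] := ltnP j n.+1.
  rewrite cons_run_lt//; have [->//|jnn] := eqVneq j n.
  apply/negbTE/negP => /nmin; rewrite leqNgt ltn_neqAle jnn /=.
  by rewrite -ltnS jn.
by rewrite -(subnKC nj) cons_run_add.
Qed.

Lemma cons_run_neq0 n v : cons_run n v <> zeros.
Proof. by move/(congr1 (@^~ n)); rewrite cons_run_lt// eqxx. Qed.

End Runs.

Section Tree.
Context {R : realType} (b : R) (a : nat -> R).
Hypotheses (b01 : 0 < b < 1) (a0b : forall n, 0 < a n <= b).
Implicit Types (c v : bits) (x : R).

(** Dividing by [n.+2] makes the slopes tend to [0] and, already for [n = 0], leaves [slope n] below
    [a n], so that [graft n] also increases beyond [b]. *)
Definition slope n := a n / n.+2%:R.

(* Nearly flat on [[0, b]], which holds the heights of all blades but the main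
   one, and taking the value [a n] at [1]. *)
Definition graft n : R -> R := bend (slope n) ((a n - slope n) / (1 - b)) b.

Definition ungraft n : R -> R :=
  bend (slope n)^-1 ((slope n + (a n - slope n) / (1 - b))^-1 - (slope n)^-1)
    (slope n * b).

Let b0 : 0 < b. Proof. by case/andP: b01. Qed.
Let b1 : b < 1. Proof. by case/andP: b01. Qed.
Let a0 n : 0 < a n. Proof. by case/andP: (a0b n). Qed.
Let ab n : a n <= b. Proof. by case/andP: (a0b n). Qed.

Let slope0 n : 0 < slope n. Proof. by rewrite divr_gt0. Qed.

Let slope_half n : slope n <= a n / 2.
Proof. by rewrite /slope ler_pM2l// lef_pV2 ?posrE// ler_nat. Qed.

Let second0 n : 0 < (a n - slope n) / (1 - b).
Proof. by rewrite divr_gt0 ?subr_gt0//; have := slope_half n; have := a0 n; lra. Qed.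

Lemma graft_continuous n : continuous (graft n).
Proof. exact: bend_continuous. Qed.

Lemma ungraft_continuous n : continuous (ungraft n).
Proof. exact: bend_continuous. Qed.

Lemma graft_homo n : {homo graft n : x y / x < y}.
Proof. exact: bend_homo. Qed.

Lemma graftK n : cancel (graft n) (ungraft n).
Proof. exact: bendK. Qed.

Lemma ungraftK n : cancel (ungraft n) (graft n).
Proof. exact: bendVK. Qed.

Lemma graft_mono n x y : (graft n x <= graft n y) = (x <= y).
Proof. exact/le_mono/graft_homo. Qed.

Lemma graft0 n : graft n 0 = 0.
Proof. by rewrite /graft bend_low ?mulr0// ltW. Qed.

Lemma graft1 n : graft n 1 = a n.
Proof.
rewrite /graft bend_high ?(ltW b1)//; field.
by rewrite subr_eq0 gt_eqF.
Qed.

Lemma graft_low n x : x <= b -> graft n x = slope n * x.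
Proof. exact: bend_low. Qed.

Lemma graft_lt n x : 0 < x <= 1 -> graft n x < x.
Proof.
move=> /andP[x0 x1]; have [xb|bx] := leP x b.
  rewrite graft_low// gtr_pMl//; have := slope_half n; have := ab n; have := b1; lra.
apply: le_lt_trans bx; apply: le_trans (ab n).
by rewrite -graft1 graft_mono.
Qed.

(* [n] is the number of bits read, [j] the length of the current run of zeros. *)
Fixpoint tree_part n j c : R :=
  if n is n'.+1 then
    if c 0%N then graft j (tree_part n' 0 (bit_shift c))
    else tree_part n' j.+1 (bit_shift c)
  else 1.

Lemma tree_part01 n j c : 0 <= tree_part n j c <= 1.
Proof.
elim: n j c => [|n IH] j c /=; first by rewrite ler01 lexx.
case: ifP => // _; have /andP[h0 h1] := IH 0%N (bit_shift c).
rewrite -(graft0 j) graft_mono h0 /=.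
rewrite -(graft_mono j) graft1 in h1; apply: le_trans h1 _.
exact: le_trans (ab j) (ltW b1).
Qed.

Lemma tree_part_decr n j c : tree_part n.+1 j c <= tree_part n j c.
Proof.
elim: n j c => [|n IH] j c; first by case/andP: (tree_part01 1 j c).
have E m : tree_part m.+1 j c = if c 0%N then graft j (tree_part m 0 (bit_shift c))
    else tree_part m j.+1 (bit_shift c) by [].
by rewrite (E n) (E n.+1); case: ifP => _; rewrite ?graft_mono; exact: IH.
Qed.

Lemma tree_part_agree n j c c' : agree n c c' -> tree_part n j c = tree_part n j c'.
Proof.
elim: n j c c' => [//|n IH] j c c' /agreeS[c0 cc'] /=.
by rewrite c0 !(IH _ _ _ cc').
Qed.

Definition tree j c : R := limn (fun n => tree_part n j c).

Lemma tree_cvg j c : tree_part n j c @[n --> \oo] --> tree j c.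
Proof.
apply: nonincreasing_is_cvgn.
  by apply/nonincreasing_seqP => n; exact: tree_part_decr.
by exists 0 => _ [n _ <-]; case/andP: (tree_part01 n j c).
Qed.

Lemma tree_le n j c : tree j c <= tree_part n j c.
Proof.
apply: nonincreasing_cvgn_ge.
  by apply/nonincreasing_seqP => m; exact: tree_part_decr.
by apply: cvgP; exact: tree_cvg.
Qed.

Lemma tree01 j c : 0 <= tree j c <= 1.
Proof.
apply/andP; split; last exact: (tree_le 0 j c).
apply: limr_ge; first by apply: cvgP; exact: tree_cvg.
by apply: nearW => n; case/andP: (tree_part01 n j c).
Qed.

Lemma tree_usc j : upper_semicontinuous (tree j).
Proof.
move=> c e e0; have := @tree_cvg j c; move/cvgrPdist_lt => /(_ _ e0)[N _ HN].
exists N => c' cc'; apply: le_lt_trans (tree_le N j c') _.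
have := HN N (leqnn N); rewrite /= -(tree_part_agree j cc') ltr_norml => /andP[]; lra.
Qed.

Lemma treeE j c : tree j c =
  if c 0%N then graft j (tree 0 (bit_shift c)) else tree j.+1 (bit_shift c).
Proof.
have h1 : tree_part n.+1 j c @[n --> \oo] --> tree j c.
  by have := @tree_cvg j c; rewrite -cvg_shiftS.
apply: (cvg_unique _ h1); first exact: order_hausdorff.
rewrite /=; case: ifP => _; last exact: tree_cvg.
by apply: (cvg_comp _ _ (@tree_cvg 0%N (bit_shift c))); exact: graft_continuous.
Qed.

Lemma tree_zeros j : tree j zeros = 1.
Proof.
have h : tree_part n j zeros @[n --> \oo] --> (1 : R).
  rewrite (_ : (fun n => _) = fun=> 1); first exact: cvg_cst.
  by apply/funext => n; elim: n j => [//|n IH] j /=; rewrite -[RHS](IH j.+1).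
exact: (cvg_lim (@order_hausdorff _ R) h).
Qed.

Lemma tree_cons_run j n v : tree j (cons_run n v) = graft (j + n) (tree 0 v).
Proof.
elim: n j => [|n IH] j; rewrite treeE cons_run_lt//=.
  by rewrite bit_shift_cons_run0 addn0.
by rewrite bit_shift_cons_runS IH addSnnS.
Qed.

Local Notation f := (tree 0).

Lemma tree_le_b c : c <> zeros -> f c <= b.
Proof.
have [->//|[n [v ->]] _] := runs_case c.
rewrite tree_cons_run add0n; apply: le_trans (ab n).
by rewrite -graft1 graft_mono; case/andP: (tree01 0 v).
Qed.

Lemma tree_pos_cons_run n v : (0 < f (cons_run n v)) = (0 < f v).
Proof. by rewrite tree_cons_run add0n !ltNge -{1}(graft0 n) graft_mono. Qed.

(** Apart from the main blade all heights are at most [b], where [graft n] has slope at most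
    [1 / 2]. Each further block thus halves the height, and a height above [2 ^- k] bounds the
    number of blocks. *)
Lemma tree_ind (Q : bits -> Prop) : Q zeros ->
  (forall n v, 0 < f v -> Q v -> Q (cons_run n v)) ->
  forall c, 0 < f c -> Q c.
Proof.
move=> Q0 QS; suff H k : forall c, 2 ^- k < f c -> Q c.
  move=> c fc; have h : (fun n => (2^-1 : R) ^+ n) @ \oo --> (0 : R).
    by apply: cvg_expr; rewrite gtr0_norm ?invr_gt0// invf_lt1// ltr1n.
  move: h => /cvgrPdist_lt /(_ _ fc)[N _ /(_ N (leqnn N))] /=.
  rewrite sub0r normrN exprVn ger0_norm ?invr_ge0 ?exprn_ge0//; exact: H.
elim: k => [|k IH] c.
  by rewrite expr0 invr1 ltNge; case/andP: (tree01 0 c) => _ ->.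
have [->//|[n [v ->]]] := runs_case c => fc.
have f0 : 0 < f v.
  by rewrite -(tree_pos_cons_run n); apply: lt_trans fc; rewrite invr_gt0 exprn_gt0.
apply: (QS n v f0); have [->//|/eqP v0] := eqVneq v zeros; apply: IH.
have vb := tree_le_b v0; move: fc; rewrite tree_cons_run add0n graft_low//.
rewrite exprS invfM => fc; have := slope_half n; have := ab n; have := b1 => ? ? ?.
have : slope n * f v <= 2^-1 * f v by rewrite ler_pM2r//; lra.
by move=> h; have := lt_le_trans fc h; rewrite ltr_pM2l.
Qed.

End Tree.

Section TreeFan.
Context {R : realType} (b : R) (a : nat -> R).
Hypotheses (b01 : 0 < b < 1) (a0b : forall n, 0 < a n <= b).
Implicit Types (c v : bits) (x s : R).

Local Notation f := (tree b a 0).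
Local Notation graft := (graft b a).
Local Notation ungraft := (ungraft b a).

Let f01 := tree01 b01 a0b 0.
Let fcons n v : f (cons_run n v) = graft n (f v).
Proof. by rewrite tree_cons_run. Qed.

Let graft0 n : graft n 0 = 0. Proof. exact: graft0. Qed.
Let graftK n : cancel (graft n) (ungraft n). Proof. exact: graftK. Qed.
Let ungraftK n : cancel (ungraft n) (graft n). Proof. exact: ungraftK. Qed.
Let graft_mono n x y : (graft n x <= graft n y) = (x <= y).
Proof. exact: graft_mono. Qed.
Let graft_cont n : continuous (graft n). Proof. exact: graft_continuous. Qed.
Let ungraft_cont n : continuous (ungraft n). Proof. exact: ungraft_continuous. Qed.

Let ungraft0 n : ungraft n 0 = 0.
Proof. by rewrite -[X in ungraft _ X](graft0 n) graftK. Qed.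

Let cont_delta (h : R -> R) x (e : R) : continuous h -> 0 < e ->
  exists2 d : R, 0 < d & forall y, `|x - y| < d -> `|h x - h y| < e.
Proof.
move=> hc e0; have : nbhs x (h @^-1` ball (h x) e) by apply: hc; exact: nbhsx_ballx.
by move=> /nbhs_ballP[d /= d0 H]; exists d => // y xy; exact: H.
Qed.

Lemma tree_three : three_positive f.
Proof.
exists zeros, (cons_run 0 zeros), (cons_run 1 zeros); split.
  by rewrite !fcons !tree_zeros// !graft1//; split => //;
    [case/andP: (a0b 0%N)|case/andP: (a0b 1%N)].
by split; apply/eqP => /(congr1 (fun c => (c 0%N, c 1%N))).
Qed.

(** Codes agreeing with [cons_run n v] past position [n] are of the form [cons_run n v'] with [v']
    near [v], and their heights are transported by the homeomorphism [graft n]. *)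
Lemma tree_heights_cons_run n v :
  heights_near f (cons_run n v) = graft n @` heights_near f v.
Proof.
apply/seteqP; split => [y hy|_ [y hy <-] k e e0].
  exists (ungraft n y); rewrite ?ungraftK// => k e e0.
  have [d d0 Hd] := cont_delta y (@ungraft_cont n) e0.
  have [c' [/agree_cons_run[v' vv' ->] c'c f'0 fy]] := hy (n.+1 + k)%N d d0.
  exists v'; split => //.
  - by move=> vE; apply: c'c; rewrite vE.
  - by rewrite tree_pos_cons_run in f'0.
  - by rewrite -(graftK n (f v')) -fcons distrC; apply: Hd; rewrite distrC.
have [d d0 Hd] := cont_delta y (@graft_cont n) e0.
have [v' [vv' v'v f'0 fy]] := hy k d d0.
exists (cons_run n v'); split.
- by move=> i ik; apply: (@agree_cons_run_same n _ _ _ vv'); lia.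
- by move=> cE; apply: v'v; rewrite -(tail_cons_run n v') cE tail_cons_run.
- by rewrite tree_pos_cons_run.
- by rewrite fcons distrC; apply: Hd; rewrite distrC.
Qed.

(** Codes near [zeros] are [cons_run m v] with [m] large. If [v] is [zeros] the height is [a m],
    close to [X]; otherwise [f v <= b] and the height is at most [slope a m], close to [0], a point
    of [X]. *)
Lemma tree_heights_zeros (X : set R) : closed X -> X 0 ->
  (forall n, exists2 x, X x & `|a n - x| <= n.+1%:R^-1) ->
  (forall x N (e : R), X x -> 0 < e -> exists2 n, (N <= n)%N & `|a n - x| < e) ->
  heights_near f zeros = X.
Proof.
move=> cX X0 aX Xa; apply/seteqP; split => [y hy|x Xx n e e0].
  apply: cX => B /nbhs_ballP[e /= e0 eB]; have e20 : 0 < e / 2 by rewrite divr_gt0.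
  have [N _ HN] := near_infty_natSinv_lt (PosNum e20).
  suff [x Xx fx] : exists2 x, X x & `|y - x| < e by exists x; split => //; exact: eB.
  have [c' [zc' c'0 f'0 fy]] := hy N _ e20.
  have [//|[m [v cE]]] := runs_case c'; subst c'.
  have Nm : (N <= m)%N.
    rewrite leqNgt; apply/negP => mN; have := zc' m mN.
    by rewrite cons_run_lt// eqxx.
  have small : m.+1%:R^-1 < e / 2 := HN m Nm.
  have [vE|/eqP v0] := eqVneq v zeros.
    have [x Xx ax] := aX m; exists x => //.
    rewrite fcons vE tree_zeros// graft1// in fy.
    have -> : y - x = (y - a m) + (a m - x) by ring.
    apply: le_lt_trans (ler_normD _ _) _; rewrite (distrC y).
    by apply: lt_le_trans (ltr_leD fy ax) _; move: small; set u := _^-1; lra.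
  exists 0 => //; rewrite subr0 -[y](subKr (f (cons_run m v))).
  apply: le_lt_trans (ler_normB _ _) _.
  have fb : f v <= b by exact: tree_le_b.
  have /andP[v0' v1] := f01 v.
  have am : 0 < a m <= b := a0b m.
  rewrite fcons (@graft_low _ b a) // in fy *.
  have sl : 0 <= slope a m * f v <= m.+1%:R^-1.
    rewrite /slope mulr_ge0 ?divr_ge0//; last by case/andP: am => /ltW.
    apply: (@le_trans _ _ (m.+2%:R^-1)); last by rewrite lef_pV2 ?posrE// ler_nat.
    case/andP: am => a0 ab; case/andP: b01 => b0 b1.
    have s0 : 0 <= (m.+2%:R^-1 : R) by rewrite invr_ge0.
    have h1 : a m * m.+2%:R^-1 <= m.+2%:R^-1.
      by rewrite ler_piMl// (le_trans ab)// ltW.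
    by apply: le_trans h1; rewrite ler_piMr// mulr_ge0// ltW.
  case/andP: sl => sl0 sl1; rewrite (ger0_norm sl0).
  by move: small fy sl1; set u := _^-1; lra.
have [m nm mx] := Xa x n e Xx e0; exists (cons_run m zeros); split.
- by move=> i ni; rewrite cons_run_lt ?ltn_eqF// ?(leq_trans ni) ?(leqW nm).
- exact: cons_run_neq0.
- by rewrite fcons tree_zeros// graft1//; case/andP: (a0b m).
- by rewrite fcons tree_zeros// graft1.
Qed.

(* Exchanging the cylinder of length [N] around [v] with its copy inside the
   cylinder of [cons_run n v] is an involution. *)
Lemma tree_fan_move n v : 0 < f v -> fan_move f v (cons_run n v).
Proof.
(* Grafting strictly lowers positive heights, so the two codes differ, and some length [N] makes the
   cylinders disjoint. *)
move=> fv; have nv : v <> cons_run n v.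
  move=> vE; have := @graft_lt _ b a b01 a0b n (f v).
  by rewrite fv -fcons -vE ltxx; case/andP: (f01 v) => _ -> /(_ isT).
have [N nN] : exists N, ~ agree N v (cons_run n v).
  by apply/existsNP => H; apply: nv; exact: agree_eq.
pose inA c := `[< agree N v c >].
pose inB c := `[< agree (n.+1 + N) (cons_run n v) c >].
have AB c : inA c -> inB c = false.
  move=> /asboolP Ac; apply/negbTE/negP => /asboolP Bc; apply: nN.
  apply: agree_trans Ac (agree_sym _).
  by apply: agree_leq Bc; rewrite leq_addl.
have AconsB c : inA c -> inB (cons_run n c).
  by move=> /asboolP Ac; apply/asboolP; exact: agree_cons_run_same.
have BE c : inB c -> exists2 v', inA v' & c = cons_run n v'.
  by move=> /asboolP/agree_cons_run[v' vv' ->]; exists v' => //; exact/asboolP.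
pose tau c := if inA c then cons_run n c else if inB c then tail_from n.+1 c else c.
pose H c s := if inA c then graft n s else if inB c then ungraft n s else s.
have BA c : inB c -> inA c = false.
  by move=> Bc; apply/negbTE/negP => /AB; rewrite Bc.
have inv c : inA c -> f (tail_from n.+1 (cons_run n c)) = f c by rewrite tail_cons_run.
exists tau, H; split; split.
- move=> c; rewrite /tau; case: (boolP (inA c)) => [Ac|nAc].
    by rewrite (BA _ (AconsB _ Ac)) AconsB// tail_cons_run.
  case: (boolP (inB c)) => [/BE[v' Av' ->]|nBc].
    by rewrite tail_cons_run Av'.
  by rewrite (negbTE nAc) (negbTE nBc).
- by rewrite /tau (_ : inA v)//; apply/asboolP.
(* Long enough to settle in which cylinder both codes lie, and to leave [k] common bits after [n.+1]
   are dropped. *)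
- move=> c k; exists (n.+1 + (N + k))%N => c' cc'.
  have c1 : agree N c c' by apply: agree_leq cc'; lia.
  have c2 : agree (n.+1 + N) c c' by apply: agree_leq cc'; lia.
  have eA : inA c' = inA c.
    by apply/asboolP/asboolP => h; apply: agree_trans h _ => //; exact: agree_sym.
  have eB : inB c' = inB c.
    by apply/asboolP/asboolP => h; apply: agree_trans h _ => //; exact: agree_sym.
  rewrite /tau eA eB; case: ifP => _; last case: ifP => _.
  + have ck : agree k c c' by apply: agree_leq cc'; lia.
    by move=> i ik; apply: (@agree_cons_run_same n _ _ _ ck); lia.
  + by move=> i ik; rewrite /tail_from cc'//; lia.
  + by apply: agree_leq cc'; lia.
- move=> c s /andP[s0 sf]; rewrite /tau /H; case: (boolP (inA c)) => [Ac|nAc].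
    rewrite (BA _ (AconsB _ Ac)) AconsB// graftK fcons graft_mono sf.
    by rewrite -{1}(graft0 n) graft_mono s0.
  case: (boolP (inB c)) => [/BE[v' Av' cE]|nBc].
    rewrite cE tail_cons_run Av' ungraftK; rewrite cE fcons in sf.
    rewrite -(graft_mono n 0) graft0 ungraftK s0.
    by rewrite -(graft_mono n (ungraft n s)) ungraftK sf.
  by rewrite (negbTE nAc) (negbTE nBc) s0 sf.
- move=> c; rewrite /tau /H; case: (boolP (inA c)) => [Ac|nAc]; first by rewrite fcons.
  case: (boolP (inB c)) => [/BE[v' Av' cE]|nBc] //.
  by rewrite cE tail_cons_run fcons graftK.
- move=> e e0.
  have [d1 d10 H1] := cont_delta 0 (@graft_cont n) e0.
  have [d2 d20 H2] := cont_delta 0 (@ungraft_cont n) e0.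
  exists (Num.min (Num.min d1 d2) e); first by rewrite !lt_min d10 d20.
  move=> c s /andP[s0 _]; rewrite !lt_min -andbA => /and3P[s1 s2 se].
  have ns : `|0 - s| = s by rewrite sub0r normrN ger0_norm.
  rewrite /H; case: ifP => _; last case: ifP => _ //.
    by have := H1 s; rewrite ns graft0 sub0r normrN => /(_ s1)/ltr_normlW.
  by have := H2 s; rewrite ns ungraft0 sub0r normrN => /(_ s2)/ltr_normlW.
- move=> c s e /andP[s0 sf] e0; exists (n.+1 + N)%N.
  have [h hc hE] : exists2 h, continuous h &
      forall c', agree (n.+1 + N) c c' -> H c' = h.
    have eq c' : agree (n.+1 + N) c c' -> H c' = H c.
      move=> cc'; have c1 : agree N c c' by apply: agree_leq cc'; lia.
      have eA : inA c' = inA c.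
        by apply/asboolP/asboolP => h; apply: agree_trans h _ => //; exact: agree_sym.
      have eB : inB c' = inB c.
        by apply/asboolP/asboolP => h; apply: agree_trans h _ => //; exact: agree_sym.
      by apply/funext => x; rewrite /H eA eB.
    exists (H c) => //; rewrite /H; case: (inA c); first exact: graft_cont.
    case: (inB c); first exact: ungraft_cont.
    by move=> x; exact: cvg_id.
  have [d d0 Hd] := cont_delta s hc e0; exists d => // c' s' _ cc' ss'.
  by rewrite (hE c')// (hE c)//; exact: Hd.
Qed.

Lemma fan_move_sym (g : bits -> R) c1 c2 : fan_move g c1 c2 -> fan_move g c2 c1.
Proof.
move=> [tau [H [[tauK tau12 tauc] HH]]]; exists tau, H; split => //; split => //.
by rewrite -tau12 tauK.
Qed.

Lemma tree_moves c1 c2 : 0 < f c1 -> 0 < f c2 ->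
  clos_refl_trans bits (fan_move f) c1 c2.
Proof.
have root c : 0 < f c -> clos_refl_trans bits (fan_move f) zeros c /\
    clos_refl_trans bits (fan_move f) c zeros.
  move: c; apply: (tree_ind b01 a0b); first by split; exact: rt_refl.
  move=> n v fv [IH1 IH2]; have mv := tree_fan_move n fv; split.
    by apply: (rt_trans _ _ _ _ _ IH1); exact: rt_step.
  by apply: (rt_trans _ _ _ _ _ _ IH2); apply: rt_step; exact: fan_move_sym.
by move=> /root[_ h1] /root[h2 _]; exact: (rt_trans _ _ _ _ _ h1 h2).
Qed.

(** On the main blade [X] sits with the identity as parametrization; each block composes with
    [graft n], an increasing homeomorphism fixing [0]. *)
Lemma tree_parametrization (X : set R) : heights_near f zeros = X ->
  forall c, 0 < f c -> exists h : R -> R,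
    [/\ continuous h, {homo h : u v / u < v}, h 0 = 0, h 1 = f c &
        h @` X = heights_near f c].
Proof.
move=> hX; apply: (tree_ind b01 a0b).
  exists id; rewrite tree_zeros// hX image_id; split => // x; exact: cvg_id.
move=> n v fv [h [hc hi h0 h1 hE]]; exists (graft n \o h); split.
- by move=> x; apply: continuous_comp; [exact: hc|exact: graft_cont].
- by move=> x y /hi; exact: graft_homo.
- by rewrite /= h0 graft0.
- by rewrite /= h1 fcons.
- by rewrite -image_comp hE tree_heights_cons_run.
Qed.

End TreeFan.

(** * Sequences clustering exactly at a given closed set *)

Section ClusterSequence.
Context {R : realType}.
Implicit Types (X : set R) (b x e : R).

Lemma closed_unit_gap X : closed X -> X `<=` `[0, 1] -> ~ X 1 ->
  exists b, 0 < b < 1 /\ forall x, X x -> x < b.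
Proof.
move=> cX hX nX1; have : nbhs (1 : R) (~` X).
  by apply: open_nbhs_nbhs; split => //; exact/closed_openC.
move=> /nbhs_ballP[e /= e0 eX]; pose e' := Num.min e 1.
have e'0 : 0 < e' by rewrite lt_min e0 ltr01.
have e'1 : e' <= 1 by rewrite ge_min lexx orbT.
have e'e : e' <= e by rewrite ge_min lexx.
exists (1 - e' / 2); split; first by apply/andP; split; lra.
move=> x Xx; rewrite ltNge; apply/negP => bx; apply: (eX x _ Xx).
have /itv01P/andP[_ x1] := hX x Xx.
by rewrite /ball /= ger0_norm ?subr_ge0//; lra.
Qed.

(* Level [k] of the sequence, the indices [n] with [2 ^ k <= n.+1 < 2 ^ k.+1],
   scans [X] on the grid of mesh [2 ^- k]. *)
Lemma cluster_sequence X b : X 0 -> X `<=` `[0, 1] -> b < 1 ->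
    (forall x, X x -> x < b) ->
  exists a : nat -> R, [/\ forall n, 0 < a n <= b,
    forall n, exists2 x, X x & `|a n - x| <= n.+1%:R^-1 &
    forall x N e, X x -> 0 < e -> exists2 n, (N <= n)%N & `|a n - x| < e].
Proof.
move=> X0 hX b1 Xb.
pose k n := trunc_log 2 n.+1.
pose q n : R := (n.+1 - 2 ^ k n)%N%:R / 2 ^+ k n.
(* A point of [X] within one mesh of the grid point [q n] if there is any, and the default [0] in
   [X] otherwise. *)
have pick n : exists x, X x /\
    forall y, X y -> `|y - q n| < 2 ^- k n -> `|x - q n| < 2 ^- k n.
  have [[x [Xx xq]]|nx] := pselect (exists x, X x /\ `|x - q n| < 2 ^- k n).
    by exists x.
  by exists 0; split => // y Xy yq; case: nx; exists y.
have [g gP] := choice pick.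
(* The shift towards [b] makes the value positive even if [g n = 0], keeps it at most [b], and
   vanishes in the limit. *)
pose a n := g n + (b - g n) / n.+2%:R.
have gX n : X (g n) by have [] := gP n.
have g0 n : 0 <= g n by have /itv01P/andP[] := hX _ (gX n).
have gb n : 0 < b - g n by rewrite subr_gt0; exact: Xb.
have small n : 0 < (b - g n) / n.+2%:R <= n.+2%:R^-1.
  rewrite divr_gt0//= ler_piMl ?invr_ge0//; have := g0 n; lra.
exists a; split.
- move=> n; have /andP[s0 s1] := small n; rewrite /a ltr_wpDl//=.
  rewrite -lerBrDl ler_piMr ?(ltW (gb n))// invf_le1 ?ltr0n// ler1n//.
- move=> n; exists (g n) => //; rewrite /a addrAC subrr add0r.
  have /andP[s0 s1] := small n; rewrite gtr0_norm//; apply: le_trans s1 _.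
  by rewrite lef_pV2 ?posrE// ler_nat.
move=> x N e Xx e0.
have [K HK] : exists K : nat, 2 ^- K < e / 4 :> R.
  have h : (fun n => (2^-1 : R) ^+ n) @ \oo --> (0 : R).
    by apply: cvg_expr; rewrite gtr0_norm ?invr_gt0// invf_lt1// ltr1n.
  have e40 : 0 < e / 4 by rewrite divr_gt0.
  move: h => /cvgrPdist_lt /(_ _ e40)[M _ /(_ M (leqnn M))] /=.
  by rewrite sub0r normrN exprVn ger0_norm ?invr_ge0 ?exprn_ge0//; exists M.
have [L HL] : exists L : nat, L.+1%:R^-1 < e / 4 :> R.
  have e40 : 0 < e / 4 by rewrite divr_gt0.
  have [M _ H] := near_infty_natSinv_lt (PosNum e40).
  by exists M; exact: (H M (leqnn M)).
pose m := maxn K (maxn L N).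
have p0 : 0 < 2 ^+ m :> R by rewrite exprn_gt0.
have x0 : 0 <= x by have /itv01P/andP[] := hX _ Xx.
have x1 : x < 1 := lt_trans (Xb _ Xx) b1.
pose i := Num.truncn (x * 2 ^+ m).
have xm0 : 0 <= x * 2 ^+ m by rewrite mulr_ge0// ltW.
have /andP[i1 i2] : i%:R <= x * 2 ^+ m < i.+1%:R := Num.Theory.truncn_itv xm0.
have im : (i < 2 ^ m)%N.
  rewrite -(ltr_nat R) natrX; apply: le_lt_trans i1 _.
  by rewrite gtr_pMl.
have pm : (0 < 2 ^ m)%N by rewrite expn_gt0.
(* The index that scans, at level [m], the last grid point not above [x]. *)
pose n := (2 ^ m + i).-1.
have nE : n.+1 = (2 ^ m + i)%N by rewrite /n prednK// addn_gt0 pm.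
have kn : k n = m.
  by apply: trunc_log_eq => //; rewrite nE leq_addr /= expnS mul2n -addnn ltn_add2l.
have mn : (m < n.+1)%N by rewrite nE (leq_trans (ltn_expl m (ltnSn 1)))// leq_addr.
exists n; first by rewrite -ltnS (leq_ltn_trans _ mn)// /m !leq_max leqnn !orbT.
have qn : q n = i%:R / 2 ^+ m by rewrite /q kn nE addKn.
have xq : `|x - q n| < 2 ^- m.
  rewrite qn; have -> : x - i%:R / 2 ^+ m = (x * 2 ^+ m - i%:R) / 2 ^+ m.
    by field; rewrite gt_eqF.
  rewrite normrM (gtr0_norm (_ : 0 < (2 ^+ m)^-1)) ?invr_gt0//.
  rewrite gtr_pMl ?invr_gt0// ger0_norm ?subr_ge0//.
  by rewrite ltrBlDr addrC natr1.
have gq : `|g n - q n| < 2 ^- m.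
  by have [_] := gP n; rewrite kn => /(_ x Xx xq).
have me : 2 ^- m < e / 4 :> R.
  apply: le_lt_trans HK; rewrite lef_pV2 ?posrE ?exprn_gt0//.
  by apply: ler_weXn2l; [rewrite ler1n|rewrite leq_maxl].
have ae : (b - g n) / n.+2%:R < e / 4.
  have /andP[_ s1] := small n; apply: le_lt_trans s1 (le_lt_trans _ HL).
  rewrite lef_pV2 ?posrE// ler_nat ltnS; apply: leqW.
  by rewrite -ltnS (leq_ltn_trans _ mn)// /m !leq_max leqnn !orbT.
have /andP[s0 _] := small n.
move: xq gq me ae s0; rewrite /a !ltr_norml; set u := (b - g n) / _; set v := 2 ^- m.
move=> /andP[? ?] /andP[? ?] ? ? ?; apply/andP; split; lra.
Qed.

End ClusterSequence.

(** * Adding an isolated 1 *)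

Section Doubling.
Context {R : realType}.
Implicit Types (X : set R) (f : bits -> R) (c u v : bits).

Definition evens c : bits := fun i => c i.*2.
Definition odds c : bits := fun i => c i.*2.+1.
Definition merge u v : bits := fun i => if odd i then v i./2 else u i./2.

Lemma evens_merge u v : evens (merge u v) = u.
Proof. by apply/funext => i; rewrite /evens /merge odd_double doubleK. Qed.

Lemma odds_merge u v : odds (merge u v) = v.
Proof.
by apply/funext => i; rewrite /odds /merge /= odd_double /= uphalf_double.
Qed.

Lemma merge_evens_odds c : merge (evens c) (odds c) = c.
Proof.
apply/funext => i; rewrite /merge /evens /odds -[in RHS](odd_double_half i).
by case: (odd i).
Qed.

Lemma agree_merge n u u' v v' : agree n u u' -> agree n v v' ->
  agree n (merge u v) (merge u' v').
Proof.
move=> uu' vv' i ni; have h : (i./2 < n)%N by lia.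
by rewrite /merge uu' ?vv'.
Qed.

Lemma agree_evens n c c' : agree n.*2 c c' -> agree n (evens c) (evens c').
Proof. by move=> cc' i ni; apply: cc'; rewrite ltn_double. Qed.

Lemma agree_odds n c c' : agree n.*2 c c' -> agree n (odds c) (odds c').
Proof. by move=> cc' i ni; apply: cc'; rewrite -doubleS leq_double. Qed.

Section DoubledFunction.
Variable f : bits -> R.
Hypotheses (f01 : forall c, 0 <= f c <= 1) (usc : upper_semicontinuous f).

Let f2 c := f (evens c).

Lemma doubled_usc : upper_semicontinuous f2.
Proof.
move=> c e e0; have [n Hn] := usc (evens c) e0.
by exists n.*2 => c' /agree_evens /Hn.
Qed.

Lemma doubled_three : three_positive f -> three_positive f2.
Proof.
move=> [c1 [c2 [c3 [[f1 f2_ f3] [c12 c13 c23]]]]].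
exists (merge c1 zeros), (merge c2 zeros), (merge c3 zeros).
rewrite /f2 !evens_merge; split => //.
by split; apply/eqP => /(congr1 evens); rewrite !evens_merge; apply/eqP.
Qed.

(** Flipping a far odd bit changes the code but not the height, which puts [f2 c] into the cluster
    set. Any other cluster value is approached by heights different from [f2 c], so the even parts
    of the codes differ from that of [c]. *)
Lemma doubled_heights c : 0 < f2 c ->
  heights_near f2 c = heights_near f (evens c) `|` [set f2 c].
Proof.
move=> fc; apply/seteqP; split => [y hy|y [hy|->] n e e0].
- have [->|/eqP yf] := eqVneq y (f2 c); first by right.
  left => n e e0; pose e' := Num.min e `|f2 c - y|.
  have e'0 : 0 < e' by rewrite lt_min e0 normr_gt0 subr_eq0 eq_sym; exact/eqP.
  have [c' [/agree_evens cc' c'c fc']] := hy n.*2 e' e'0.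
  rewrite lt_min => /andP[h1 h2]; exists (evens c'); split => //.
  by move=> cE; move: h2; rewrite /f2 cE ltxx.
- have [u [cu uc fu fy]] := hy n e e0; exists (merge u (odds c)).
  rewrite /f2 evens_merge; split => //.
    by rewrite -{1}(merge_evens_odds c); exact: agree_merge.
  by move=> mc; apply: uc; rewrite -mc evens_merge.
- have [h1 h2] := xor_pred1 (odds c) n.
  exists (merge (evens c) (xor_bits (odds c) (pred1 n))).
  rewrite /f2 evens_merge subrr normr0; split => //.
    by rewrite -{1}(merge_evens_odds c); exact: agree_merge.
  by move=> mc; apply: h2; rewrite -[RHS](congr1 odds mc) odds_merge.
Qed.

Lemma doubled_move_evens u u' v : fan_move f u u' ->
  fan_move f2 (merge u v) (merge u' v).
Proof.
move=> [tau [H [[tauK tau12 tauc] [HH Htip H0 Hc]]]].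
exists (fun c => merge (tau (evens c)) (odds c)), (fun c => H (evens c)).
split; split.
- by move=> c; rewrite evens_merge odds_merge tauK merge_evens_odds.
- by rewrite evens_merge odds_merge tau12.
- move=> c n; have [m Hm] := tauc (evens c) n; exists (maxn m n).*2 => c' cc'.
  apply: agree_merge.
    apply: Hm; apply: agree_evens; apply: agree_leq cc'.
    by rewrite leq_double leq_maxl.
  by apply: agree_odds; apply: agree_leq cc'; rewrite leq_double leq_maxr.
- by move=> c s sf; rewrite /f2 evens_merge; exact: HH.
- by move=> c; rewrite /f2 evens_merge; exact: Htip.
- move=> e e0; have [d d0 Hd] := H0 e e0; exists d => // c s; exact: Hd.
- move=> c s e sf e0; have [m [d d0 Hd]] := Hc (evens c) s e sf e0.
  by exists m.*2, d => // c' s' sf' /agree_evens cc'; exact: Hd.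
Qed.

Lemma doubled_move_odds u v v' : fan_move f2 (merge u v) (merge u v').
Proof.
pose g := xor_bits v v'.
exists (fun c => merge (evens c) (xor_bits (odds c) g)), (fun _ s => s).
split; split.
- by move=> c; rewrite evens_merge odds_merge xor_bitsK merge_evens_odds.
- rewrite evens_merge odds_merge; congr merge.
  by apply/funext => i; rewrite /g /xor_bits addKb.
- move=> c n; exists n.*2 => c' cc'; apply: agree_merge; first exact: agree_evens.
  by have := agree_odds cc' => h i ni; rewrite /xor_bits h.
- by move=> c s sf; rewrite /f2 evens_merge.
- by move=> c; rewrite /f2 evens_merge.
- by move=> e e0; exists e.
- by move=> c s e _ e0; exists 0%N, e.
Qed.

(** The even bits are moved along a chain for [f] with the odd bits frozen; one translation of the
    odd bits, which leaves heights alone, does the rest. *)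
Lemma doubled_moves :
  (forall c1 c2, 0 < f c1 -> 0 < f c2 -> clos_refl_trans bits (fan_move f) c1 c2) ->
  forall c1 c2, 0 < f2 c1 -> 0 < f2 c2 -> clos_refl_trans bits (fan_move f2) c1 c2.
Proof.
move=> hom c1 c2 fc1 fc2; rewrite -(merge_evens_odds c1) -(merge_evens_odds c2).
apply: (rt_trans _ _ _ (merge (evens c2) (odds c1))); last first.
  by apply: rt_step; exact: doubled_move_odds.
elim: (hom _ _ fc1 fc2) => [u u' uu'|u|u u' u'' _ h1 _ h2].
- by apply: rt_step; exact: doubled_move_evens.
- exact: rt_refl.
- exact: (rt_trans _ _ _ _ _ h1 h2).
Qed.

End DoubledFunction.

End Doubling.

(** * Assembling the equivalence *)

Section Sufficiency.
Context {R : realType}.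
Implicit Types X : set R.

Let tree_data X : closed X -> X `<=` `[0, 1] -> X 0 -> ~ X 1 ->
  exists b a, [/\ 0 < b < 1, forall n, 0 < a n <= b &
    heights_near (tree b a 0) zeros = X].
Proof.
move=> cX hX X0 nX1; have [b [b01 Xb]] := closed_unit_gap cX hX nX1.
have b1 : b < 1 by case/andP: b01.
have [a [a0b aX Xa]] := cluster_sequence X0 hX b1 Xb.
by exists b, a; split => //; exact: tree_heights_zeros.
Qed.

Lemma realizes_without_one X : closed X -> X `<=` `[0, 1] -> X 0 -> ~ X 1 ->
  homogeneous_smooth_fan X.
Proof.
move=> cX hX X0 nX1; have [b [a [b01 a0b hE]]] := tree_data cX hX X0 nX1.
apply: (@Fan_realizes R X (tree b a 0)) => //.
- exact: tree01.
- exact: tree_usc.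
- exact: tree_three.
- exact: tree_parametrization.
- by left.
- exact: tree_moves.
Qed.

Lemma realizes_isolated_one X : closed X -> X `<=` `[0, 1] -> X 0 -> ~ X 1 ->
  homogeneous_smooth_fan (X `|` [set 1]).
Proof.
move=> cX hX X0 nX1; have [b [a [b01 a0b hE]]] := tree_data cX hX X0 nX1.
pose f := tree b a 0; have f01 := tree01 b01 a0b 0.
apply: (@Fan_realizes R _ (fun c => f (evens c))).
- by move=> x [/hX//|->]; rewrite /= in_itv/= ler01 lexx.
- by move=> c; exact: f01.
- exact/doubled_usc/tree_usc.
- exact/doubled_three/tree_three.
- move=> c fc; have [h [hc hi h0 h1 hXE]] := tree_parametrization b01 a0b hE fc.
  exists h; split => //.
  by rewrite doubled_heights // image_setU hXE image_set1 h1.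
- by left; left.
- exact/doubled_moves/tree_moves.
Qed.

Lemma realizes_classification X : X `<=` `[0, 1] ->
  [\/ (X = set0 \/ X = [set 1] \/ X = `[0, 1]%classic),
       [/\ closed X, X 0 & ~ X 1] |
       [/\ closed X, X 0, X 1 & isolated X 1]] ->
  homogeneous_smooth_fan X.
Proof.
move=> hX [[->|[->|->]]|[cX X0 nX1]|[cX X0 X1 [_ [V V1 VX]]]].
- exact: realizes_set0.
- exact: realizes_set1.
- exact: realizes_interval.
- exact: realizes_without_one.
(* Removing the interior of an isolating neighbourhood of [1] leaves a closed set without [1]; it
   keeps [0], since [V] meets [X] in [1] only. *)
have XE : X = X `&` ~` V° `|` [set 1].
  apply/seteqP; split => [x Xx|x [[]//|->//]].
  have [Vx|nVx] := pselect (V° x); last by left.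
  by right; rewrite -VX; split => //; exact: interior_subset.
rewrite XE; apply: realizes_isolated_one.
- by apply: closedI => //; apply: open_closedC; exact: open_interior.
- by move=> x [/hX].
- split => //; move=> /interior_subset V0.
  have : (V `&` X) 0 by [].
  by rewrite VX => /esym/eqP; rewrite oner_eq0.
- by move=> [_]; apply.
Qed.

End Sufficiency.

Theorem corollary5p4 (R : realType) (X : set R) (hX : X `<=` `[0, 1]) :
  ((exists (M : metricType R) (F : set M) (t : M),
      [/\ smooth_fan F t, endpoint_generated X F t & endpoint_homogeneous F])
   <->
   (exists (M : metricType R) (F : set M) (t : M),
      smooth_fan F t /\ endpoint_generated X F t))
  /\
  ((exists (M : metricType R) (F : set M) (t : M),
      smooth_fan F t /\ endpoint_generated X F t)
   <->
   [\/ (X = set0 \/ X = [set 1] \/ X = `[0, 1]%classic),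
       [/\ closed X, X 0 & ~ X 1] |
       [/\ closed X, X 0, X 1 & isolated X 1]]).
Proof.
have weaken : homogeneous_smooth_fan X -> exists (M : metricType R) (F : set M) (t : M),
    smooth_fan F t /\ endpoint_generated X F t.
  by move=> [M [F [t [sF gF _]]]]; exists M, F, t.
split; split.
- exact: weaken.
- move=> [M [F [t [sF gF]]]].
  (* The given fan is discarded: only the classification of [X] is kept, and a new homogeneous fan
     is built from it. *)
  exact: realizes_classification hX (generator_classification sF gF hX).
- by move=> [M [F [t [sF gF]]]]; exact: generator_classification sF gF hX.
- by move=> /(realizes_classification hX); exact: weaken.
Qed.
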